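(* Let $(M,g)$ be a Lorentzian 4-manifold with coframes $\vartheta$, Pauli matrices $\sigma$, second order Pauli matrices $\sigma_{\alpha\beta ab}$ and spinor fields $\xi$ as specified in the context. Call two coframes equivalent if they differ by a transformation from the group $H$, and call two spinor fields equivalent if they differ by a constant complex factor of modulus 1. Then the equivalence classes of coframes $\vartheta$ and the equivalence classes of nonvanishing spinor fields $\xi$ are in one-to-one correspondence, the correspondence being given by the formula: there is a constant $c\in\mathbb{C}$, $|c|=1$, such that $$(l\wedge m)_{\alpha\beta}=c\,\sigma_{\alpha\beta ab}\,\xi^a\xi^b ,$$ where $l=\vartheta^0+\vartheta^3$, $m=\vartheta^1+i\vartheta^2$, and $\vartheta$ and $\xi$ are arbitrary representatives of the corresponding equivalence classes. Furthermore, whenever $\vartheta$ and $\xi$ correspond to each other in this way, $$L_{\mathrm{tele}}(\vartheta)=-\tfrac43\,L_{\mathrm{Weyl}}(\xi),$$ where $L_{\mathrm{tele}}(\vartheta):=l\wedge T^{\mathrm{ax}}$ with $T^{\mathrm{ax}}:=\frac13\,o_{jk}\,\vartheta^j\wedge d\vartheta^k$, and $$L_{\mathrm{Weyl}}(\xi):=\frac i2\left(\bar\xi^{\dot b}\sigma^\alpha{}_{a\dot b}\{\nabla\}_\alpha\xi^a-\xi^a\sigma^\alpha{}_{a\dot b}\{\nabla\}_\alpha\bar\xi^{\dot b}\right)*1 .$$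
   Context: All objects are smooth. $M$ is a 4-manifold with a prescribed Lorentzian metric $g$ (not necessarily flat) of signature $(+,-,-,-)$; everything is local, so $M$ is understood to be a small (contractible) coordinate neighbourhood of a point, on which a fixed reference coframe $\boldsymbol\vartheta$ is given. Local coordinates are restricted to those with $\det\boldsymbol\vartheta^j_\alpha>0$. Summation over repeated indices is used; Greek indices are tensor indices, raised and lowered with $g$; $o_{jk}=o^{jk}=\operatorname{diag}(1,-1,-1,-1)$. Differential forms are identified with antisymmetric tensors, so $(u\wedge v)_{\alpha\beta}=u_\alpha v_\beta-u_\beta v_\alpha$ for covectors; $d$ is the exterior derivative. Coframes. A coframe is a quartet of real covector fields $\vartheta^j$, $j=0,1,2,3$, with $g=o_{jk}\,\vartheta^j\otimes\vartheta^k$, $\det\vartheta^j_\alpha>0$ and $g(\boldsymbol\vartheta^0,\vartheta^0)>0$ (inner product on covectors). The forward light cone at a point is the set of covectors $c_j\vartheta^j$ with $o^{jk}c_jc_k=0$, $c_0>0$. Group $H$. It consists of Lorentz transformations $\vartheta^j\mapsto\tilde\vartheta^j=\Lambda^j{}_k\vartheta^k$, where the $\Lambda^j{}_k$ are real scalar functions with $o_{jk}\Lambda^j{}_r\Lambda^k{}_s=o_{rs}$, $\det\Lambda>0$, $\Lambda^0{}_0>0$, such that $\tilde l\wedge\tilde m=e^{i\varphi}\,l\wedge m$ for some constant $\varphi\in\mathbb{R}$, where $\tilde l=\tilde\vartheta^0+\tilde\vartheta^3$, $\tilde m=\tilde\vartheta^1+i\tilde\vartheta^2$. Hodge star. For an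 antisymmetric tensor $R$ of rank $r$, $( *R)_{\alpha_{r+1}\ldots\alpha_4}:=(r!)^{-1}\sqrt{|\det g|}\,R^{\alpha_1\ldots\alpha_r}\varepsilon_{\alpha_1\ldots\alpha_4}$ with $\varepsilon$ totally antisymmetric, $\varepsilon_{0123}=+1$. In particular $*1$ is the volume 4-form. Spinors. A spinor field is a $\mathbb{C}^2$-valued function $\xi^a$, $a=1,2$; $\bar\xi^{\dot a}$ is its complex conjugate. It is nonvanishing if it is nonzero at every point. Put $\epsilon_{ab}=\epsilon_{\dot a\dot b}=\epsilon^{ab}=\epsilon^{\dot a\dot b}=\begin{pmatrix}0&1\\-1&0\end{pmatrix}$ (first index: rows). Pauli matrices are fixed Hermitian $2\times2$ matrix-functions $\sigma_{\alpha a\dot b}$, $\alpha=0,1,2,3$, with $\sigma^\alpha{}_{a\dot b}\sigma^{\beta c\dot b}+\sigma^\beta{}_{a\dot b}\sigma^{\alpha c\dot b}=2g^{\alpha\beta}\delta_a{}^c$, where $\sigma^{\alpha a\dot b}=\epsilon^{ac}\epsilon^{\dot b\dot d}\sigma^\alpha{}_{c\dot d}$. Second order Pauli matrices are $$\sigma_{\alpha\beta ac}:=\tfrac12\left(\sigma_{\alpha a\dot b}\epsilon^{\dot b\dot d}\sigma_{\beta c\dot d}-\sigma_{\beta a\dot b}\epsilon^{\dot b\dot d}\sigma_{\alpha c\dot d}\right).$$ It is assumed that the Pauli matrices agree with the time orientation and orientation of the coframes: for every nonzero $\xi$ the covector $\sigma_{\alpha a\dot b}\xi^a\bar\xi^{\dot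 b}$ lies on the forward light cone, and $*\sigma=-i\sigma$, where $( *\sigma)_{\gamma\delta ab}:=\frac12\sqrt{|\det g|}\,\sigma^{\alpha\beta}{}_{ab}\,\varepsilon_{\alpha\beta\gamma\delta}$. The Pauli matrices are not otherwise assumed to be related to the coframe $\vartheta$. Covariant derivative. $\{\nabla\}$ is the Levi-Civita covariant derivative, acting on spinor fields by $$\{\nabla\}_\alpha\xi^a:=\partial_\alpha\xi^a+\tfrac14\sigma_\beta{}^{a\dot c}\left(\partial_\alpha\sigma^\beta{}_{b\dot c}+\{\Gamma\}^\beta{}_{\alpha\gamma}\sigma^\gamma{}_{b\dot c}\right)\xi^b,$$ where $\{\Gamma\}^\beta{}_{\alpha\gamma}$ are the Christoffel symbols of $g$, and $\{\nabla\}_\alpha\bar\xi^{\dot a}$ is the complex conjugate of $\{\nabla\}_\alpha\xi^a$. *)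

(* Defs.v *)
From HB Require Import structures.
From mathcomp Require Import all_boot all_order all_algebra.
From mathcomp Require Import complex.
From mathcomp Require Import all_classical all_reals all_analysis.

Set Implicit Arguments.
Unset Strict Implicit.
Unset Printing Implicit Defensive.

Import Order.TTheory GRing.Theory Num.Theory.
Import numFieldNormedType.Exports.

Local Open Scope classical_set_scope.
Local Open Scope ring_scope.

(* The manifold is a coordinate domain U in R^4, and a field on it is the
   collection of its components in these coordinates, given as functions on the
   whole of R^4: all conditions below are imposed at the points of U only, and
   the values outside U carry no meaning. *)

Definition contractible (R : realType) (U : set 'rV[R]_4) : Prop :=
  exists (x0 : 'rV[R]_4) (h : R * 'rV[R]_4 -> 'rV[R]_4),
    [/\ U x0,
        {within [set p | 0 <= p.1 <= 1 /\ U p.2], continuous h},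
        forall t x, 0 <= t <= 1 -> U x -> U (h (t, x)),
        forall x, U x -> h (0, x) = x
      & forall x, U x -> h (1, x) = x0].

Definition coord_nbhd (R : realType) (U : set 'rV[R]_4) : Prop :=
  open U /\ contractible U.

Definition pd (R : realType) (al : 'I_4) (f : 'rV[R]_4 -> R) (x : 'rV[R]_4) : R :=
  'D_(delta_mx 0 al) f x.

Definition pdC (R : realType) (al : 'I_4) (f : 'rV[R]_4 -> R[i])
    (x : 'rV[R]_4) : R[i] :=
  (pd al (fun y => complex.Re (f y)) x +i* pd al (fun y => complex.Im (f y)) x)%C.

Fixpoint Ck (R : realType) (U : set 'rV[R]_4) (k : nat) (f : 'rV[R]_4 -> R) :
    Prop :=
  (forall x, U x -> {for x, continuous f}) /\
  (if k is k'.+1 then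
     forall al : 'I_4,
       (forall x, U x -> derivable f x (delta_mx 0 al)) /\ Ck U k' (pd al f)
   else True).

Definition smooth (R : realType) (U : set 'rV[R]_4) (f : 'rV[R]_4 -> R) : Prop :=
  forall k, Ck U k f.

Definition smoothC (R : realType) (U : set 'rV[R]_4) (f : 'rV[R]_4 -> R[i]) :
    Prop :=
  smooth U (fun x => complex.Re (f x)) /\ smooth U (fun x => complex.Im (f x)).

(* Antisymmetric tensors of ranks 1 to 4 are given by all their components. *)

Definition form1 (K : Type) := 'I_4 -> K.
Definition form2 (K : Type) := 'I_4 -> 'I_4 -> K.
Definition form3 (K : Type) := 'I_4 -> 'I_4 -> 'I_4 -> K.
Definition form4 (K : Type) := 'I_4 -> 'I_4 -> 'I_4 -> 'I_4 -> K.

Definition wedge11 (K : comNzRingType) (u v : form1 K) : form2 K :=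
  fun a b => u a * v b - u b * v a.

Definition wedge12 (K : comNzRingType) (u : form1 K) (w : form2 K) : form3 K :=
  fun a b c => u a * w b c - u b * w a c + u c * w a b.

Definition wedge13 (K : comNzRingType) (u : form1 K) (w : form3 K) : form4 K :=
  fun a b c d =>
    u a * w b c d - u b * w a c d + u c * w a b d - u d * w a b c.

Definition ext_d1 (R : realType) (u : 'rV[R]_4 -> form1 R) (x : 'rV[R]_4) :
    form2 R :=
  fun a b => pd a (fun y => u y b) x - pd b (fun y => u y a) x.

(* The totally antisymmetric symbol with value 1 on (0, 1, 2, 3): the
   determinant of the matrix whose rows are the basis vectors a, b, c, d. *)
Definition levi_civita (R : realType) : form4 R :=
  fun a b c d => \det (\matrix_(i < 4, j < 4) (tnth [tuple a; b; c; d] i == j)%:R).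

Definition eta (R : realType) : 'M[R]_4 :=
  \matrix_(j < 4, k < 4) (if j == k then (if j == 0 then 1 else -1) else 0).

(* g x al be is g_{al be}(x); signature (+,-,-,-) is expressed by congruence
   to eta. *)
Definition lorentz_metric (R : realType) (U : set 'rV[R]_4)
    (g : 'rV[R]_4 -> 'M[R]_4) : Prop :=
  (forall al be, smooth U (fun x => g x al be)) /\
  (forall x, U x ->
     exists2 P : 'M[R]_4, P \in unitmx & g x = P^T *m eta R *m P).

Definition cov_inner (R : realType) (gx : 'M[R]_4) (u v : form1 R) : R :=
  \sum_(al < 4) \sum_(be < 4) invmx gx al be * u al * v be.

Definition christoffel (R : realType) (g : 'rV[R]_4 -> 'M[R]_4)
    (be al ga : 'I_4) (x : 'rV[R]_4) : R :=
  2^-1 * \sum_(de < 4) invmx (g x) be de *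
    (pd al (fun y => g y ga de) x + pd ga (fun y => g y al de) x
     - pd de (fun y => g y al ga) x).

(* The Hodge dual *1 of the constant 1. *)
Definition vol_form (R : realType) (gx : 'M[R]_4) : form4 R :=
  fun a b c d => Num.sqrt `|\det gx| * levi_civita R a b c d.

(* The Hodge star in rank 2, on complex-valued tensors. *)
Definition hodge2 (R : realType) (gx : 'M[R]_4) (w : form2 R[i]) : form2 R[i] :=
  fun ga de =>
    2^-1 * (Num.sqrt `|\det gx|)%:C%C *
    \sum_(al < 4) \sum_(be < 4)
      (\sum_(mu < 4) \sum_(nu < 4)
         (invmx gx al mu * invmx gx be nu)%:C%C * w mu nu)
      * (levi_civita R al be ga de)%:C%C.

(* th x j al is the component th^j_al(x). *)
Definition frame (R : realType) (U : set 'rV[R]_4) (g th : 'rV[R]_4 -> 'M[R]_4) :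
    Prop :=
  (forall j al, smooth U (fun x => th x j al)) /\
  (forall x, U x ->
     (forall al be, g x al be =
        \sum_(j < 4) \sum_(k < 4) eta R j k * th x j al * th x k be) /\
     0 < \det (th x)).

(* th0 is the reference coframe. *)
Definition coframe (R : realType) (U : set 'rV[R]_4)
    (g th0 th : 'rV[R]_4 -> 'M[R]_4) : Prop :=
  frame U g th /\
  (forall x, U x -> 0 < cov_inner (g x) (th0 x 0) (th x 0)).

Definition cov_l (R : realType) (th : 'rV[R]_4 -> 'M[R]_4) (x : 'rV[R]_4) :
    form1 R :=
  fun al => th x 0 al + th x 3 al.

Definition cov_m (R : realType) (th : 'rV[R]_4 -> 'M[R]_4) (x : 'rV[R]_4) :
    form1 R[i] :=
  fun al => (th x 1 al +i* th x 2 al)%C.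

Definition lm (R : realType) (th : 'rV[R]_4 -> 'M[R]_4) (x : 'rV[R]_4) :
    form2 R[i] :=
  wedge11 (fun al => (cov_l th x al)%:C%C) (cov_m th x).

Definition forward_cone (R : realType) (thx : 'M[R]_4) : set (form1 R) :=
  [set u | exists c : 'I_4 -> R,
     [/\ forall al, u al = \sum_(j < 4) c j * thx j al,
         \sum_(j < 4) \sum_(k < 4) eta R j k * c j * c k = 0
       & 0 < c 0]].

Definition lorentz_mx (R : realType) (L : 'M[R]_4) : Prop :=
  [/\ forall r s, \sum_(j < 4) \sum_(k < 4) eta R j k * L j r * L k s = eta R r s,
      0 < \det L & 0 < L 0 0].

Definition expi (R : realType) (phi : R) : R[i] := (cos phi +i* sin phi)%C.

Definition in_H (R : realType) (U : set 'rV[R]_4)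
    (th L : 'rV[R]_4 -> 'M[R]_4) : Prop :=
  [/\ forall j k, smooth U (fun x => L x j k),
      forall x, U x -> lorentz_mx (L x)
    & exists phi : R, forall x, U x -> forall al be,
        lm (fun y => L y *m th y) x al be = expi phi * lm th x al be].

Definition coframe_equiv (R : realType) (U : set 'rV[R]_4)
    (th th' : 'rV[R]_4 -> 'M[R]_4) : Prop :=
  exists2 L, in_H U th L & forall x, U x -> th' x = L x *m th x.

(* xi x 0 a is xi^a(x), and sigma x al a b below is sigma_{al a b}(x), the second
   spinor index being the dotted one. *)

Definition nv_spinor (R : realType) (U : set 'rV[R]_4) (xi : 'rV[R]_4 -> 'rV[R[i]]_2) :
    Prop :=
  (forall a, smoothC U (fun x => xi x 0 a)) /\ (forall x, U x -> xi x != 0).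

Definition spinor_equiv (R : realType) (U : set 'rV[R]_4)
    (xi xi' : 'rV[R]_4 -> 'rV[R[i]]_2) : Prop :=
  exists2 c : R[i], `|c| = 1 & forall x, U x -> xi' x = c *: xi x.

Definition eps (R : realType) : 'M[R[i]]_2 :=
  \matrix_(a < 2, b < 2) (if a == b then 0 else if a == 0 then 1 else -1).

Definition sp_raise (R : realType) (M : 'M[R[i]]_2) : 'M[R[i]]_2 :=
  \matrix_(a < 2, b < 2) \sum_(c < 2) \sum_(d < 2) eps R a c * eps R b d * M c d.

(* sigma^al_{a b}, the tensor index being raised with g *)
Definition sigma_up (R : realType) (g : 'rV[R]_4 -> 'M[R]_4)
    (sigma : 'rV[R]_4 -> 'I_4 -> 'M[R[i]]_2) (x : 'rV[R]_4) (al : 'I_4) : 'M[R[i]]_2 :=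
  \sum_(be < 4) (invmx (g x) al be)%:C%C *: sigma x be.

Definition sigma2 (R : realType) (sigma : 'rV[R]_4 -> 'I_4 -> 'M[R[i]]_2)
    (x : 'rV[R]_4) (a c : 'I_2) : form2 R[i] :=
  fun al be => 2^-1 * \sum_(b < 2) \sum_(d < 2)
    (sigma x al a b * eps R b d * sigma x be c d
     - sigma x be a b * eps R b d * sigma x al c d).

Definition pauli (R : realType) (U : set 'rV[R]_4)
    (g th0 : 'rV[R]_4 -> 'M[R]_4) (sigma : 'rV[R]_4 -> 'I_4 -> 'M[R[i]]_2) : Prop :=
  (forall al a b, smoothC U (fun x => sigma x al a b)) /\
  (forall x, U x ->
    [/\ forall al a b, sigma x al a b = conjc (sigma x al b a),
        forall al be a c,
          \sum_(b < 2) (sigma_up g sigma x al a b * sp_raise (sigma_up g sigma x be) c b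
             + sigma_up g sigma x be a b * sp_raise (sigma_up g sigma x al) c b)
          = 2 * (invmx (g x) al be)%:C%C * (a == c)%:R,
        forall v : 'rV[R[i]]_2, v != 0 ->
          exists2 u, forward_cone (th0 x) u &
            forall al, \sum_(a < 2) \sum_(b < 2) sigma x al a b * v 0 a * conjc (v 0 b)
                       = (u al)%:C%C
      & forall a b ga de,
          hodge2 (g x) (sigma2 sigma x a b) ga de = - 'i%C * sigma2 sigma x a b ga de]).

(* The component {nabla}_al xi^a. *)
Definition nabla (R : realType) (g : 'rV[R]_4 -> 'M[R]_4)
    (sigma : 'rV[R]_4 -> 'I_4 -> 'M[R[i]]_2) (xi : 'rV[R]_4 -> 'rV[R[i]]_2)
    (al : 'I_4) (a : 'I_2) (x : 'rV[R]_4) : R[i] :=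
  pdC al (fun y => xi y 0 a) x +
  4^-1 * \sum_(be < 4) \sum_(b < 2) \sum_(c < 2)
    sp_raise (sigma x be) a c *
    (pdC al (fun y => sigma_up g sigma y be b c) x
     + \sum_(ga < 4) (christoffel g be al ga x)%:C%C * sigma_up g sigma x ga b c)
    * xi x 0 b.

Definition corresp (R : realType) (U : set 'rV[R]_4)
    (sigma : 'rV[R]_4 -> 'I_4 -> 'M[R[i]]_2)
    (th : 'rV[R]_4 -> 'M[R]_4) (xi : 'rV[R]_4 -> 'rV[R[i]]_2) : Prop :=
  exists2 c : R[i], `|c| = 1 & forall x, U x -> forall al be,
    lm th x al be =
    c * \sum_(a < 2) \sum_(b < 2) sigma2 sigma x a b al be * xi x 0 a * xi x 0 b.

Definition T_ax (R : realType) (th : 'rV[R]_4 -> 'M[R]_4) (x : 'rV[R]_4) :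
    form3 R :=
  fun a b c => 3^-1 * \sum_(j < 4) \sum_(k < 4)
    eta R j k * wedge12 (th x j) (ext_d1 (fun y => th y k) x) a b c.

Definition L_tele (R : realType) (th : 'rV[R]_4 -> 'M[R]_4) (x : 'rV[R]_4) :
    form4 R :=
  wedge13 (cov_l th x) (T_ax th x).

Definition L_Weyl (R : realType) (g : 'rV[R]_4 -> 'M[R]_4)
    (sigma : 'rV[R]_4 -> 'I_4 -> 'M[R[i]]_2) (xi : 'rV[R]_4 -> 'rV[R[i]]_2)
    (x : 'rV[R]_4) : form4 R[i] :=
  fun al be ga de =>
    'i%C / 2 *
    (\sum_(mu < 4) \sum_(a < 2) \sum_(b < 2)
       (conjc (xi x 0 b) * sigma_up g sigma x mu a b * nabla g sigma xi mu a x
        - xi x 0 a * sigma_up g sigma x mu a b * conjc (nabla g sigma xi mu b x)))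
    * (vol_form (g x) al be ga de)%:C%C.

Definition eq_class (T : Type) (A : set T) (e : T -> T -> Prop) (x : T) : set T :=
  [set y | A y /\ e x y].

Definition eq_classes (T : Type) (A : set T) (e : T -> T -> Prop) : set (set T) :=
  [set eq_class A e x | x in A].

(* Main.v *)
(* Hermiticity, the Clifford relation and the two orientation conditions say that
   sigma is the matrix [[e^0+e^3, e^1+ie^2], [e^1-ie^2, e^0-e^3]] of a coframe e, so
   that sigma_{11} = l and sigma_{12} = m for this e; a unimodular dyad A = (xi, eta)
   replaces it by the coframe with matrix A^T sigma conj(A), for which l /\ m is
   sigma_{ab} xi^a xi^b.  Two coframes with the same l /\ m differ by a null rotation,
   that is by eta |-> eta + f xi, so every coframe arises from a dyad.  Conversely
   l /\ m is self-dual and null, hence sigma_{ab} S^{ab} with det S = 0, and S has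
   exactly two square roots xi, -xi, locally smooth; on a contractible domain the
   local roots glue, by lifting along the contraction.  Since the spinor derivative is
   covariant under A, the Lagrangian identity may be checked for the dyad of theta
   itself, where xi is constant: only the totally antisymmetric part of the spin
   connection then survives in the imaginary part of the Weyl current, and this is
   the axial torsion. *)

Require Import Defs.
From HB Require Import structures.
From mathcomp Require Import all_boot all_order all_algebra.
From mathcomp Require Import complex.
From mathcomp Require Import all_classical all_reals all_analysis.
From mathcomp Require Import ring lra.

Import Defs.

Set Implicit Arguments.
Unset Strict Implicit.
Unset Printing Implicit Defensive.

Import Order.TTheory GRing.Theory Num.Theory.
Import numFieldNormedType.Exports.

Local Open Scope classical_set_scope.
Local Open Scope ring_scope.

(** * Smooth functions *)

(** The two directions of the correspondence differ in nature. From spinor to coframe the second leg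
    of the dyad is an explicit formula in [xi], smooth on all of [U]. From coframe to spinor a
    square root with two branches has to be chosen, and contractibility serves twice: to choose the
    branch on all of [U], and to show that two spinors of one coframe differ by a constant. Both
    uses rest on one observation: the inner product of two points of a fibre is never 0, and its
    sign tells the sheets apart. The lift is followed backwards along the contraction, from a value
    fixed at its end point. The phase [c] is absorbed into the spinor by a square root of [c] of
    modulus 1. In the Lagrangian identity the Levi-Civita bracket of the spin connection is
    symmetric in the pair of frame indices in which the imaginary part of the current is
    antisymmetric, so only derivatives of the coframe itself remain, as in the torsion. *)

Section Calculus.
Variable R : realType.
Implicit Types (U V : set 'rV[R]_4) (f g : 'rV[R]_4 -> R) (x : 'rV[R]_4).

Lemma near_open U x (P : 'rV[R]_4 -> Prop) :
  open U -> U x -> (forall y, U y -> P y) -> \near x, P x.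
Proof. by move=> oU Ux UP; apply: filterS UP _; apply: open_nbhs_nbhs. Qed.

Lemma pd_ext U f g x (al : 'I_4) : open U -> U x -> (forall y, U y -> f y = g y) ->
  pd al f x = pd al g x.
Proof. by move=> oU Ux fg; apply: near_eq_derive; apply: near_open oU Ux fg. Qed.

Lemma continuous_ext U f g x : open U -> U x -> (forall y, U y -> f y = g y) ->
  {for x, continuous f} -> {for x, continuous g}.
Proof.
move=> oU Ux fg fc A; rewrite -fg // => /fc fA.
have gA : \near x, f x = g x := near_open oU Ux fg.
have fA' : nbhs x (f @^-1` A) := fA.
have : nbhs x ([set y | f y = g y] `&` f @^-1` A) by apply: filterI.
by apply: filterS => y [e fAy]; rewrite /preimage /= -e.
Qed.

(** Values outside [U] are arbitrary. Since [U] is open, a partial derivative at a point of [U] sees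
    only nearby points of [U], so equality on [U] passes to all iterated derivatives. *)
Lemma Ck_ext U k f g : open U -> (forall x, U x -> f x = g x) -> Ck U k f -> Ck U k g.
Proof.
move=> oU; elim: k f g => [|k IH] f g fg [fc fd]; split.
- by move=> x Ux; apply: continuous_ext oU Ux fg (fc x Ux).
- by [].
- by move=> x Ux; apply: continuous_ext oU Ux fg (fc x Ux).
- move=> al; have [d c] := fd al; split.
    by move=> x Ux; apply: near_eq_derivable (d x Ux); apply: (near_open oU Ux fg).
  by apply: IH c => x Ux; apply: pd_ext oU Ux fg.
Qed.

Lemma Ck_local U k f :
  (forall x, U x -> exists V, [/\ open V, V x & Ck V k f]) -> Ck U k f.
Proof.
elim: k f => [|k IH] f H; split=> //.
- by move=> x Ux; have [V [_ Vx [c _]]] := H x Ux; apply: c.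
- by move=> x Ux; have [V [_ Vx [c _]]] := H x Ux; apply: c.
- move=> al; split.
    by move=> x Ux; have [V [_ Vx [_ /(_ al)[d _]]]] := H x Ux; apply: d.
  apply: IH => x Ux; have [V [oV Vx [_ /(_ al)[_ c]]]] := H x Ux.
  by exists V.
Qed.

Lemma CkS U k f : Ck U k.+1 f -> Ck U k f.
Proof.
elim: k f => [|k IH] f [fc fd]; split=> //.
by move=> al; have [d c] := fd al; split=> //; apply: IH.
Qed.

Lemma Ck_cst U k (a : R) : Ck U k (fun=> a).
Proof.
elim: k a => [|k IH] a; split=> //; try by move=> x _ A; apply: cst_continuous.
move=> al; split; first by move=> x _; apply: (derivable_cst a).
suff -> : pd al (fun=> a) = fun=> 0 by apply: IH.
by apply/funext => x; apply: (derive_cst a).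
Qed.

Lemma contD f g x : {for x, continuous f} -> {for x, continuous g} ->
  {for x, continuous (fun y => f y + g y)}.
Proof. by move=> fc gc; exact: (continuousD fc gc). Qed.

Lemma contM f g x : {for x, continuous f} -> {for x, continuous g} ->
  {for x, continuous (fun y => f y * g y)}.
Proof. by move=> fc gc; exact: (continuousM fc gc). Qed.

Lemma contV f x : f x != 0 -> {for x, continuous f} ->
  {for x, continuous (fun y => (f y)^-1)}.
Proof. by move=> f0 fc; exact: (continuousV f0 fc). Qed.

Lemma CkD U k f g : open U -> Ck U k f -> Ck U k g -> Ck U k (fun x => f x + g x).
Proof.
move=> oU; elim: k f g => [|k IH] f g [fc fd] [gc gd]; split=> //;
  try by move=> x Ux; apply: contD; [apply: fc|apply: gc].
move=> al; have [df cf] := fd al; have [dg cg] := gd al; split.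
  by move=> x Ux; apply: derivableD; [apply: df|apply: dg].
apply: Ck_ext (IH _ _ cf cg) => // x Ux.
by rewrite /pd -deriveD //; [apply: df|apply: dg].
Qed.

Lemma CkM U k f g : open U -> Ck U k f -> Ck U k g -> Ck U k (fun x => f x * g x).
Proof.
move=> oU; elim: k f g => [|k IH] f g Cf Cg.
  have [fc _] := Cf; have [gc _] := Cg; split=> // x Ux.
  by apply: contM; [apply: fc|apply: gc].
have [fc fd] := Cf; have [gc gd] := Cg; split.
  by move=> x Ux; apply: contM; [apply: fc|apply: gc].
move=> al; have [df cf] := fd al; have [dg cg] := gd al; split.
  by move=> x Ux; apply: derivableM; [apply: df|apply: dg].
apply: Ck_ext (CkD oU (IH _ _ (CkS Cf) cg) (IH _ _ (CkS Cg) cf)) => // x Ux.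
by rewrite /pd -deriveM //; [apply: df|apply: dg].
Qed.

Lemma CkV U k f : open U -> (forall x, U x -> f x != 0) -> Ck U k f ->
  Ck U k (fun x => (f x)^-1).
Proof.
move=> oU f0; elim: k => [|k IH] Cf.
  by have [fc _] := Cf; split=> // x Ux; apply: contV; [apply: f0|apply: fc].
have [fc fd] := Cf; split.
  by move=> x Ux; apply: contV; [apply: f0|apply: fc].
move=> al; have [df cf] := fd al; split.
  by move=> x Ux; apply: derivableV; [apply: f0|apply: df].
have Cv := IH (CkS Cf).
(* The derivative is [- f' / f^2], and order [k] of [f^-1], which the induction hypothesis supplies,
   is enough for it. *)
have := CkM oU (CkM oU (Ck_cst U k (-1)) (CkM oU Cv Cv)) cf.
apply: Ck_ext => // x Ux.
by rewrite /pd deriveV ?f0 //; [rewrite mulN1r -exprVn expr2|apply: df].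
Qed.

(* The quotient of [sqrt f] is that of [f] divided by [sqrt (f y) + sqrt (f x)],
   which tends to [2 sqrt (f x)]. *)
Lemma is_derive_sqrt f x v : {for x, continuous f} -> 0 < f x -> derivable f x v ->
  is_derive x v (fun y => Num.sqrt (f y)) ('D_v f x / (2 * Num.sqrt (f x))).
Proof.
move=> fc f0 df.
have s0 : 0 < Num.sqrt (f x) by rewrite sqrtr_gt0.
have lin : h *: v + x @[h --> (0:R)] --> x.
  rewrite -[X in _ --> X]add0r; apply: cvgD; last exact: cvg_cst.
  by rewrite -(scale0r v); apply: cvgZr_tmp.
have lin' : h *: v + x @[h --> (0:R)^'] --> x.
  by apply: cvg_trans lin; apply: cvg_app; apply: cvg_within.
have fl : f (h *: v + x) @[h --> (0:R)^'] --> f x by apply: cvg_comp lin' fc.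
have sl : Num.sqrt (f (h *: v + x)) @[h --> (0:R)^'] --> Num.sqrt (f x).
  by apply: cvg_comp fl _; apply: sqrt_continuous.
have key : h^-1 *: (((fun y => Num.sqrt (f y)) \o shift x) (h *: v) - Num.sqrt (f x))
    @[h --> (0:R)^'] --> 'D_v f x / (2 * Num.sqrt (f x)).
  have q : h^-1 *: ((f \o shift x) (h *: v) - f x) /
      (Num.sqrt (f (h *: v + x)) + Num.sqrt (f x)) @[h --> (0:R)^'] -->
      'D_v f x / (2 * Num.sqrt (f x)).
    apply: cvgM; first exact: df.
    apply: cvgV; first by apply: lt0r_neq0; lra.
    by rewrite mulr_natl mulr2n; apply: cvgD; [exact: sl|exact: cvg_cst].
  apply: cvg_trans q; apply: near_eq_cvg.
  have fp : \forall h \near (0:R)^', 0 < f (h *: v + x).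
    exact: cvgr_gt fl _ f0.
  near=> h => /=.
  have fp' : 0 < f (h *: v + x) by near: h.
  have e1 := sqr_sqrtr (ltW fp'); have e2 := sqr_sqrtr (ltW f0).
  have s1 : 0 < Num.sqrt (f (h *: v + x)) by rewrite sqrtr_gt0.
  rewrite -{1}e1 -{1}e2 -scalerAl; congr (_ *: _).
  by field; apply: lt0r_neq0; lra.
apply: DeriveDef; first by apply/cvg_ex; eexists; exact: key.
by apply: (cvg_lim _ key).
Unshelve. all: by end_near.
Qed.

Lemma Ck_sqrt U k f : open U -> (forall x, U x -> 0 < f x) -> Ck U k f ->
  Ck U k (fun x => Num.sqrt (f x)).
Proof.
move=> oU f0.
have c0 : (forall x, U x -> {for x, continuous f}) ->
    forall x, U x -> {for x, continuous (fun x => Num.sqrt (f x))}.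
  by move=> fc x Ux; apply: continuous_comp; [apply: fc|apply: sqrt_continuous].
elim: k => [|k IH] Cf; first by have [fc _] := Cf; split=> //; exact: c0.
have [fc fd] := Cf; split; first exact: c0.
move=> al; have [df cf] := fd al.
have D x : U x -> is_derive x (delta_mx 0 al) (fun y => Num.sqrt (f y)) _ :=
  fun Ux => is_derive_sqrt (fc x Ux) (f0 x Ux) (df x Ux).
split; first by move=> x Ux; have [] := D x Ux.
have nz x : U x -> 2 * Num.sqrt (f x) != 0.
  by move=> Ux; rewrite mulf_neq0 ?pnatr_eq0 // gt_eqF // sqrtr_gt0 f0.
have Cd := CkV oU nz (CkM oU (Ck_cst U k 2) (IH (CkS Cf))).
apply: Ck_ext (CkM oU cf Cd) => // x Ux.
by have [_ ] := D x Ux; rewrite /pd => ->.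
Qed.

End Calculus.

(** * Calculus of smooth real, complex and matrix-valued functions *)

Section Smooth.
Variables (R : realType) (U : set 'rV[R]_4).
Hypothesis oU : open U.
Implicit Types (f g : 'rV[R]_4 -> R) (F G : 'rV[R]_4 -> R[i]) (x : 'rV[R]_4).

Lemma smooth_ext f g : (forall x, U x -> f x = g x) -> smooth U f -> smooth U g.
Proof. by move=> fg Sf k; apply: Ck_ext oU fg (Sf k). Qed.

Lemma smooth_cst (a : R) : smooth U (fun=> a).
Proof. by move=> k; apply: Ck_cst. Qed.

Lemma smoothD f g : smooth U f -> smooth U g -> smooth U (fun x => f x + g x).
Proof. by move=> Sf Sg k; apply: CkD. Qed.

Lemma smoothM f g : smooth U f -> smooth U g -> smooth U (fun x => f x * g x).
Proof. by move=> Sf Sg k; apply: CkM. Qed.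

Lemma smoothN f : smooth U f -> smooth U (fun x => - f x).
Proof.
by move=> Sf; apply: smooth_ext (smoothM (smooth_cst (-1)) Sf) => x _; rewrite mulN1r.
Qed.

Lemma smoothB f g : smooth U f -> smooth U g -> smooth U (fun x => f x - g x).
Proof. by move=> Sf Sg; apply: smoothD => //; apply: smoothN. Qed.

Lemma smoothV f : (forall x, U x -> f x != 0) -> smooth U f ->
  smooth U (fun x => (f x)^-1).
Proof. by move=> f0 Sf k; apply: CkV. Qed.

Lemma smooth_sqrt f : (forall x, U x -> 0 < f x) -> smooth U f ->
  smooth U (fun x => Num.sqrt (f x)).
Proof. by move=> f0 Sf k; apply: Ck_sqrt. Qed.

Lemma smooth_sum (I : Type) (r : seq I) (P : pred I) (h : I -> 'rV[R]_4 -> R) :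
  (forall i, P i -> smooth U (h i)) -> smooth U (fun x => \sum_(i <- r | P i) h i x).
Proof.
move=> Sh; elim: r => [|i r IH].
  by apply: smooth_ext (smooth_cst 0) => x _; rewrite big_nil.
case Pi: (P i); last by apply: smooth_ext IH => x _; rewrite big_cons Pi.
by apply: smooth_ext (smoothD (Sh i Pi) IH) => x _; rewrite big_cons Pi.
Qed.

Lemma smooth_prod (I : Type) (r : seq I) (P : pred I) (h : I -> 'rV[R]_4 -> R) :
  (forall i, P i -> smooth U (h i)) -> smooth U (fun x => \prod_(i <- r | P i) h i x).
Proof.
move=> Sh; elim: r => [|i r IH].
  by apply: smooth_ext (smooth_cst 1) => x _; rewrite big_nil.
case Pi: (P i); last by apply: smooth_ext IH => x _; rewrite big_cons Pi.
by apply: smooth_ext (smoothM (Sh i Pi) IH) => x _; rewrite big_cons Pi.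
Qed.

Lemma smooth_det n (A : 'rV[R]_4 -> 'M[R]_n) :
  (forall i j, smooth U (fun x => A x i j)) -> smooth U (fun x => \det (A x)).
Proof.
move=> SA; apply: smooth_sum => s _; apply: smoothM; first exact: smooth_cst.
by apply: smooth_prod => i _; apply: SA.
Qed.

Lemma smooth_mulmx m n p (A : 'rV[R]_4 -> 'M[R]_(m, n)) (B : 'rV[R]_4 -> 'M[R]_(n, p)) :
  (forall i j, smooth U (fun x => A x i j)) -> (forall i j, smooth U (fun x => B x i j)) ->
  forall i j, smooth U (fun x => (A x *m B x) i j).
Proof.
move=> SA SB i j.
apply: (@smooth_ext (fun x => \sum_k A x i k * B x k j)) => [x _|]; first by rewrite mxE.
by apply: smooth_sum => k _; apply: smoothM.
Qed.

(** By Cramer's rule the entries of the inverse are cofactors divided by the determinant. *)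
Lemma smooth_invmx n (A : 'rV[R]_4 -> 'M[R]_n) :
  (forall x, U x -> A x \in unitmx) ->
  (forall i j, smooth U (fun x => A x i j)) ->
  forall i j, smooth U (fun x => invmx (A x) i j).
Proof.
move=> uA SA i j.
apply: (@smooth_ext (fun x => (\det (A x))^-1 *
    ((-1) ^+ (j + i) * \det (row' j (col' i (A x)))))) => [x Ux|].
  by rewrite /invmx uA // !mxE.
apply: smoothM.
  by apply: smoothV => [x /uA|]; [rewrite unitmxE unitfE|apply: smooth_det].
apply: smoothM; first exact: smooth_cst.
apply: smooth_det => k l; apply: smooth_ext (SA (lift j k) (lift i l)) => x _.
by rewrite !mxE.
Qed.

Lemma smooth_continuous f x : smooth U f -> U x -> {for x, continuous f}.
Proof. by move=> /(_ 0%N) [fc _] Ux; apply: fc. Qed.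

Lemma smooth_derivable f x (al : 'I_4) : smooth U f -> U x ->
  derivable f x (delta_mx 0 al).
Proof. by move=> /(_ 1%N) [_ /(_ al)[d _]] Ux; apply: d. Qed.

Lemma pd_cst x al (a : R) : pd al (fun=> a) x = 0.
Proof. exact: (derive_cst a). Qed.

Lemma pdD f g x al : smooth U f -> smooth U g -> U x ->
  pd al (fun y => f y + g y) x = pd al f x + pd al g x.
Proof.
by move=> Sf Sg Ux; rewrite /pd -deriveD //; apply: smooth_derivable.
Qed.

Lemma pdM f g x al : smooth U f -> smooth U g -> U x ->
  pd al (fun y => f y * g y) x = pd al f x * g x + f x * pd al g x.
Proof.
move=> Sf Sg Ux; rewrite /pd addrC [X in _ + X]mulrC -deriveM //;
  exact: smooth_derivable.
Qed.

Lemma pdN f x al : smooth U f -> U x -> pd al (fun y => - f y) x = - pd al f x.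
Proof. by move=> Sf Ux; rewrite /pd -deriveN //; apply: smooth_derivable. Qed.

Lemma pd_sum (I : Type) (r : seq I) (h : I -> 'rV[R]_4 -> R) x al :
  (forall i, smooth U (h i)) -> U x ->
  pd al (fun y => \sum_(i <- r) h i y) x = \sum_(i <- r) pd al (h i) x.
Proof.
move=> Sh Ux; elim: r => [|i r IH].
  rewrite big_nil; transitivity (pd al (fun=> 0) x); last exact: pd_cst.
  by apply: pd_ext oU Ux _ => y _; rewrite big_nil.
rewrite big_cons -IH -pdD //; last by apply: smooth_sum.
by apply: pd_ext oU Ux _ => y _; rewrite big_cons.
Qed.

Lemma smoothC_ext F G : (forall x, U x -> F x = G x) -> smoothC U F -> smoothC U G.
Proof.
by move=> FG [S1 S2]; split; [apply: smooth_ext S1|apply: smooth_ext S2] => x Ux;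
  rewrite FG.
Qed.

Lemma smoothC_cst (a : R[i]) : smoothC U (fun=> a).
Proof. by split; apply: smooth_cst. Qed.

Lemma smoothC_real f : smooth U f -> smoothC U (fun x => (f x)%:C%C).
Proof. by move=> Sf; split=> //=; apply: smooth_cst. Qed.

Lemma smoothC_pair f g : smooth U f -> smooth U g -> smoothC U (fun x => (f x +i* g x)%C).
Proof. by split. Qed.

Lemma smoothCD F G : smoothC U F -> smoothC U G -> smoothC U (fun x => F x + G x).
Proof.
move=> [F1 F2] [G1 G2]; split.
  by apply: smooth_ext (smoothD F1 G1) => x _; case: (F x) (G x) => [? ?] [? ?].
by apply: smooth_ext (smoothD F2 G2) => x _; case: (F x) (G x) => [? ?] [? ?].
Qed.

Lemma smoothCM F G : smoothC U F -> smoothC U G -> smoothC U (fun x => F x * G x).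
Proof.
move=> [F1 F2] [G1 G2]; split.
  apply: smooth_ext (smoothB (smoothM F1 G1) (smoothM F2 G2)) => x _.
  by case: (F x) (G x) => [? ?] [? ?].
apply: smooth_ext (smoothD (smoothM F1 G2) (smoothM F2 G1)) => x _.
by case: (F x) (G x) => [? ?] [? ?].
Qed.

Lemma smoothCN F : smoothC U F -> smoothC U (fun x => - F x).
Proof.
by move=> SF; apply: smoothC_ext (smoothCM (smoothC_cst (-1)) SF) => x _;
  rewrite mulN1r.
Qed.

Lemma smoothC_conj F : smoothC U F -> smoothC U (fun x => conjc (F x)).
Proof.
move=> [F1 F2]; split.
  by apply: smooth_ext F1 => x _; case: (F x).
by apply: smooth_ext (smoothN F2) => x _; case: (F x).
Qed.

Lemma smoothC_sum (I : Type) (r : seq I) (P : pred I) (h : I -> 'rV[R]_4 -> R[i]) :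
  (forall i, P i -> smoothC U (h i)) ->
  smoothC U (fun x => \sum_(i <- r | P i) h i x).
Proof.
move=> Sh; elim: r => [|i r IH].
  by apply: smoothC_ext (smoothC_cst 0) => x _; rewrite big_nil.
case Pi: (P i); last by apply: smoothC_ext IH => x _; rewrite big_cons Pi.
by apply: smoothC_ext (smoothCD (Sh i Pi) IH) => x _; rewrite big_cons Pi.
Qed.

(** [1/F] is [conj F / |F|^2], which leaves only the inverse of a positive real function. *)
Lemma smoothCV F : (forall x, U x -> F x != 0) -> smoothC U F ->
  smoothC U (fun x => (F x)^-1).
Proof.
move=> F0 [F1 F2].
have Sn := smoothD (smoothM F1 F1) (smoothM F2 F2).
have Sv : smooth U (fun x => (complex.Re (F x) * complex.Re (F x) +
    complex.Im (F x) * complex.Im (F x))^-1).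
  apply: smoothV => // x /F0; case: (F x) => a b; rewrite eq_complex /= negb_and.
  by rewrite paddr_eq0 -?expr2 ?sqr_ge0 // !sqrf_eq0 negb_and.
have := smoothCM (smoothC_conj (conj F1 F2)) (smoothC_real Sv).
apply: smoothC_ext => x Ux.
have := F0 x Ux; case: (F x) => a b; rewrite eq_complex /= negb_and => nz.
apply/eqP; rewrite eq_complex /= !mulr0 subr0 add0r !expr2.
by rewrite mulNr !eqxx.
Qed.

Lemma pdC_ext F G x al : U x -> (forall y, U y -> F y = G y) -> pdC al F x = pdC al G x.
Proof.
by move=> Ux FG; congr (_ +i* _)%C; apply: pd_ext oU Ux _ => y Uy; rewrite FG.
Qed.

Lemma pdC_cst x al (a : R[i]) : pdC al (fun=> a) x = 0.
Proof. by rewrite /pdC !pd_cst. Qed.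

Lemma pdC_real f x al : pdC al (fun y => (f y)%:C%C) x = (pd al f x)%:C%C.
Proof. by rewrite /pdC /= pd_cst. Qed.

Lemma pdCD F G x al : smoothC U F -> smoothC U G -> U x ->
  pdC al (fun y => F y + G y) x = pdC al F x + pdC al G x.
Proof.
move=> [F1 F2] [G1 G2] Ux; apply/eqP; rewrite eq_complex /= -!pdD //.
by apply/andP; split; apply/eqP; apply: pd_ext oU Ux _ => y _;
  case: (F y) (G y) => [? ?] [? ?].
Qed.

Lemma pdCM F G x al : smoothC U F -> smoothC U G -> U x ->
  pdC al (fun y => F y * G y) x = pdC al F x * G x + F x * pdC al G x.
Proof.
move=> [F1 F2] [G1 G2] Ux.
set F1' := fun y => complex.Re (F y) in F1 *.
set F2' := fun y => complex.Im (F y) in F2 *.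
set G1' := fun y => complex.Re (G y) in G1 *.
set G2' := fun y => complex.Im (G y) in G2 *.
have e1 : pd al (fun y => complex.Re (F y * G y)) x =
    pd al (fun y => F1' y * G1' y + - (F2' y * G2' y)) x.
  by apply: pd_ext oU Ux _ => y _; rewrite /F1' /F2' /G1' /G2'; case: (F y) (G y) => [? ?] [? ?].
have e2 : pd al (fun y => complex.Im (F y * G y)) x =
    pd al (fun y => F1' y * G2' y + F2' y * G1' y) x.
  by apply: pd_ext oU Ux _ => y _; rewrite /F1' /F2' /G1' /G2'; case: (F y) (G y) => [? ?] [? ?].
rewrite {1}/pdC e1 e2 !pdD ?pdN ?pdM //; try by [apply: smoothM|apply: smoothN; apply: smoothM].
rewrite /pdC -/F1' -/F2' -/G1' -/G2'.
have -> : F x = (F1' x +i* F2' x)%C by rewrite /F1' /F2'; case: (F x).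
have -> : G x = (G1' x +i* G2' x)%C by rewrite /G1' /G2'; case: (G x).
by apply/eqP; rewrite eq_complex /=; apply/andP; split; apply/eqP; ring.
Qed.

Lemma pdC_sum (I : Type) (r : seq I) (h : I -> 'rV[R]_4 -> R[i]) x al :
  (forall i, smoothC U (h i)) -> U x ->
  pdC al (fun y => \sum_(i <- r) h i y) x = \sum_(i <- r) pdC al (h i) x.
Proof.
move=> Sh Ux; elim: r => [|i r IH].
  rewrite big_nil; transitivity (pdC al (fun=> 0) x); last exact: pdC_cst.
  by apply: pdC_ext Ux _ => y _; rewrite big_nil.
rewrite big_cons -IH -pdCD //; last by apply: smoothC_sum.
by apply: pdC_ext Ux _ => y _; rewrite big_cons.
Qed.

Definition smoothMx m n (A : 'rV[R]_4 -> 'M[R[i]]_(m, n)) :=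
  forall i j, smoothC U (fun x => A x i j).

Definition pdMx m n al (A : 'rV[R]_4 -> 'M[R[i]]_(m, n)) x : 'M[R[i]]_(m, n) :=
  \matrix_(i, j) pdC al (fun y => A y i j) x.

Lemma smoothMx_mul m n p (A : 'rV[R]_4 -> 'M[R[i]]_(m, n))
    (B : 'rV[R]_4 -> 'M[R[i]]_(n, p)) :
  smoothMx A -> smoothMx B -> smoothMx (fun x => A x *m B x).
Proof.
move=> SA SB i j.
apply: (@smoothC_ext (fun x => \sum_k A x i k * B x k j)) => [x _|]; first by rewrite mxE.
by apply: smoothC_sum => k _; apply: smoothCM.
Qed.

Lemma smoothMx_tr m n (A : 'rV[R]_4 -> 'M[R[i]]_(m, n)) :
  smoothMx A -> smoothMx (fun x => (A x)^T).
Proof. by move=> SA i j; apply: smoothC_ext (SA j i) => x _; rewrite mxE. Qed.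

Lemma smoothMx_conj m n (A : 'rV[R]_4 -> 'M[R[i]]_(m, n)) :
  smoothMx A -> smoothMx (fun x => map_mx conjc (A x)).
Proof.
by move=> SA i j; apply: smoothC_ext (smoothC_conj (SA i j)) => x _; rewrite mxE.
Qed.

Lemma pdMx_ext m n al (A B : 'rV[R]_4 -> 'M[R[i]]_(m, n)) x :
  U x -> (forall y, U y -> A y = B y) -> pdMx al A x = pdMx al B x.
Proof.
by move=> Ux AB; apply/matrixP => i j; rewrite !mxE; apply: pdC_ext => // y /AB ->.
Qed.

Lemma pdMx_mul m n p al (A : 'rV[R]_4 -> 'M[R[i]]_(m, n))
    (B : 'rV[R]_4 -> 'M[R[i]]_(n, p)) x :
  smoothMx A -> smoothMx B -> U x ->
  pdMx al (fun y => A y *m B y) x = pdMx al A x *m B x + A x *m pdMx al B x.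
Proof.
move=> SA SB Ux; apply/matrixP => i j; rewrite !mxE -big_split /=.
transitivity (pdC al (fun y => \sum_k A y i k * B y k j) x).
  by apply: pdC_ext => // y _; rewrite mxE.
rewrite pdC_sum //; last by move=> k; apply: smoothCM.
by apply: eq_bigr => k _; rewrite !mxE pdCM.
Qed.

Lemma pdMx_tr m n al (A : 'rV[R]_4 -> 'M[R[i]]_(m, n)) x : U x ->
  pdMx al (fun y => (A y)^T) x = (pdMx al A x)^T.
Proof.
by move=> Ux; apply/matrixP => i j; rewrite !mxE; apply: pdC_ext => // y _; rewrite mxE.
Qed.

End Smooth.

(** The global spinor field is known to coincide with a smooth square root only near each point;
    this makes it smooth. *)
Lemma smooth_local (R : realType) (U : set 'rV[R]_4) f :
  (forall x, U x -> exists V, [/\ open V, V x & smooth V f]) -> smooth U f.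
Proof.
by move=> H k; apply: Ck_local => x /H[V [oV Vx S]]; exists V.
Qed.

Lemma smooth_sub (R : realType) (U V : set 'rV[R]_4) f :
  open V -> V `<=` U -> smooth U f -> smooth V f.
Proof.
move=> oV VU Sf k; elim: k f {Sf}(Sf k) => [|k IH] f [fc fd]; split=> //;
  try by move=> x /VU; apply: fc.
move=> al; have [d c] := fd al; split; last exact: IH.
by move=> x /VU; apply: d.
Qed.

(** * Sections of two-sheeted coverings *)

Section SignLift.
Variables (R : realType) (n : nat) (U : set 'rV[R]_4).
Variable P : 'rV[R]_4 -> ('I_n -> R) -> Prop.
Hypothesis oU : open U.
Hypothesis P0 : forall y v, U y -> P y v -> exists i, v i != 0.
Hypothesis Psg : forall y v (b : bool), U y -> P y v -> P y (fun i => (-1) ^+ b * v i).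
Hypothesis Pfib : forall y v w, U y -> P y v -> P y w ->
  exists b : bool, w = fun i => (-1) ^+ b * v i.

(** [P y] stands for the fibre over [y]: two opposite nonzero real tuples. Sections are only
    continuous here; smoothness is recovered afterwards by comparison with smooth local roots. *)
Definition local_section (V : set 'rV[R]_4) (s : 'rV[R]_4 -> 'I_n -> R) :=
  [/\ open V, V `<=` U, forall y, V y -> P y (s y)
    & forall i y, V y -> {for y, continuous (fun z => s z i)}].

Lemma sqr_sum_gt0 (v : 'I_n -> R) i : v i != 0 -> 0 < \sum_j v j * v j.
Proof.
move=> vi; rewrite (bigD1 i) //= ltr_pwDl ?sumr_ge0 //.
  by rewrite -expr2 lt_def sqr_ge0 sqrf_eq0 vi.
by move=> j _; rewrite -expr2 sqr_ge0.
Qed.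

(** The inner product of two points of a fibre is a positive number up to sign. It varies
    continuously, so its sign is the tool for comparing sheets. *)
Lemma sg_sum (v : 'I_n -> R) (b : bool) :
  \sum_j v j * ((-1) ^+ b * v j) = (-1) ^+ b * \sum_j v j * v j.
Proof. by rewrite mulr_sumr; apply: eq_bigr => j _; ring. Qed.

Lemma cvg_sumM (T : Type) (F : set_system T) (FF : Filter F) (f g : T -> 'I_n -> R)
    (a b : 'I_n -> R) :
  (forall i, f x i @[x --> F] --> a i) -> (forall i, g x i @[x --> F] --> b i) ->
  \sum_i f x i * g x i @[x --> F] --> \sum_i a i * b i.
Proof.
move=> fa gb; elim: (index_enum _) => [|i r IH].
  have -> : (fun x => \sum_(i <- [::]) f x i * g x i) = (fun=> 0).
    by apply/funext => x; rewrite big_nil.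
  by rewrite big_nil; apply: cvg_cst.
have -> : (fun x => \sum_(j <- i :: r) f x j * g x j) =
    (fun x => f x i * g x i + \sum_(j <- r) f x j * g x j).
  by apply/funext => x; rewrite big_cons.
rewrite big_cons; apply: cvgD IH; exact: cvgM.
Qed.

Lemma local_section_sg V s (b : bool) : local_section V s ->
  local_section V (fun y i => (-1) ^+ b * s y i).
Proof.
move=> [oV VU Vs Vc]; split=> // [y Vy|i y Vy].
  by apply: Psg; [apply: VU|apply: Vs].
by apply: contM; [move=> A; apply: cst_continuous|apply: Vc].
Qed.

(** The inner product of the two sections, times the sign found at [z], is continuous and positive
    at [z], hence positive nearby, which excludes the other sheet there. *)
Lemma local_section_compare V s V' s' z (b : bool) :
  local_section V s -> local_section V' s' -> V z -> V' z ->
  s' z = (fun i => (-1) ^+ b * s z i) ->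
  \forall y \near z, V y /\ V' y /\ s' y = (fun i => (-1) ^+ b * s y i).
Proof.
move=> [oV VU Vs Vc] [oV' VU' Vs' Vc'] Vz Vz' e.
have c : \sum_i s y i * s' y i @[y --> z] --> \sum_i s z i * s' z i.
  by apply: (@cvg_sumM _ (nbhs z) (nbhs_filter z)) => i; [apply: Vc|apply: Vc'].
have {}c := cvgM (cvg_cst ((-1) ^+ b : R)) c.
have [i si] := P0 (VU _ Vz) (Vs _ Vz).
have p : 0 < (-1) ^+ b * \sum_i s z i * s' z i.
  by rewrite e sg_sum mulrA -expr2 sqrr_sign mul1r (sqr_sum_gt0 si).
have np : \forall y \near z, 0 < (-1) ^+ b * \sum_i s y i * s' y i.
  have := cvgr_gt _ (c (nbhs_filter z) (nbhs_filter z)) _ p.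
  by move=> /(_ (nbhs_filter z)).
have nV : \forall y \near z, V y by apply: open_nbhs_nbhs.
have nV' : \forall y \near z, V' y by apply: open_nbhs_nbhs.
near=> y.
have Vy : V y by near: y.
have Vy' : V' y by near: y.
do 2!split=> //.
have [b' eb] := Pfib (VU _ Vy) (Vs _ Vy) (Vs' _ Vy').
have : 0 < (-1) ^+ b * \sum_i s y i * s' y i by near: y.
rewrite eb sg_sum mulrA.
have [j sj] := P0 (VU _ Vy) (Vs _ Vy).
have q := sqr_sum_gt0 sj.
rewrite pmulr_lgt0 // -signr_addb.
have [->|nb] := eqVneq b' b; first by [].
have -> : b (+) b' = true by move: nb; case: (b); case: (b').
by rewrite expr1 oppr_gt0 ltr10.
Unshelve. all: by end_near.
Qed.

Lemma local_section_near V s V' s' z :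
  local_section V s -> local_section V' s' -> V z -> V' z -> exists b : bool,
  \forall y \near z, V y /\ V' y /\ s' y = (fun i => (-1) ^+ b * s y i).
Proof.
move=> S S' Vz Vz'; have [oV VU Vs Vc] := S; have [_ _ Vs' _] := S'.
have [b e] := Pfib (VU _ Vz) (Vs _ Vz) (Vs' _ Vz').
by exists b; apply: local_section_compare S S' Vz Vz' e.
Qed.

(** The inner product [f] of the two lifts vanishes nowhere, so by the intermediate value theorem it
    keeps the sign it has at [b]. Agreement goes from [b] back to [a] because the contraction brings
    all points together at time 1. *)
Lemma path_lift_unique (q : R -> 'rV[R]_4) (ga ga' : R -> 'I_n -> R) (a b : R) :
  a <= b -> (forall t : R, a <= t <= b -> [/\ U (q t), P (q t) (ga t) & P (q t) (ga' t)]) ->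
  (forall i, {within `[a, b], continuous (fun t => ga t i)}) ->
  (forall i, {within `[a, b], continuous (fun t => ga' t i)}) ->
  ga b = ga' b -> ga a = ga' a.
Proof.
move=> ab H c c' e.
pose f t := \sum_i ga t i * ga' t i.
have fc : {within `[a, b], continuous f}.
  by move=> t; apply: (@cvg_sumM _ (nbhs t) (nbhs_filter t)) => i; [exact: c|exact: c'].
have fE t : a <= t <= b -> exists (d : bool) (m : R),
    [/\ 0 < m, f t = (-1) ^+ d * m & ga' t = (fun i => (-1) ^+ d * ga t i)].
  move=> /H[Uq P1 P2]; have [d ed] := Pfib Uq P1 P2; have [i gi] := P0 Uq P1.
  by exists d, (\sum_j ga t j * ga t j); split; [apply: sqr_sum_gt0 gi|rewrite /f ed sg_sum|].
have fb : 0 < f b.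
  have [|Uq P1 P2] := H b; first by rewrite ab lexx.
  by have [i gi] := P0 Uq P1; rewrite /f -e (sqr_sum_gt0 gi).
have [|d [m [m0 fa ->]]] := fE a; first by rewrite lexx.
case: d fa => fa; last by apply/funext => i; rewrite expr0 mul1r.
have fa0 : f a < 0 by rewrite fa expr1 mulN1r oppr_lt0.
have [|c0 /= c0i fc0] := IVT (v := 0) ab fc.
  by rewrite minElt maxElt (lt_trans fa0 fb) !ltW.
have [|d [m' [m'0 + _]]] := fE c0; first by rewrite in_itv in c0i.
by move/eqP; rewrite fc0 eq_sym mulf_eq0 signr_eq0 /= gt_eqF.
Qed.

Variables (x0 : 'rV[R]_4) (h : R * 'rV[R]_4 -> 'rV[R]_4).
Hypothesis Ux0 : U x0.
Hypothesis hc : {within [set p | 0 <= p.1 <= 1 /\ U p.2], continuous h}.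
Hypothesis hU : forall t x, 0 <= t <= 1 -> U x -> U (h (t, x)).
Hypothesis h0 : forall x, U x -> h (0, x) = x.
Hypothesis h1 : forall x, U x -> h (1, x) = x0.

(** Continuity within the strip yields a product neighbourhood, so one time radius [e] serves all
    [y] near [x]. This uniformity allows the paths of a whole neighbourhood to be lifted
    together. *)
Lemma homotopy_near (t : R) x (W : set 'rV[R]_4) : 0 <= t <= 1 -> U x -> nbhs (h (t, x)) W ->
  exists e, 0 < e /\ exists2 N, nbhs x N &
    forall r y, `|t - r| < e -> 0 <= r <= 1 -> N y -> U y -> W (h (r, y)).
Proof.
move=> t01 Ux nW.
have /subspace_continuousP/(_ (t, x)) := hc.
move=> /(_ (conj t01 Ux)) /(_ _ nW) [[A B] [/= nA nB] sub].
move/nbhs_ballP: nA => [e /= e0 eA]; exists e; split=> //; exists B => // r y er r01 By Uy.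
by apply: (sub (r, y)) => //=; split=> //=; apply: eA.
Qed.

Lemma homotopy_path_continuous V s (a b : R) y i : local_section V s -> U y -> 0 <= a -> b <= 1 ->
  (forall t, a <= t <= b -> V (h (t, y))) ->
  {within `[a, b], continuous (fun t => s (h (t, y)) i)}.
Proof.
move=> [oV VU Vs Vc] Uy a0 b1 hV; apply/subspace_continuousP => t /=.
rewrite in_itv /= => tab; have /andP[at_ tb] := tab.
have t01 : 0 <= t <= 1 by rewrite (le_trans a0 at_) (le_trans tb b1).
move=> W nW; have := Vc i _ (hV _ tab) W nW.
move=> /(homotopy_near t01 Uy) [e [e0 [N nN H]]].
rewrite /nbhs /=; apply/nbhs_ballP; exists e => //= r er rab.
apply: H => //; last exact: nbhs_singleton.
by move: rab; rewrite /= in_itv /= => /andP[ar rb]; rewrite (le_trans a0 ar) (le_trans rb b1).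
Qed.

Variable v0 : 'I_n -> R.

(** The lift is prescribed at time 1, where every path is at [x0], and followed backwards; at time 0
    it lies over [y] itself. *)
Definition lifted y (t : R) v := exists ga : R -> 'I_n -> R,
  [/\ ga 1 = v0, ga t = v, forall r, t <= r <= 1 -> P (h (r, y)) (ga r)
    & forall i, {within `[t, 1], continuous (fun r => ga r i)}].

Lemma lifted_unique y (t : R) v w : U y -> 0 <= t <= 1 -> lifted y t v -> lifted y t w -> v = w.
Proof.
move=> Uy /andP[t0 t1] [g [g1 <- gP gc]] [g' [g1' <- gP' gc']].
apply: (path_lift_unique (q := fun r => h (r, y)) t1) => //; last by rewrite g1 g1'.
move=> r tr1; split; [|exact: gP|exact: gP'].
by apply: hU => //; have /andP[tr ->] := tr1; rewrite (le_trans t0 tr).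
Qed.

(** On [[a, b]] the lift is [s] composed with the path; it joins the given lift on [[b, 1]] because
    both have the value [s (h (b, y))] at [b]. *)
Lemma lifted_extend V s y (a b : R) : local_section V s -> U y -> 0 <= a -> a <= b -> b <= 1 ->
  (forall t, a <= t <= b -> V (h (t, y))) -> lifted y b (s (h (b, y))) ->
  lifted y a (s (h (a, y))).
Proof.
move=> S Uy a0 ab b1 hV [g [g1 gb gP gc]]; have [oV VU Vs Vc] := S.
pose g' r := if r <= b then s (h (r, y)) else g r.
have g'l r : r <= b -> g' r = s (h (r, y)) by rewrite /g' => ->.
have g'r r : b <= r -> g' r = g r.
  rewrite le_eqVlt => /orP[/eqP <-|br]; first by rewrite g'l // gb.
  by rewrite /g' leNgt br.
exists g'; split; first by rewrite g'r.
- by rewrite g'l.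
- move=> r /andP[ar r1]; have [rb|/ltW br] := leP r b.
    by rewrite g'l //; apply/Vs/hV; rewrite ar.
  by rewrite g'r //; apply: gP; rewrite br.
move=> i.
have -> : `[a, 1]%classic = `[a, b] `|` `[b, 1].
  apply/seteqP; split=> r /=; rewrite !in_itv /=.
    by move=> /andP[ar r1]; have [rb|/ltW br] := leP r b; [left; rewrite ar|right; rewrite br].
  by case=> /andP[p q]; [rewrite p (le_trans q b1)|rewrite q (le_trans ab p)].
apply: withinU_continuous; try exact: itv_closed.
- apply: subspace_eq_continuous (@homotopy_path_continuous _ _ _ _ _ i S Uy a0 b1 hV).
  by move=> r; rewrite inE /= in_itv /= => /andP[_ rb]; exact: (congr1 (@^~ i) (esym (g'l r rb))).
- apply: subspace_eq_continuous (gc i).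
  by move=> r; rewrite inE /= in_itv /= => /andP[br _]; exact: (congr1 (@^~ i) (esym (g'r r br))).
Qed.

Hypothesis Ploc : forall x, U x -> exists V s, local_section V s /\ V x.
Hypothesis Pv0 : P x0 v0.

(** The invariant of the backward continuation: for all [y] near [x] the lifts at time [t] are
    values of a single local section, which gives existence and continuous dependence on [y] at
    once. *)
Definition lifted_near x t := exists V s,
  [/\ local_section V s, V (h (t, x)) & \forall y \near x, U y -> lifted y t (s (h (t, y)))].

Lemma lifted_near1 x : U x -> lifted_near x 1.
Proof.
move=> Ux; have [V [s [S Vx]]] := Ploc Ux0; have [oV VU Vs Vc] := S.
have [b e] := Pfib Ux0 (Vs _ Vx) Pv0.
exists V, (fun y i => (-1) ^+ b * s y i); split; first exact: local_section_sg.
  by rewrite h1.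
near=> y => Uy; rewrite h1 // -e; exists (fun=> v0); split=> //.
  by move=> r; rewrite -eq_le => /eqP <-; rewrite h1.
by move=> i; apply/subspace_continuousP => r _; apply: cvg_cst.
Unshelve. all: by end_near.
Qed.

(** Let [a] be the infimum of the times reached. A local section around [h (a, x)] covers the paths
    of all nearby [y] during an interval around [a], so a time reached just after [a] can be pushed
    below [a], unless [a] is 0. *)
Lemma lifted_near0 x : U x -> lifted_near x 0.
Proof.
move=> Ux; pose A := [set t : R | 0 <= t <= 1 /\ lifted_near x t].
have A1 : A 1 by split; [rewrite ler01 lexx|exact: lifted_near1].
have lbA : lbound A 0 by move=> t [/andP[]].
have hA : has_inf A by split; [exists 1|exists 0].
set a := inf A.
have a0 : 0 <= a by apply: lb_le_inf => //; exists 1.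
have aA t : A t -> a <= t by apply: ge_inf; exists 0.
have a1 : a <= 1 by apply: aA.
have a01 : 0 <= a <= 1 by rewrite a0.
have [V [s [S Vx]]] := Ploc (hU a01 Ux); have [oV VU Vs Vc] := S.
have nV : nbhs (h (a, x)) V by apply: open_nbhs_nbhs.
have [e [e0 [N nN hV]]] := homotopy_near a01 Ux nV.
have [t [t01 [V1 [s1 [S1 V1x n1]]]] ta] := inf_adherent e0 hA.
have at_ : a <= t by apply: aA; split=> //; exists V1, s1.
have Nx : N x by apply: nbhs_singleton.
have tae : `|a - t| < e by rewrite distrC ger0_norm ?subr_ge0 // ltrBlDl.
have Vtx : V (h (t, x)) by apply: hV.
(* The section [s] may lie on the other sheet than [s1], which was reached at time [t]; the sign [b]
   corrects this near [h (t, x)]. *)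
have [b nb] := local_section_near S S1 Vtx V1x.
have [e' [e'0 [N' nN' H']]] := homotopy_near t01 Ux nb.
have Sb := local_section_sg b S.
(* Half of [e] stays inside the interval covered by [V], and the maximum keeps the time nonnegative.
   When [a] is 0, [t2] is 0 as well, so time 0 is itself reached. *)
pose t2 := Num.max 0 (a - e / 2).
have t20 : 0 <= t2 by rewrite le_max lexx.
have t2a : t2 <= a by rewrite ge_max a0 /= gerBl; lra.
have t2t := le_trans t2a at_.
have near2 r : t2 <= r <= t -> `|a - r| < e /\ 0 <= r <= 1.
  move=> /andP[t2r rt]; have /andP[_ t1] := t01.
  have r0 := le_trans t20 t2r; have r1 := le_trans rt t1; split; last by rewrite r0.
  have : a - e / 2 <= r by apply: le_trans t2r; rewrite le_max lexx orbT.
  move=> ?; rewrite -/a in ta; rewrite ltr_norml; apply/andP; split; lra.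
have At2 : A t2.
  split; first by rewrite t20 (le_trans t2a a1).
  exists V, (fun y i => (-1) ^+ b * s y i); split=> //.
    by have [|? ?] := near2 t2; [rewrite lexx t2t|apply: hV].
  near=> y => Uy.
  have Ny : N y by near: y.
  have Ny' : N' y by near: y.
  have Ly : U y -> lifted y t (s1 (h (t, y))) by near: y.
  apply: (lifted_extend Sb Uy t20 t2t); first by have /andP[] := t01.
    by move=> r /near2[? ?]; apply: hV.
  have := H' t y; rewrite subrr normr0 => /(_ e'0 t01 Ny' Uy) [_ [_ <-]].
  exact: Ly.
have := aA _ At2; rewrite le_max => /orP[a0'|]; last by lra.
have az : a = 0 by apply/eqP; rewrite eq_le a0 a0'.
by have [_] := At2; rewrite /t2 az max_l //; lra.
Unshelve. all: by end_near.
Qed.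

End SignLift.

(** The value at [y] comes from lifting the path from [y] to [x0]. Agreement up to sign with every
    local section is recorded because it transfers smoothness to the global section. *)
Lemma contractible_section (R : realType) (n : nat) (U : set 'rV[R]_4)
    (P : 'rV[R]_4 -> ('I_n -> R) -> Prop) :
  open U -> contractible U ->
  (forall y v, U y -> P y v -> exists i, v i != 0) ->
  (forall y v (b : bool), U y -> P y v -> P y (fun i => (-1) ^+ b * v i)) ->
  (forall y v w, U y -> P y v -> P y w -> exists b : bool, w = fun i => (-1) ^+ b * v i) ->
  (forall x, U x -> exists V s, local_section U P V s /\ V x) ->
  exists s, (forall y, U y -> P y (s y)) /\
    forall V s' x, local_section U P V s' -> V x -> exists b : bool,
      \forall y \near x, V y /\ s y = (fun i => (-1) ^+ b * s' y i).
Proof.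
move=> oU [x0 [h [Ux0 hc hU h0 h1]]] P0 Psg Pfib Ploc.
have [V0 [s0 [[_ _ Ps0 _] V0x]]] := Ploc _ Ux0; have Pv0 := Ps0 _ V0x.
set v0 := s0 x0 in Pv0.
have L y : U y -> lifted_near U P h v0 y 0.
  by move=> Uy; apply: (lifted_near0 P0 Psg Pfib Ux0 hc hU h1 Ploc Pv0).
(* Choice needs a value at every point of the ambient space; outside [U] it is the dummy [v0]. *)
have E y : exists v, U y -> lifted P h v0 y 0 v.
  have [Uy|nUy] := pselect (U y); last by exists v0.
  have [V [s [_ _ nl]]] := L y Uy; exists (s (h (0, y))) => _.
  exact: (nbhs_singleton nl).
have [s sP] := choice E; exists s.
have nearL x V s' : U x -> local_section U P V s' -> V x -> exists b : bool,
      \forall y \near x, V y /\ s y = (fun i => (-1) ^+ b * s' y i).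
  move=> Ux S' Vx; have [V1 [s1 [S1 + n1]]] := L x Ux; rewrite h0 // => V1x.
  have [b nb] := local_section_near P0 Pfib S' S1 Vx V1x; exists b.
  have nU : \forall y \near x, U y by apply: open_nbhs_nbhs.
  near=> y.
  have Uy : U y by near: y.
  have [Vy [_ <-]] : V y /\ V1 y /\ s1 y = (fun i => (-1) ^+ b * s' y i) by near: y.
  split=> //; apply: (lifted_unique P0 Pfib hU (t := 0) Uy) => //.
  - by rewrite lexx ler01.
  - exact: sP.
  have : U y -> lifted P h v0 y 0 (s1 (h (0, y))) by near: y.
  by rewrite h0 //; apply.
split.
  move=> y Uy; have [g [_ gs gP _]] := sP y Uy.
  by rewrite -gs -[X in P X _]h0 //; apply: gP; rewrite lexx ler01.
by move=> V s' x S' Vx; have [_ VU _ _] := S'; apply: nearL => //; apply: VU.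
Unshelve. all: by end_near.
Qed.

(** The sign is read off at [x0], and uniqueness of lifts along the path from [y] to [x0] carries it
    to every [y]. *)
Lemma contractible_section_unique (R : realType) (n : nat) (U : set 'rV[R]_4)
    (P : 'rV[R]_4 -> ('I_n -> R) -> Prop) s s' :
  contractible U ->
  (forall y v, U y -> P y v -> exists i, v i != 0) ->
  (forall y v (b : bool), U y -> P y v -> P y (fun i => (-1) ^+ b * v i)) ->
  (forall y v w, U y -> P y v -> P y w -> exists b : bool, w = fun i => (-1) ^+ b * v i) ->
  local_section U P U s -> local_section U P U s' ->
  exists b : bool, forall y, U y -> s' y = fun i => (-1) ^+ b * s y i.
Proof.
move=> [x0 [h [Ux0 hc hU h0 h1]]] P0 Psg Pfib S S'; have [oU _ Ps sc] := S.
have [_ _ Ps' sc'] := S'.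
have [b eb] := Pfib _ _ _ Ux0 (Ps _ Ux0) (Ps' _ Ux0); exists b => y Uy.
have Sb := local_section_sg Psg b S; have [_ _ Pb _] := Sb.
have := @path_lift_unique _ _ _ _ P0 Pfib (fun t => h (t, y))
  (fun t => s' (h (t, y))) (fun t i => (-1) ^+ b * s (h (t, y)) i) 0 1 ler01.
rewrite /= h0 //; apply.
- by move=> t t01; have Uh := hU _ _ t01 Uy; split; [|apply: Ps'|apply: Pb].
- move=> i; apply: (homotopy_path_continuous hc S' Uy) => // t t01; exact: hU.
- move=> i; apply: (homotopy_path_continuous hc Sb Uy) => // t t01; exact: hU.
- by rewrite h1.
Qed.

(** * Determinants of four rows *)

Lemma ord4_ind (P : 'I_4 -> Prop) : P 0 -> P 1 -> P 2 -> P 3 -> forall i, P i.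
Proof.
move=> p0 p1 p2 p3 [[|[|[|[|//]]]] lti].
- by have -> : Ordinal lti = 0 by apply: val_inj.
- by have -> : Ordinal lti = 1 by apply: val_inj.
- by have -> : Ordinal lti = 2 by apply: val_inj.
- by have -> : Ordinal lti = 3 by apply: val_inj.
Qed.

Lemma ord2_ind (P : 'I_2 -> Prop) : P 0 -> P 1 -> forall i, P i.
Proof.
move=> p0 p1 [[|[|//]] lti].
- by have -> : Ordinal lti = 0 by apply: val_inj.
- by have -> : Ordinal lti = 1 by apply: val_inj.
Qed.

Lemma sum4 (V : nmodType) (F : 'I_4 -> V) : \sum_(i < 4) F i = F 0 + F 1 + F 2 + F 3.
Proof.
rewrite !big_ord_recl big_ord0 addr0 !addrA.
by congr (F _ + F _ + F _ + F _); apply: val_inj.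
Qed.

Lemma sum2 (V : nmodType) (F : 'I_2 -> V) : \sum_(i < 2) F i = F 0 + F 1.
Proof. by rewrite !big_ord_recl big_ord0 addr0; congr (F _ + F _); apply: val_inj. Qed.

Lemma ord4_neq : (((0 == 1 :> 'I_4) = false) * ((0 == 2 :> 'I_4) = false) *
  ((0 == 3 :> 'I_4) = false) * ((1 == 0 :> 'I_4) = false) * ((1 == 2 :> 'I_4) = false) *
  ((1 == 3 :> 'I_4) = false) * ((2 == 0 :> 'I_4) = false) * ((2 == 1 :> 'I_4) = false) *
  ((2 == 3 :> 'I_4) = false) * ((3 == 0 :> 'I_4) = false) * ((3 == 1 :> 'I_4) = false) *
  ((3 == 2 :> 'I_4) = false))%type.
Proof. by []. Qed.

Lemma ord2_neq : (((0 == 1 :> 'I_2) = false) * ((1 == 0 :> 'I_2) = false))%type.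
Proof. by []. Qed.

Definition ordE := (eqxx, ord4_neq, ord2_neq).

Section Det4.
Variable K : comNzRingType.
Implicit Types u v w z : 'I_4 -> K.

(** The nested cofactor expansion as a plain polynomial, so that identities between four-forms
    become goals for [ring]. *)
Definition det_rows u v w z : K :=
  let m i j := w i * z j - w j * z i in
  let n i j k := v i * m j k - v j * m i k + v k * m i j in
  u 0 * n 1 2 3 - u 1 * n 0 2 3 + u 2 * n 0 1 3 - u 3 * n 0 1 2.

Lemma det3 (B : 'M[K]_3) (b := fun i j : nat => B (inord i) (inord j)) :
  \det B = b 0 0 * (b 1 1 * b 2 2 - b 1 2 * b 2 1)
    - b 0 1 * (b 1 0 * b 2 2 - b 1 2 * b 2 0) + b 0 2 * (b 1 0 * b 2 1 - b 1 1 * b 2 0).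
Proof.
have bE i j : B i j = b i j by rewrite /b !inord_val.
rewrite (expand_det_row _ ord0) !big_ord_recl big_ord0 /cofactor.
rewrite !(expand_det_row _ ord0) !big_ord_recl !big_ord0 /cofactor.
rewrite !det_mx11 !mxE !bE /= /bump /= !addn0 !add0n.
by rewrite !(expr0, expr1, exprS, add0n, addn0, addr0) /=; ring.
Qed.

Lemma det_det_rows (A : 'M[K]_4) : \det A = det_rows (A 0) (A 1) (A 2) (A 3).
Proof.
pose f (i j : nat) := A (inord i) (inord j).
have fE i j : A i j = f i j by rewrite /f !inord_val.
rewrite /det_rows !fE /= (expand_det_row _ ord0) !big_ord_recl big_ord0 /cofactor.
rewrite !det3 !mxE !fE /= /bump /= !inordK //= !addn0 !add0n.
by rewrite !(expr0, expr1, exprS, add0n, addn0, addr0) /=; ring.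
Qed.

Definition rowmul u (M : 'M[K]_4) : 'I_4 -> K := fun j => \sum_k u k * M k j.

Lemma det_rows_mulmx u v w z (M : 'M[K]_4) :
  det_rows (rowmul u M) (rowmul v M) (rowmul w M) (rowmul z M) = det_rows u v w z * \det M.
Proof.
pose A : 'M[K]_4 := \matrix_(i, j) tnth [tuple u; v; w; z] i j.
have <- : \det A = det_rows u v w z by rewrite det_det_rows /det_rows !mxE.
have r i x : (forall j, A i j = x j) -> (A *m M) i = rowmul x M.
  move=> Ai; apply/funext => j; rewrite mxE; apply: eq_bigr => k _.
  by rewrite Ai.
rewrite -det_mulmx det_det_rows !(r 0 u, r 1 v, r 2 w, r 3 z) // => j; by rewrite mxE.
Qed.

(** Linearity in the first two rows; it evaluates the double sum against the antisymmetric symbol in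
    the Hodge star. *)
Lemma det_rows_sum u v w z :
  \sum_i \sum_j u i * v j * det_rows (fun k => (i == k)%:R) (fun k => (j == k)%:R) w z
  = det_rows u v w z.
Proof. by rewrite !sum4 /det_rows !ordE /=; ring. Qed.

End Det4.

Lemma levi_civitaE (R : realType) a b c d : levi_civita R a b c d =
  det_rows (fun k => (a == k)%:R) (fun k => (b == k)%:R) (fun k => (c == k)%:R)
     (fun k => (d == k)%:R).
Proof. by rewrite /levi_civita det_det_rows /det_rows !mxE. Qed.

(** * Lorentz matrices *)

Section Lorentz.
Variable R : realType.
Implicit Types (G T E L M : 'M[R]_4) (u v : 'I_4 -> R).

Lemma etaE (j k : 'I_4) : eta R j k = if j == k then (if j == 0 then 1 else -1) else 0.
Proof. by rewrite mxE. Qed.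

Lemma eta_sum u v : \sum_(j < 4) \sum_(k < 4) eta R j k * u j * v k =
  u 0 * v 0 - u 1 * v 1 - u 2 * v 2 - u 3 * v 3.
Proof. by rewrite !sum4 !etaE !ordE /=; ring. Qed.

Lemma tr_eta : (eta R)^T = eta R.
Proof.
by apply/matrixP => i j; rewrite mxE !etaE [j == i]eq_sym; case: eqP => // ->.
Qed.

Lemma eta_mul (n : nat) (A : 'M[R]_(4, n)) i j :
  (eta R *m A) i j = (if i == 0 then 1 else -1) * A i j.
Proof.
by rewrite mxE sum4 !etaE; elim/ord4_ind: i; rewrite !ordE; ring.
Qed.

Lemma mul_eta (n : nat) (A : 'M[R]_(n, 4)) i j :
  (A *m eta R) i j = A i j * (if j == 0 then 1 else -1).
Proof.
by rewrite mxE sum4 !etaE; elim/ord4_ind: j; rewrite !ordE; ring.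
Qed.

Lemma eta2 : eta R *m eta R = 1%:M.
Proof.
apply/matrixP => i j; rewrite eta_mul etaE mxE.
by elim/ord4_ind: i; elim/ord4_ind: j; rewrite !ordE /=; ring.
Qed.

Lemma gram_mxE T i j : (T^T *m eta R *m T) i j =
  T 0 i * T 0 j - T 1 i * T 1 j - T 2 i * T 2 j - T 3 i * T 3 j.
Proof. by rewrite -mulmxA mxE sum4 !eta_mul !mxE !ordE; ring. Qed.

Lemma gramP G T :
  (forall al be, G al be = \sum_(j < 4) \sum_(k < 4) eta R j k * T j al * T k be) <->
  G = T^T *m eta R *m T.
Proof.
split=> [H|-> al be]; last by rewrite gram_mxE -(eta_sum (T^~ al) (T^~ be)).
by apply/matrixP => al be; rewrite H gram_mxE -(eta_sum (T^~ al) (T^~ be)).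
Qed.

Lemma lorentz_mxP L : lorentz_mx L <->
  [/\ L^T *m eta R *m L = eta R, 0 < \det L & 0 < L 0 0].
Proof.
split=> -[H dL L0]; split=> //; first by apply/esym/gramP => r s; rewrite H.
by move=> r s; rewrite -{2}H gram_mxE -(eta_sum (L^~ r) (L^~ s)).
Qed.

Lemma lorentz_inv L : L^T *m eta R *m L = eta R ->
  (eta R *m L^T *m eta R) *m L = 1%:M /\ L *m (eta R *m L^T *m eta R) = 1%:M.
Proof.
move=> H.
have e : (eta R *m L^T *m eta R) *m L = 1%:M by rewrite -!mulmxA [L^T *m _]mulmxA H eta2.
by split=> //; apply: mulmx1C.
Qed.

Lemma lorentz_tr L : L^T *m eta R *m L = eta R -> L *m eta R *m L^T = eta R.
Proof.
move=> /lorentz_inv[_ H].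
by have := congr1 (mulmx^~ (eta R)) H; rewrite mul1mx -!mulmxA eta2 mulmx1.
Qed.

Lemma lorentz_row0 L i j : L^T *m eta R *m L = eta R ->
  L i 0 * L j 0 - L i 1 * L j 1 - L i 2 * L j 2 - L i 3 * L j 3 = eta R i j.
Proof.
move=> /lorentz_tr <-; rewrite -[X in _ = (X *m _ *m _) _ _]trmxK gram_mxE.
by rewrite !mxE.
Qed.

(** By Cauchy-Schwarz, obtained here from the Lagrange identity, the space part satisfies
    [S^2 <= (a0^2 - 1) (b0^2 - 1)], which is less than [(a0 b0)^2]; the time part therefore
    dominates. *)
Lemma timelike_pos (a0 a1 a2 a3 b0 b1 b2 b3 : R) :
  a0 * a0 - a1 * a1 - a2 * a2 - a3 * a3 = 1 ->
  b0 * b0 - b1 * b1 - b2 * b2 - b3 * b3 = 1 -> 0 < a0 -> 0 < b0 ->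
  0 < a0 * b0 + a1 * b1 + a2 * b2 + a3 * b3.
Proof.
move=> ea eb pa pb; rewrite ltNge; apply/negP => le0.
set S := a1 * b1 + a2 * b2 + a3 * b3.
have cs : S * S <= (a0 * a0 - 1) * (b0 * b0 - 1).
  have -> : a0 * a0 - 1 = a1 * a1 + a2 * a2 + a3 * a3 by lra.
  have -> : b0 * b0 - 1 = b1 * b1 + b2 * b2 + b3 * b3 by lra.
  have h1 := sqr_ge0 (a1 * b2 - a2 * b1).
  have h2 := sqr_ge0 (a1 * b3 - a3 * b1).
  have h3 := sqr_ge0 (a2 * b3 - a3 * b2).
  rewrite -subr_ge0; apply: le_trans (addr_ge0 (addr_ge0 h1 h2) h3) _.
  by rewrite le_eqVlt; apply/orP; left; apply/eqP; rewrite /S; ring.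
have pab : 0 < a0 * b0 by rewrite mulr_gt0.
have lS : a0 * b0 <= - S by rewrite /S; lra.
have : (a0 * b0) * (a0 * b0) <= (- S) * (- S) by apply: ler_pM => //; apply: ltW.
have := sqr_ge0 a1; have := sqr_ge0 a2; have := sqr_ge0 a3.
have := sqr_ge0 b1; have := sqr_ge0 b2; have := sqr_ge0 b3.
by rewrite !expr2 => *; nra.
Qed.

(** The entry pairs row 0 of [L] with column 0 of [M]; both are unit timelike with positive time
    component. *)
Lemma lorentz_mul00 L M : L^T *m eta R *m L = eta R -> M^T *m eta R *m M = eta R ->
  0 < L 0 0 -> 0 < M 0 0 -> 0 < (L *m M) 0 0.
Proof.
move=> HL HM L0 M0; rewrite mxE sum4.
have := lorentz_row0 0 0 HL; have := gram_mxE M 0 0; rewrite HM etaE !ordE => eM eL.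
exact: timelike_pos eL (esym eM) L0 M0.
Qed.

(** [L'] is the inverse of [L]. That both have the same [00] entry makes agreement of time
    orientation symmetric. *)
Lemma lorentz_adj L : L^T *m eta R *m L = eta R ->
  let L' := eta R *m L^T *m eta R in L'^T *m eta R *m L' = eta R /\ L' 0 0 = L 0 0.
Proof.
move=> HL /=; split; last by rewrite mul_eta eta_mul !mxE !eqxx; ring.
rewrite !trmx_mul trmxK tr_eta.
have -> : eta R *m (L *m eta R) *m eta R *m (eta R *m L^T *m eta R) =
    eta R *m (L *m (eta R *m eta R) *m eta R *m L^T) *m eta R by rewrite !mulmxA.
by rewrite eta2 mulmx1 lorentz_tr // eta2 mul1mx.
Qed.

Lemma mulmx1_invmx (K : comUnitRingType) n (A B : 'M[K]_n) : A *m B = 1%:M -> invmx A = B.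
Proof.
move=> AB; have [uA _] := mulmx1_unit AB.
by rewrite -[LHS]mulmx1 -AB mulmxA mulVmx // mul1mx.
Qed.

Lemma gram_invmx G E : E \in unitmx -> G = E^T *m eta R *m E ->
  invmx G = invmx E *m eta R *m (invmx E)^T.
Proof.
move=> uE ->; apply: mulmx1_invmx.
have -> : E^T *m eta R *m E *m (invmx E *m eta R *m (invmx E)^T) =
    E^T *m (eta R *m (E *m invmx E) *m eta R) *m (invmx E)^T by rewrite !mulmxA.
by rewrite mulmxV // mulmx1 eta2 mulmx1 -trmx_mul mulVmx // trmx1.
Qed.

Lemma gram_lorentz G E T : E \in unitmx -> G = E^T *m eta R *m E ->
  G = T^T *m eta R *m T ->
  (T *m invmx E)^T *m eta R *m (T *m invmx E) = eta R.
Proof.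
move=> uE GE GT.
have -> : (T *m invmx E)^T *m eta R *m (T *m invmx E) =
    (invmx E)^T *m (T^T *m eta R *m T) *m invmx E by rewrite trmx_mul !mulmxA.
rewrite -GT GE -!mulmxA mulmxV // mulmx1 mulmxA -trmx_mul mulmxV //.
by rewrite trmx1 mul1mx.
Qed.

Lemma cov_innerE G (A B : 'M[R]_4) i j :
  cov_inner G (A i) (B j) = (A *m invmx G *m B^T) i j.
Proof.
rewrite /cov_inner mxE exchange_big /=; apply: eq_bigr => k _.
rewrite !mxE mulr_suml; apply: eq_bigr => l _; ring.
Qed.

(** Turns the time orientation of coframes into the sign of the [00] entry of the Lorentz matrix
    between them. *)
Lemma cov_inner_lorentz G E T : E \in unitmx -> G = E^T *m eta R *m E ->
  cov_inner G (E 0) (T 0) = (T *m invmx E) 0 0.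
Proof.
move=> uE GE; rewrite cov_innerE (gram_invmx uE GE).
have -> : E *m (invmx E *m eta R *m (invmx E)^T) *m T^T =
   (E *m invmx E) *m (eta R *m (T *m invmx E)^T) by rewrite trmx_mul !mulmxA.
by rewrite mulmxV // mul1mx eta_mul eqxx mul1r mxE.
Qed.

Lemma sqrt_det_gram G E : G = E^T *m eta R *m E -> Num.sqrt `|\det G| = `|\det E|.
Proof.
move=> ->; rewrite !det_mulmx det_tr.
have : `|\det (eta R)| ^+ 2 = 1.
  by rewrite -normrX expr2 -det_mulmx eta2 det1 normr1.
move/eqP; rewrite sqrp_eq1 // => /eqP e.
rewrite !normrM e mulr1 -expr2 sqrtr_sqr normr_id //.
Qed.

End Lorentz.

(** * Pauli matrices of a frame *)

Section PauliAlgebra.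
Variable R : realType.
Implicit Types (G T E L : 'M[R]_4).
Local Notation C := R[i].
Local Notation toC := (map_mx (real_complex R)).
Local Notation conjmx := (map_mx (@conjc R)).

(* A folded copy of ['i], which would itself match the pattern [_ +i* _]. *)
Definition iC : C := 'i%C.
Local Notation Ci := iC.

(** This form lets [ring] compute with complex pairs, with [iC_sqr] as a side equation. *)
Lemma complex_pairE (a b : R) : (a +i* b)%C = a%:C%C + Ci * b%:C%C.
Proof. rewrite /iC; by apply/eqP; rewrite eq_complex /=; apply/andP; split; apply/eqP; ring. Qed.

Lemma iC_sqr : Ci * Ci = -1.
Proof. rewrite /iC; by apply/eqP; rewrite eq_complex /=; apply/andP; split; apply/eqP; ring. Qed.

Lemma conjc_iC : conjc Ci = - Ci.
Proof. rewrite /iC; by apply/eqP; rewrite eq_complex /=; apply/andP; split; apply/eqP; ring. Qed.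

Definition lc T : form1 C := fun al => (T 0 al + T 3 al)%:C%C.
Definition mc T : form1 C := fun al => (T 1 al +i* T 2 al)%C.

Lemma lmE (th : 'rV[R]_4 -> 'M[R]_4) x : lm th x = wedge11 (lc (th x)) (mc (th x)).
Proof. by []. Qed.

(** In matrix form, a change of coframe acts on [l /\ m] by a congruence, which can be cancelled. *)
Definition lmx T : 'M[C]_4 := \matrix_(a, b) wedge11 (lc T) (mc T) a b.

Lemma lc_mul L E al : lc (L *m E) al = \sum_k lc L k * (E k al)%:C%C.
Proof. rewrite /lc !mxE !sum4; ring. Qed.

Lemma mc_mul L E al : mc (L *m E) al = \sum_k mc L k * (E k al)%:C%C.
Proof. rewrite /mc !complex_pairE !mxE !sum4 !complex_pairE; ring. Qed.

Lemma lmx_mul L E : lmx (L *m E) = (toC E)^T *m lmx L *m toC E.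
Proof.
apply/matrixP => a b; rewrite !mxE /wedge11 !lc_mul !mc_mul !sum4 !mxE !sum4 !mxE /wedge11.
ring.
Qed.

Lemma toC_unit E : E \in unitmx -> toC E \in unitmx.
Proof. by rewrite map_unitmx. Qed.

Lemma lmx1_neq0 : lmx 1%:M != 0.
Proof.
apply/eqP => /matrixP/(_ 0 1); rewrite !mxE /wedge11 /lc /mc !mxE !ordE /= => /eqP.
rewrite eq_complex /= => /andP[/eqP + _]; apply/eqP.
by rewrite !(addr0, add0r, mulr0, mulr1, subr0, mul0r) oner_eq0.
Qed.

Lemma sandwich_inj (K : comUnitRingType) n (A B M M' : 'M[K]_n) :
  A \in unitmx -> B \in unitmx -> A *m M *m B = A *m M' *m B -> M = M'.
Proof. by move=> uA uB /(can_inj (mulmxK uB))/(can_inj (mulKmx uA)). Qed.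

Lemma lmx_neq0 E : E \in unitmx -> lmx E != 0.
Proof.
move=> uE; apply/eqP => e0; move/eqP: lmx1_neq0; apply.
have uC := toC_unit uE.
apply: (@sandwich_inj _ _ (toC E)^T (toC E)); [by rewrite unitmx_tr|exact: uC|].
by rewrite -lmx_mul mul1mx e0 mulmx0 mul0mx.
Qed.

Lemma lmx_inj E L L' : E \in unitmx -> lmx (L *m E) = lmx (L' *m E) -> lmx L = lmx L'.
Proof.
move=> uE; have uC := toC_unit uE; rewrite !lmx_mul.
by apply: sandwich_inj; [rewrite unitmx_tr|].
Qed.

Lemma det_rows_rmorph (u v w z : 'I_4 -> R) :
  (det_rows u v w z)%:C%C = det_rows (fun k => (u k)%:C%C) (fun k => (v k)%:C%C)
     (fun k => (w k)%:C%C) (fun k => (z k)%:C%C).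
Proof. rewrite /det_rows; ring. Qed.

Definition dlt (K : comNzRingType) (a : 'I_4) : form1 K := fun k => (a == k)%:R.

Definition sharp G (u : form1 C) : form1 C :=
  fun a => \sum_mu (invmx G a mu)%:C%C * u mu.

(** The star inserts the two raised covectors into the volume form; the factor one half cancels
    against their two orders. *)
Lemma hodge_wedge G (u v : form1 C) ga de :
  hodge2 G (wedge11 u v) ga de = (Num.sqrt `|\det G|)%:C%C *
    det_rows (sharp G u) (sharp G v) (dlt C ga) (dlt C de).
Proof.
rewrite /hodge2.
have e a b : \sum_(mu < 4) \sum_(nu < 4)
    (invmx G a mu * invmx G b nu)%:C%C * wedge11 u v mu nu =
    sharp G u a * sharp G v b - sharp G v a * sharp G u b.
  rewrite /sharp !mulr_suml -sumrB; apply: eq_bigr => mu _.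
  rewrite !mulr_sumr -sumrB; apply: eq_bigr => nu _.
  by rewrite /wedge11; ring.
have lc_det a b : (levi_civita R a b ga de)%:C%C =
    det_rows (dlt C a) (dlt C b) (dlt C ga) (dlt C de).
  rewrite levi_civitaE det_rows_rmorph /det_rows /dlt.
  by rewrite !(rmorph_nat (real_complex R)).
transitivity (2^-1 * (Num.sqrt `|\det G|)%:C%C *
  (\sum_a \sum_b sharp G u a * sharp G v b * det_rows (dlt C a) (dlt C b) (dlt C ga) (dlt C de)
  - \sum_a \sum_b sharp G v a * sharp G u b * det_rows (dlt C a) (dlt C b) (dlt C ga) (dlt C de))).
  congr (_ * _); rewrite -sumrB; apply: eq_bigr => a _; rewrite -sumrB.
  by apply: eq_bigr => b _; rewrite e lc_det; ring.
by rewrite !det_rows_sum /det_rows; field.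
Qed.

(** Multiplying all four rows of the determinant by the transpose of [E] turns the raised [l] and
    [m] into constant combinations of columns of [eta], at the cost of the factor [\det E]. The sign
    of [\det E] thus decides between the eigenvalues [-i] and [i]. *)
Lemma hodge_lm G E ga de : E \in unitmx -> G = E^T *m eta R *m E ->
  (\det E)%:C%C * hodge2 G (wedge11 (lc E) (mc E)) ga de =
  (`|\det E|)%:C%C * (- Ci * wedge11 (lc E) (mc E) ga de).
Proof.
move=> uE GE; rewrite hodge_wedge (sqrt_det_gram GE) mulrCA; congr (_ * _).
have EG i j : \sum_k (E i k)%:C%C * sharp G (fun mu => (E j mu)%:C%C) k = (eta R i j)%:C%C.
  have : E *m invmx G *m E^T = eta R.
    rewrite (gram_invmx uE GE).
    have -> : E *m (invmx E *m eta R *m (invmx E)^T) *m E^T =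
      (E *m invmx E) *m eta R *m (E *m invmx E)^T by rewrite trmx_mul !mulmxA.
    by rewrite mulmxV // trmx1 mul1mx mulmx1.
  move=> <-; rewrite -mulmxA mxE rmorph_sum; apply: eq_bigr => k _.
  rewrite rmorphM /sharp mxE rmorph_sum; congr (_ * _).
  by apply: eq_bigr => l _; rewrite rmorphM !mxE.
have sD u v : sharp G (fun mu => u mu + v mu) = fun a => sharp G u a + sharp G v a.
  by apply/funext => a; rewrite /sharp -big_split; apply: eq_bigr => k _; rewrite mulrDr.
have sZ c u : sharp G (fun mu => c * u mu) = fun a => c * sharp G u a.
  by apply/funext => a; rewrite /sharp mulr_sumr; apply: eq_bigr => k _; ring.
have lE : rowmul (sharp G (lc E)) (toC E)^T = fun j => (eta R j 0)%:C%C + (eta R j 3)%:C%C.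
  apply/funext => j; rewrite /rowmul -!EG -big_split; apply: eq_bigr => k _ /=.
  have -> : lc E = fun al => (E 0 al)%:C%C + (E 3 al)%:C%C.
    by apply/funext => al; rewrite /lc rmorphD.
  by rewrite sD !mxE; ring.
have mE : rowmul (sharp G (mc E)) (toC E)^T =
    fun j => (eta R j 1)%:C%C + Ci * (eta R j 2)%:C%C.
  apply/funext => j; rewrite /rowmul -!EG mulr_sumr -big_split; apply: eq_bigr => k _ /=.
  have -> : mc E = fun al => (E 1 al)%:C%C + Ci * (E 2 al)%:C%C.
    by apply/funext => al; rewrite /mc complex_pairE.
  by rewrite sD sZ !mxE; ring.
have dE a : rowmul (dlt C a) (toC E)^T = fun j => (E j a)%:C%C.
  apply/funext => j; rewrite /rowmul (bigD1 a) //= big1 => [|k ka].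
    by rewrite /dlt eqxx !mxE mul1r addr0.
  by rewrite /dlt eq_sym (negbTE ka) mul0r.
have -> : (\det E)%:C%C = \det (toC E)^T by rewrite det_tr det_map_mx.
rewrite mulrC -det_rows_mulmx lE mE !dE /det_rows !etaE !ordE /wedge11 /lc /mc !complex_pairE.
have i2 := iC_sqr.
by apply/eqP; rewrite -subr_eq0; apply/eqP; ring: i2.
Qed.

End PauliAlgebra.

(** * Hermitian matrices of a coframe and the unimodular action on them *)

Section PauliFrame.
Variable R : realType.
Implicit Types (G T E L : 'M[R]_4).
Local Notation C := R[i].
Local Notation toC := (map_mx (real_complex R)).
Local Notation conjmx := (map_mx (@conjc R)).
Local Notation Ci := (iC R).

Definition mx2 (K : Type) (a b c d : K) : 'M[K]_2 :=
  \matrix_(i, j) if i == 0 then (if j == 0 then a else b) else (if j == 0 then c else d).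

Lemma mx2E (K : Type) (a b c d : K) :
  ((mx2 a b c d 0 0 = a) * (mx2 a b c d 0 1 = b) *
   (mx2 a b c d 1 0 = c) * (mx2 a b c d 1 1 = d))%type.
Proof. by rewrite !mxE. Qed.

Lemma mx2P (K : Type) (A B : 'M[K]_2) : A 0 0 = B 0 0 -> A 0 1 = B 0 1 ->
  A 1 0 = B 1 0 -> A 1 1 = B 1 1 -> A = B.
Proof.
by move=> *; apply/matrixP => i j; elim/ord2_ind: i; elim/ord2_ind: j.
Qed.

Lemma mul2E (K : pzSemiRingType) m n (A : 'M[K]_(m, 2)) (B : 'M[K]_(2, n)) i j :
  (A *m B) i j = A i 0 * B 0 j + A i 1 * B 1 j.
Proof. by rewrite mxE sum2. Qed.

Lemma det2 (K : comNzRingType) (A : 'M[K]_2) : \det A = A 0 0 * A 1 1 - A 0 1 * A 1 0.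
Proof.
rewrite (expand_det_row _ 0) sum2 /cofactor !det_mx11 !mxE.
have l0 : lift 0 0 = 1 :> 'I_2 by apply: val_inj.
have l1 : lift 1 0 = 0 :> 'I_2 by apply: val_inj.
by rewrite !l0 !l1 /= expr0 expr1; ring.
Qed.

(* Spinor indices start at 0: [sigma_00 = l] and [sigma_01 = m] for the given frame. *)
Definition pauli_mx T (al : 'I_4) : 'M[C]_2 :=
  mx2 (lc T al) (mc T al) (conjc (mc T al)) (T 0 al - T 3 al)%:C%C.

(** Inverse to [pauli_mx] on Hermitian matrices; the real parts make it real-valued on all
    matrices. *)
Definition frame_of (tau : 'I_4 -> 'M[C]_2) : 'M[R]_4 :=
  \matrix_(j, al)
    if j == 0 then (complex.Re (tau al 0 0) + complex.Re (tau al 1 1)) / 2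
    else if j == 1 then complex.Re (tau al 0 1)
    else if j == 2 then complex.Im (tau al 0 1)
    else (complex.Re (tau al 0 0) - complex.Re (tau al 1 1)) / 2.

Lemma frame_ofE (tau : 'I_4 -> 'M[C]_2) al :
  ((frame_of tau 0 al = (complex.Re (tau al 0 0) + complex.Re (tau al 1 1)) / 2) *
   (frame_of tau 1 al = complex.Re (tau al 0 1)) *
   (frame_of tau 2 al = complex.Im (tau al 0 1)) *
   (frame_of tau 3 al = (complex.Re (tau al 0 0) - complex.Re (tau al 1 1)) / 2))%type.
Proof. by rewrite !mxE. Qed.

Lemma hermitian_diag (z : C) : z = conjc z -> z = (complex.Re z)%:C%C.
Proof.
case: z => a b /eqP; rewrite eq_complex /= => /andP[_ /eqP b0].
have -> : b = 0 by lra.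
by [].
Qed.

Lemma pauli_frame_of (tau : 'I_4 -> 'M[C]_2) al : (forall a b, tau al a b = conjc (tau al b a)) ->
  pauli_mx (frame_of tau) al = tau al.
Proof.
move=> H; apply: mx2P; rewrite mx2E /lc /mc ?frame_ofE.
- by rewrite [RHS]hermitian_diag //; congr (_%:C%C); field.
- by case: (tau al 0 1).
- by rewrite [RHS]H; case: (tau al 0 1).
- by rewrite [RHS]hermitian_diag //; congr (_%:C%C); field.
Qed.

Lemma frame_of_pauli T : frame_of (pauli_mx T) = T.
Proof.
apply/matrixP => j al; elim/ord4_ind: j; rewrite frame_ofE ?mx2E /lc /mc //=; lra.
Qed.

Lemma conjcD (z z' : C) : conjc (z + z') = conjc z + conjc z'.
Proof. exact: rmorphD. Qed.

Lemma conjcMr (z : C) (r : R) : conjc (z * r%:C%C) = conjc z * r%:C%C.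
Proof. by rewrite [LHS]rmorphM; congr (_ * _); apply: conjc_real. Qed.

Lemma mcE T al : mc T al = (T 1 al)%:C%C + Ci * (T 2 al)%:C%C.
Proof. by rewrite /mc complex_pairE. Qed.

Lemma mcJ T al : conjc (mc T al) = (T 1 al)%:C%C - Ci * (T 2 al)%:C%C.
Proof. by rewrite mcE conjcD conjcMr conjc_iC mulNr; congr (_ - _); apply: conjc_real. Qed.

Lemma pauli_mul L E al :
  pauli_mx (L *m E) al = \sum_k (E k al)%:C%C *: pauli_mx L k.
Proof.
rewrite sum4; apply: mx2P; rewrite !mxE !ordE ?lc_mul ?mc_mul ?sum4;
  first [ring | by rewrite !conjcD !conjcMr; ring].
Qed.

Lemma pauli_conj_mul L E T (A : 'M[C]_2) :
  (forall k, pauli_mx L k = A^T *m pauli_mx T k *m conjmx A) ->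
  forall al, pauli_mx (L *m E) al = A^T *m pauli_mx (T *m E) al *m conjmx A.
Proof.
move=> H al; rewrite !pauli_mul mulmx_sumr mulmx_suml; apply: eq_bigr => k _.
by rewrite H -scalemxAr -scalemxAl.
Qed.

(** The polarised determinant: [mink t t] is twice [\det t]. The determinant of a Pauli matrix is a
    Minkowski square, so unimodular conjugation acts by isometries. *)
Definition mink (t t' : 'M[C]_2) : C :=
  t 0 0 * t' 1 1 + t 1 1 * t' 0 0 - t 0 1 * t' 1 0 - t 1 0 * t' 0 1.

Lemma mink_pauli T al be :
  mink (pauli_mx T al) (pauli_mx T be) = 2 * ((T^T *m eta R *m T) al be)%:C%C.
Proof.
rewrite /mink !mx2E gram_mxE !mcJ !mcE /lc.
have i2 := @iC_sqr R.
by ring: i2.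
Qed.

Lemma mink_conj (A t t' : 'M[C]_2) : \det A = 1 ->
  mink (A^T *m t *m conjmx A) (A^T *m t' *m conjmx A) = mink t t'.
Proof.
rewrite det2 => dA.
have dA' : conjc (A 0 0) * conjc (A 1 1) - conjc (A 0 1) * conjc (A 1 0) = 1.
  by rewrite -!rmorphM -rmorphB dA rmorph1.
rewrite /mink !mul2E !mxE.
transitivity ((A 0 0 * A 1 1 - A 0 1 * A 1 0) *
   (conjc (A 0 0) * conjc (A 1 1) - conjc (A 0 1) * conjc (A 1 0)) * mink t t').
  by rewrite /mink; ring.
by rewrite dA dA' !mul1r.
Qed.

Lemma gram_conj E T (A : 'M[C]_2) : \det A = 1 ->
  (forall al, pauli_mx T al = A^T *m pauli_mx E al *m conjmx A) ->
  T^T *m eta R *m T = E^T *m eta R *m E.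
Proof.
move=> dA H; apply/matrixP => al be.
have := mink_pauli T al be; rewrite !H mink_conj // mink_pauli.
have two : 2 != 0 :> C by rewrite pnatr_eq0.
by move=> /(mulfI two)/eqP; rewrite eq_complex => /andP[/eqP /= -> _].
Qed.

(** [L 0 0] is half the sum of the squared moduli of the entries of [A]. The four squares add up to
    that sum minus twice the real part of [\det A], so [L 0 0] is at least 1. *)
Lemma conj_lorentz00 (A : 'M[C]_2) L : \det A = 1 ->
  (forall k, pauli_mx L k = A^T *m pauli_mx 1%:M k *m conjmx A) -> 0 < L 0 0.
Proof.
rewrite det2 => dA H; rewrite -(frame_of_pauli L) frame_ofE !H !mul2E !mxE /lc /mc.
rewrite !mxE !ordE /=.
move: dA; case: (A 0 0) (A 0 1) (A 1 0) (A 1 1) => [a a'] [b b'] [c c'] [d d'] /eqP.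
rewrite eq_complex /= => /andP[/eqP e _].
have := sqr_ge0 (a - d); have := sqr_ge0 (a' + d').
have := sqr_ge0 (b + c); have := sqr_ge0 (b' - c').
rewrite !expr2 => *; nra.
Qed.

(** The contraction of the second order Pauli matrices with [xi] twice ([sigma2_sum]): summing the
    dotted indices against epsilon leaves the wedge of the two components of [xi^a sigma_{ab}]. *)
Definition eps_wedge (sg : 'I_4 -> 'M[C]_2) (xi : 'rV[C]_2) : form2 C :=
  wedge11 (fun al => (xi *m sg al) 0 0) (fun al => (xi *m sg al) 0 1).

Lemma sigma2_sum (sigma : 'rV[R]_4 -> 'I_4 -> 'M[C]_2) x (xi : 'rV[C]_2) al be :
  \sum_(a < 2) \sum_(b < 2) sigma2 sigma x a b al be * xi 0 a * xi 0 b =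
  eps_wedge (sigma x) xi al be.
Proof.
by rewrite /eps_wedge /wedge11 !sum2 !mul2E /sigma2 !sum2 /eps !mxE !ordE /=; field.
Qed.

(** The conjugate factor on the right contributes only [conj (\det A)], which is 1; what remains
    involves the first column of [A] alone. *)
Lemma eps_wedge_conj E T (A : 'M[C]_2) al be : \det A = 1 ->
  (forall al, pauli_mx T al = A^T *m pauli_mx E al *m conjmx A) ->
  wedge11 (lc T) (mc T) al be = eps_wedge (pauli_mx E) (row 0 A^T) al be.
Proof.
rewrite det2 => dA H.
have dA' : conjc (A 0 0) * conjc (A 1 1) - conjc (A 0 1) * conjc (A 1 0) = 1.
  by rewrite -!rmorphM -rmorphB dA rmorph1.
have l al' : lc T al' = (A^T *m pauli_mx E al' *m conjmx A) 0 0 by rewrite -H mx2E.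
have m al' : mc T al' = (A^T *m pauli_mx E al' *m conjmx A) 0 1 by rewrite -H mx2E.
rewrite /eps_wedge /wedge11 !l !m !mul2E !mxE -[RHS]mulr1 -dA'.
ring.
Qed.

Lemma eps_wedge_mul L E xi al be : 
  eps_wedge (pauli_mx (L *m E)) xi al be =
  \sum_j \sum_k (E j al)%:C%C * (E k be)%:C%C * eps_wedge (pauli_mx L) xi j k.
Proof.
have e a c : (xi *m pauli_mx (L *m E) a) 0 c = \sum_j (E j a)%:C%C * (xi *m pauli_mx L j) 0 c.
  by rewrite pauli_mul mulmx_sumr summxE; apply: eq_bigr => k _; rewrite -scalemxAr mxE.
rewrite /eps_wedge /wedge11 !e !big_distrlr /= [X in _ - X]exchange_big /= -sumrB.
apply: eq_bigr => j _; rewrite -sumrB; apply: eq_bigr => k _; ring.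
Qed.

End PauliFrame.

(** * Null rotations and square roots of null bivectors *)

Section SpinorAlgebra.
Variable R : realType.
Implicit Types (G T E L : 'M[R]_4).
Local Notation C := R[i].
Local Notation toC := (map_mx (real_complex R)).
Local Notation conjmx := (map_mx (@conjc R)).
Local Notation Ci := (iC R).
Local Notation lmw T := (wedge11 (lc T) (mc T)).

Lemma lm_mul L E al be : lmw (L *m E) al be =
  \sum_j \sum_k (E j al)%:C%C * (E k be)%:C%C * lmw L j k.
Proof.
rewrite /wedge11 !lc_mul !mc_mul !big_distrlr /= [X in _ - X]exchange_big /= -sumrB.
apply: eq_bigr => j _; rewrite -sumrB; apply: eq_bigr => k _; ring.
Qed.

Lemma lmw_re T a b : complex.Re (lmw T a b) =
  (T 0 a + T 3 a) * T 1 b - (T 0 b + T 3 b) * T 1 a.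
Proof. by rewrite /wedge11 /lc /mc /=; ring. Qed.

Lemma lmw_im T a b : complex.Im (lmw T a b) =
  (T 0 a + T 3 a) * T 2 b - (T 0 b + T 3 b) * T 2 a.
Proof. by rewrite /wedge11 /lc /mc /=; ring. Qed.

(** The form [l /\ m] determines the line of [l], so the new [l] is a multiple of the standard one.
    The multiple is positive, and the norm of row 1 makes it 1. Orthonormality then expresses rows 0
    and 3 by [p] and [q]. *)
Lemma null_rotation_entries L : L^T *m eta R *m L = eta R -> 0 < L 0 0 ->
  (forall a b, lmw L a b = lmw 1%:M a b) ->
  let p := L 1 0 in let q := L 2 0 in let s := (p * p + q * q) / 2 in
  [/\ [/\ L 0 0 = 1 + s, L 0 1 = p, L 0 2 = q & L 0 3 = s],
      [/\ L 1 1 = 1, L 1 2 = 0 & L 1 3 = p],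
      [/\ L 2 1 = 0, L 2 2 = 1 & L 2 3 = q]
    & [/\ L 3 0 = - s, L 3 1 = - p, L 3 2 = - q & L 3 3 = 1 - s]].
Proof.
move=> HL L00 HW p q s.
have re a b := congr1 (@complex.Re R) (HW a b).
have im a b := congr1 (@complex.Im R) (HW a b).
have r a b := lorentz_row0 a b HL.
have c00 := gram_mxE L 0 0; rewrite HL in c00.
have r01 := re 0 1; have r02 := re 0 2; have r03 := re 0 3.
have r12 := re 1 2; have r13 := re 1 3; have r23 := re 2 3.
have i01 := im 0 1; have i02 := im 0 2; have i03 := im 0 3.
have i12 := im 1 2; have i13 := im 1 3; have i23 := im 2 3.
have n00 := r 0 0; have n11 := r 1 1; have n33 := r 3 3; have n01 := r 0 1.
have n02 := r 0 2; have n03 := r 0 3; have n13 := r 1 3; have n23 := r 2 3.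
clear r re im HW HL.
rewrite !lmw_re !mxE !ordE /= in r01 r02 r03 r12 r13 r23.
rewrite !lmw_im !mxE !ordE /= in i01 i02 i03 i12 i13 i23.
rewrite !etaE !ordE in n00 n11 n33 n01 n02 n03 n13 n23 c00.
rewrite {}/s {}/p {}/q.
move: (L 0 0) (L 0 1) (L 0 2) (L 0 3) (L 1 0) (L 1 1) (L 1 2) (L 1 3)
  (L 2 0) (L 2 1) (L 2 2) (L 2 3) (L 3 0) (L 3 1) (L 3 2) (L 3 3)
  L00 c00 r01 r02 r03 r12 r13 r23 i01 i02 i03 i12 i13 i23
  n00 n11 n33 n01 n02 n03 n13 n23.
move=> a0 a1 a2 a3 p0 p1 p2 p3 q0 q1 q2 q3 d0 d1 d2 d3.
move=> L00 c00 r01 r02 r03 r12 r13 r23 i01 i02 i03 i12 i13 i23.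
move=> n00 n11 n33 n01 n02 n03 n13 n23.
(* Components of [l /\ l /\ Re m = 0] and [l /\ l /\ Im m = 0] for the rows of [L], with the known
   values of [l /\ m] substituted. *)
have l2 : a2 + d2 = 0.
  have : (a2 + d2) * ((a0 + d0) * p1 - (a1 + d1) * p0)
    - (a1 + d1) * ((a0 + d0) * p2 - (a2 + d2) * p0)
    + (a0 + d0) * ((a1 + d1) * p2 - (a2 + d2) * p1) = 0 by ring.
  by rewrite r01 r02 r12; lra.
have l1 : a1 + d1 = 0.
  have : (a2 + d2) * ((a0 + d0) * q1 - (a1 + d1) * q0)
    - (a1 + d1) * ((a0 + d0) * q2 - (a2 + d2) * q0)
    + (a0 + d0) * ((a1 + d1) * q2 - (a2 + d2) * q1) = 0 by ring.
  by rewrite i01 i02 i12; lra.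
have l3 : a3 + d3 = a0 + d0.
  have : (a3 + d3) * ((a0 + d0) * p1 - (a1 + d1) * p0)
    - (a1 + d1) * ((a0 + d0) * p3 - (a3 + d3) * p0)
    + (a0 + d0) * ((a1 + d1) * p3 - (a3 + d3) * p1) = 0 by ring.
  by rewrite r01 r03 r13; lra.
(* Column 0 gives [a0^2 - d0^2 = 1 + p0^2 + q0^2], so [|d0| < a0]. *)
have rho0 : 0 < a0 + d0.
  rewrite ltNge; apply/negP => h.
  have := sqr_ge0 p0; have := sqr_ge0 q0; rewrite !expr2 => *; nra.
rewrite l1 l2 l3 !mul0r !subr0 in r01 r02 r03 i01 i02 i03.
have nz : a0 + d0 != 0 by rewrite gt_eqF.
have p2e : p2 = 0 by apply: (mulfI nz); lra.
have q1e : q1 = 0 by apply: (mulfI nz); lra.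
have p3e : p3 = p0 by apply: (mulfI nz); lra.
have q3e : q3 = q0 by apply: (mulfI nz); lra.
rewrite p2e p3e in n11 n01 n13.
have p11 : p1 = 1.
  have p1p : 0 < p1 by rewrite -(pmulr_rgt0 _ rho0); lra.
  have : (p1 - 1) * (p1 + 1) = 0 by lra.
  by move/eqP; rewrite mulf_eq0 => /orP[/eqP|/eqP] ?; lra.
have rho1 : a0 + d0 = 1 by rewrite p11 in r01; lra.
have q21 : q2 = 1 by rewrite rho1 in i02; lra.
rewrite p11 q1e q21 q3e in n01 n13 n02 n23.
have ea3 : a3 = 1 - d3 by lra.
have ed0 : d0 = 1 - a0 by lra.
have ed1 : d1 = - a1 by lra.
have ed2 : d2 = - a2 by lra.
rewrite ea3 ed0 ed1 ed2 in n00 n33 n01 n03 n13 n02 n23 *.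
have e03 : a0 + d3 = 2 by nra.
have ed3 : d3 = 2 - a0 by lra.
rewrite ed3 in n00 n33 n01 n03 n13 n02 n23 *.
have ea1 : a1 = p0 by nra.
have ea2 : a2 = q0 by nra.
rewrite ea1 ea2 in n00 *.
by split; split=> //; nra.
Qed.

(** The parameter sits in column 0 of [L]: the time component of the new [m] is [p + iq], and its
    conjugate is the multiple of the first spinor that is added to the second. *)
Lemma null_rotation L : L^T *m eta R *m L = eta R -> 0 < L 0 0 ->
  (forall a b, lmw L a b = lmw 1%:M a b) ->
  let N := mx2 1 ((L 1 0)%:C%C - Ci * (L 2 0)%:C%C) 0 1 in
  forall k, pauli_mx L k = N^T *m pauli_mx 1%:M k *m conjmx N.
Proof.
move=> HL L00 HW N.
have [] := null_rotation_entries HL L00 HW; rewrite /N => {N}.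
move=> [e00 e01 e02 e03] [e11 e12 e13] [e21 e22 e23] [e30 e31 e32 e33].
have i2 := iC_sqr R.
have cN (a b : R) : conjc (a%:C%C - Ci * b%:C%C) = a%:C%C + Ci * b%:C%C.
  by rewrite /iC; apply/eqP; rewrite eq_complex /=; apply/andP; split; apply/eqP; ring.
move=> k; rewrite /pauli_mx; elim/ord4_ind: k; apply: mx2P;
  rewrite !mul2E ![(_^T) _ _]mxE ![map_mx _ _ _ _]mxE !mx2E ?mcJ ?mcE /lc;
  rewrite ?rmorph0 ?rmorph1 ?cN ?e00 ?e01 ?e02 ?e03 ?e11 ?e12 ?e13 ?e21 ?e22 ?e23
    ?e30 ?e31 ?e32 ?e33 !mxE !ordE /=; by field: i2.
Qed.

(** This is [hodge_lm] for the metric [eta], where the positive determinant selects the eigenvalue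
    [-i]. The components [01], [02], [03] thus determine the form. *)
Lemma gram_selfdual L : L^T *m eta R *m L = eta R -> 0 < \det L ->
  [/\ lmw L 2 3 = - Ci * lmw L 0 1, lmw L 3 1 = - Ci * lmw L 0 2
    & lmw L 1 2 = - Ci * lmw L 0 3].
Proof.
move=> HL dL.
have uL : L \in unitmx by rewrite unitmxE unitfE gt_eqF.
have nz : (\det L)%:C%C != 0 :> C by rewrite eq_complex /= gt_eqF.
have s1 : Num.sqrt `|\det (eta R)| = 1.
  by rewrite (@sqrt_det_gram R (eta R) 1%:M) ?det1 ?normr1 // trmx1 mul1mx mulmx1.
have sh u : sharp (eta R) u = fun a => (if a == 0 then 1 else -1) * u a.
  apply/funext => a; rewrite /sharp (mulmx1_invmx (eta2 R)) sum4 !etaE.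
  by elim/ord4_ind: a; rewrite !ordE; ring.
have H ga de : det_rows (fun a => (if a == 0 then 1 else -1) * lc L a)
    (fun a => (if a == 0 then 1 else -1) * mc L a) (dlt C ga) (dlt C de) =
    - Ci * lmw L ga de.
  have := hodge_lm ga de uL (esym HL).
  by rewrite hodge_wedge s1 !sh gtr0_norm // mul1r => /(mulfI nz).
have H23 := H 2 3; have H31 := H 3 1; have H12 := H 1 2; clear H.
move: H23 H31 H12; rewrite /det_rows /dlt !ordE /wedge11 /=.
move: (lc L) (mc L) => l m H23 H31 H12; have i2 := iC_sqr R.
have X (x y : C) : - x = - Ci * y -> y = - Ci * x.
  move=> e; have -> : x = Ci * y by rewrite -[x]opprK e; ring.
  by rewrite mulrA mulNr i2 opprK mul1r.
by split; apply: X; rewrite -?H23 -?H31 -?H12; ring.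
Qed.

(** The sum of squares is a combination of the inner products of [l] and [m] with themselves and
    each other, and these all vanish. *)
Lemma lmw_null L : L^T *m eta R *m L = eta R ->
  lmw L 0 1 ^+ 2 + lmw L 0 2 ^+ 2 + lmw L 0 3 ^+ 2 = 0.
Proof.
move=> HL.
have r i j := lorentz_row0 i j HL.
have i2 := iC_sqr R.
pose q i j := L i 0 * L j 0 - L i 1 * L j 1 - L i 2 * L j 2 - L i 3 * L j 3.
have rq i j : q i j = eta R i j := r i j.
have ll : lc L 1 * lc L 1 + lc L 2 * lc L 2 + lc L 3 * lc L 3 - lc L 0 * lc L 0 = 0.
  transitivity (- (q 0 0 + q 3 3 + 2 * q 0 3))%:C%C; first by rewrite /q /lc; ring.
  by rewrite !rq !etaE !ordE; ring.
have lm : lc L 1 * mc L 1 + lc L 2 * mc L 2 + lc L 3 * mc L 3 - lc L 0 * mc L 0 = 0.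
  transitivity (- (q 0 1 + q 3 1)%:C%C - Ci * (q 0 2 + q 3 2)%:C%C).
    by rewrite /q /lc !mcE; ring.
  by rewrite !rq !etaE !ordE; ring.
have mm : mc L 1 * mc L 1 + mc L 2 * mc L 2 + mc L 3 * mc L 3 - mc L 0 * mc L 0 = 0.
  transitivity (- (q 1 1 - q 2 2)%:C%C - 2 * Ci * (q 1 2)%:C%C).
    by rewrite /q !mcE; ring: i2.
  by rewrite !rq !etaE !ordE; ring.
rewrite /wedge11.
have -> : (lc L 0 * mc L 1 - lc L 1 * mc L 0) ^+ 2 + (lc L 0 * mc L 2 - lc L 2 * mc L 0) ^+ 2
   + (lc L 0 * mc L 3 - lc L 3 * mc L 0) ^+ 2 =
   lc L 0 * lc L 0 * (mc L 1 * mc L 1 + mc L 2 * mc L 2 + mc L 3 * mc L 3 - mc L 0 * mc L 0)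
   - 2 * lc L 0 * mc L 0 * (lc L 1 * mc L 1 + lc L 2 * mc L 2 + lc L 3 * mc L 3 - lc L 0 * mc L 0)
   + mc L 0 * mc L 0 * (lc L 1 * lc L 1 + lc L 2 * lc L 2 + lc L 3 * lc L 3 - lc L 0 * lc L 0).
  by ring.
by rewrite ll lm mm; ring.
Qed.

Lemma wedge11_ext (K : comNzRingType) (u v u' v' : form1 K) :
  wedge11 u v 0 1 = wedge11 u' v' 0 1 -> wedge11 u v 0 2 = wedge11 u' v' 0 2 ->
  wedge11 u v 0 3 = wedge11 u' v' 0 3 -> wedge11 u v 2 3 = wedge11 u' v' 2 3 ->
  wedge11 u v 3 1 = wedge11 u' v' 3 1 -> wedge11 u v 1 2 = wedge11 u' v' 1 2 ->
  forall a b, wedge11 u v a b = wedge11 u' v' a b.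
Proof.
move=> e01 e02 e03 e23 e31 e12.
have as_ (w z : form1 K) a b : wedge11 w z a b = - wedge11 w z b a by rewrite /wedge11; ring.
have d_ (w z : form1 K) a : wedge11 w z a a = 0 by rewrite /wedge11; ring.
by elim/ord4_ind; elim/ord4_ind; rewrite ?d_ //; rewrite as_ [RHS]as_; congr (- _).
Qed.

(** Cartan's parametrisation of isotropic vectors of complex three-space by spinors. *)
Lemma eps_wedge1 (xi : 'rV[C]_2) : let a := xi 0 0 in let b := xi 0 1 in
  let w := eps_wedge (pauli_mx 1%:M) xi in
  [/\ w 0 1 = a * a - b * b, w 0 2 = Ci * (a * a + b * b) & w 0 3 = - 2 * (a * b)] /\
  [/\ w 2 3 = - Ci * (a * a - b * b), w 3 1 = a * a + b * b & w 1 2 = 2 * Ci * (a * b)].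
Proof.
have i2 := iC_sqr R.
by move=> a b w; split; split; rewrite /w /eps_wedge /wedge11 !mul2E !mx2E !mcJ !mcE /lc
  !mxE !ordE /= -/a -/b; ring: i2.
Qed.

(** [spin00], [spin01], [spin11] solve the formulas of [eps_wedge1] for [a^2], [ab], [b^2]. *)
Definition spin00 L : C := (lmw L 0 1 - Ci * lmw L 0 2) / 2.
Definition spin01 L : C := - lmw L 0 3 / 2.
Definition spin11 L : C := (- lmw L 0 1 - Ci * lmw L 0 2) / 2.

Lemma spin_det L : L^T *m eta R *m L = eta R -> spin00 L * spin11 L = spin01 L * spin01 L.
Proof.
move=> /lmw_null; rewrite /spin00 /spin01 /spin11.
move: (lmw L 0 1) (lmw L 0 2) (lmw L 0 3) => a b c e; have i2 := iC_sqr R.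
have cc : c * c = - (a * a + b * b) by rewrite -[RHS]addr0 -e; ring.
have -> : - c / 2 * (- c / 2) = c * c / 4 by field.
by rewrite cc; field: i2.
Qed.

Lemma lm_spin L (xi : 'rV[C]_2) : L^T *m eta R *m L = eta R -> 0 < \det L ->
  xi 0 0 * xi 0 0 = spin00 L -> xi 0 0 * xi 0 1 = spin01 L -> xi 0 1 * xi 0 1 = spin11 L ->
  forall a b, lmw L a b = eps_wedge (pauli_mx 1%:M) xi a b.
Proof.
move=> HL dL e00 e01 e11.
have [s23 s31 s12] := gram_selfdual HL dL.
have two : 2 != 0 :> C by rewrite pnatr_eq0.
have i2 := iC_sqr R.
have w01 : lmw L 0 1 = xi 0 0 * xi 0 0 - xi 0 1 * xi 0 1.
  by rewrite e00 e11 /spin00 /spin11; field.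
have w02 : lmw L 0 2 = Ci * (xi 0 0 * xi 0 0 + xi 0 1 * xi 0 1).
  by rewrite e00 e11 /spin00 /spin11; field: i2.
have w03 : lmw L 0 3 = - 2 * (xi 0 0 * xi 0 1) by rewrite e01 /spin01; field.
have [[v01 v02 v03] [v23 v31 v12]] := eps_wedge1 xi.
rewrite w01 in s23; rewrite w02 in s31; rewrite w03 in s12.
apply: wedge11_ext; rewrite ?w01 ?w02 ?w03 ?s23 ?s31 ?s12;
  rewrite -/(eps_wedge (pauli_mx 1%:M) xi _ _) ?v01 ?v02 ?v03 ?v23 ?v31 ?v12 //;
  by ring: i2.
Qed.

(** A nonzero first component fixes the sign, and the mixed product forces the same sign on the
    second; if the first component is 0, the second fixes it. *)
Lemma spinor_pm (K : idomainType) (a b c d : K) : a * a = c * c -> a * b = c * d ->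
  b * b = d * d -> (exists s : bool, a = (-1) ^+ s * c /\ b = (-1) ^+ s * d).
Proof.
move=> ac abcd bd.
have H (x y : K) : x * x = y * y -> exists s : bool, x = (-1) ^+ s * y.
  move=> e; have : (x - y) * (x + y) = x * x - y * y by ring.
  rewrite e subrr.
  move/eqP; rewrite mulf_eq0 subr_eq0 addr_eq0 => /orP[]/eqP->.
    by exists false; rewrite expr0 mul1r.
  by exists true; rewrite expr1 mulN1r.
have [s es] := H _ _ ac; have [c0|c0] := eqVneq c 0.
  have [t et] := H _ _ bd; exists t; split=> //.
  by rewrite es c0 !mulr0.
exists s; split=> //; apply: (mulfI c0).
have ss : (-1) ^+ s * (-1) ^+ s = 1 :> K by rewrite -expr2 sqrr_sign.
have -> : c * b = (-1) ^+ s * (a * b).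
  by rewrite es !mulrA ss mul1r.
by rewrite abcd; ring.
Qed.

End SpinorAlgebra.

(** * The spin connection in a frame *)

Section FrameCalculus.
Variables (R : realType) (U : set 'rV[R]_4) (g T : 'rV[R]_4 -> 'M[R]_4).
Hypothesis oU : open U.
Hypothesis fT : frame U g T.

Lemma frame_gram x : U x -> g x = (T x)^T *m eta R *m T x.
Proof. by move=> Ux; have [_ /(_ x Ux)[H _]] := fT; apply/gramP. Qed.

Lemma frame_unit x : U x -> T x \in unitmx.
Proof.
by move=> Ux; have [_ /(_ x Ux)[_ d]] := fT; rewrite unitmxE unitfE gt_eqF.
Qed.

Lemma frame_metric_unit x : U x -> g x \in unitmx.
Proof.
move=> Ux; rewrite (frame_gram Ux) !unitmx_mul unitmx_tr frame_unit // andbT /=.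
by have [] := mulmx1_unit (eta2 R).
Qed.

Lemma frame_metric_smooth al be : smooth U (fun x => g x al be).
Proof.
have [ST HT] := fT.
apply: (smooth_ext oU (f := fun x => \sum_(j < 4) \sum_(k < 4) eta R j k * T x j al * T x k be)).
  by move=> x Ux; have [-> _] := HT x Ux.
apply: smooth_sum => // j _; apply: smooth_sum => // k _.
by apply: smoothM => //; apply: smoothM => //; apply: smooth_cst.
Qed.

(* Row [i] is the vector dual to [theta^i] multiplied by [eta_ii]. *)
Definition dual_frame x : 'M[R]_4 := T x *m invmx (g x).
Local Notation F := dual_frame.

Lemma dual_frame_smooth i j : smooth U (fun x => F x i j).
Proof.
have [ST HT] := fT.
apply: smooth_mulmx => //; apply: smooth_invmx => //; first exact: frame_metric_unit.
exact: frame_metric_smooth.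
Qed.

Lemma frame_metric_sym x : U x -> (g x)^T = g x.
Proof.
by move=> Ux; rewrite (frame_gram Ux) !trmx_mul trmxK tr_eta mulmxA.
Qed.

Lemma dual_frameP x : U x -> T x *m (F x)^T = eta R.
Proof.
move=> Ux; rewrite /F trmx_mul trmx_inv frame_metric_sym // mulmxA.
rewrite (gram_invmx (frame_unit Ux) (frame_gram Ux)).
have uT := frame_unit Ux.
have -> : T x *m (invmx (T x) *m eta R *m (invmx (T x))^T) *m (T x)^T =
   (T x *m invmx (T x)) *m eta R *m (T x *m invmx (T x))^T by rewrite trmx_mul !mulmxA.
by rewrite mulmxV // trmx1 mul1mx mulmx1.
Qed.

Lemma dual_frame_inv x : U x -> (T x)^T *m eta R *m F x = 1%:M.
Proof.
by move=> Ux; rewrite /F mulmxA -(frame_gram Ux) mulmxV // frame_metric_unit.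
Qed.

Lemma dual_frame_sum x k j : U x -> \sum_be T x k be * F x j be = eta R k j.
Proof.
move=> Ux; rewrite -(dual_frameP Ux) mxE; apply: eq_bigr => b _.
by rewrite [in RHS]mxE.
Qed.

(** Frame components of the derivatives of [theta^k]: [i] is the direction of differentiation, [j]
    the component. *)
Definition dframe x (k i j : 'I_4) : R :=
  \sum_mu \sum_be F x i mu * F x j be * pd mu (fun y => T y k be) x.

Definition contract3 x i j k (X : 'I_4 -> 'I_4 -> 'I_4 -> R) : R :=
  \sum_mu \sum_be \sum_de F x i mu * F x j be * F x k de * X mu be de.

Lemma contract3_swap12 x i j k X :
  contract3 x i j k (fun m b d => X b m d) = contract3 x j i k X.
Proof.
rewrite /contract3 exchange_big; apply: eq_bigr => m _; apply: eq_bigr => b _.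
by apply: eq_bigr => d _; ring.
Qed.

Lemma contract3_swap23 x i j k X :
  contract3 x i j k (fun m b d => X m d b) = contract3 x i k j X.
Proof.
rewrite /contract3; apply: eq_bigr => m _; rewrite exchange_big.
by apply: eq_bigr => b _; apply: eq_bigr => d _; ring.
Qed.

(** The product rule on [g], written as the sum of [eta_pp T^p T^p]: the factor left
    undifferentiated pairs with the dual frame to an entry of [eta]. *)
Lemma contract3_pd_metric x i j k : U x ->
  contract3 x i j k (fun m b d => pd m (fun y => g y b d) x) =
  dframe x k i j + dframe x j i k.
Proof.
move=> Ux; have [ST HT] := fT.
have dg m b d : pd m (fun y => g y b d) x = \sum_p
   (eta R p p * (pd m (fun y => T y p b) x * T x p d + T x p b * pd m (fun y => T y p d) x)).
  transitivity (pd m (fun y => \sum_p eta R p p * (T y p b * T y p d)) x).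
    apply: pd_ext Ux _ => // y Uy; rewrite (frame_gram Uy) gram_mxE sum4 !etaE !ordE; ring.
  rewrite (pd_sum oU) // => [|p]; last first.
    by apply: smoothM => //; [apply: smooth_cst|apply: smoothM].
  apply: eq_bigr => p _; rewrite (@pdM _ U) //; [|exact: smooth_cst|exact: smoothM].
  by rewrite pd_cst (@pdM _ U) // mul0r add0r.
have fs p a : \sum_d F x a d * T x p d = eta R p a.
  by rewrite -(dual_frame_sum p a Ux); apply: eq_bigr => d _; rewrite mulrC.
transitivity (\sum_m \sum_b \sum_p (F x i m * F x j b * (eta R p p * eta R p k)
    * pd m (fun y => T y p b) x)
  + \sum_m \sum_d \sum_p (F x i m * F x k d * (eta R p p * eta R p j)
    * pd m (fun y => T y p d) x)).
  rewrite -big_split; apply: eq_bigr => m _ /=.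
  rewrite [X in _ + X](_ : _ = \sum_d \sum_b \sum_p F x i m * F x k d *
     (eta R p p * (F x j b * T x p b)) * pd m (fun y => T y p d) x); last first.
    apply: eq_bigr => d _; rewrite exchange_big; apply: eq_bigr => p _.
    by rewrite -mulr_suml -!mulr_sumr fs.
  rewrite [X in _ + X]exchange_big -big_split; apply: eq_bigr => b _ /=.
  rewrite [X in _ = X + _](_ : _ = \sum_d \sum_p F x i m * F x j b *
     (eta R p p * (F x k d * T x p d)) * pd m (fun y => T y p b) x); last first.
    rewrite exchange_big; apply: eq_bigr => p _.
    by rewrite -mulr_suml -!mulr_sumr fs.
  rewrite -big_split; apply: eq_bigr => d _ /=.
  rewrite dg mulr_sumr -big_split; apply: eq_bigr => p _ /=; ring.
have ek p (f : 'I_4 -> R) : \sum_q (eta R q q * eta R q p) * f q = f p.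
  by rewrite sum4 !etaE; elim/ord4_ind: p; rewrite !ordE; ring.
congr (_ + _); apply: eq_bigr => m _; apply: eq_bigr => b _.
  rewrite -(ek k (fun p => F x i m * F x j b * pd m (fun y => T y p b) x)).
  by apply: eq_bigr => p _; ring.
rewrite -(ek j (fun p => F x i m * F x k b * pd m (fun y => T y p b) x)).
by apply: eq_bigr => p _; ring.
Qed.

(** The Koszul formula: each of the three derivatives of the metric contributes two frame terms. *)
Lemma contract_christoffel x i j k : U x ->
  \sum_mu \sum_be F x i mu * T x k be * (\sum_ga christoffel g be mu ga x * F x j ga) =
  2^-1 * (dframe x k i j + dframe x j i k + (dframe x k j i + dframe x i j k)
          - (dframe x j k i + dframe x i k j)).
Proof.
move=> Ux.
pose dg m b d := pd m (fun y => g y b d) x.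
transitivity (2^-1 * (contract3 x i j k dg + contract3 x i j k (fun m b d => dg b m d)
   - contract3 x i j k (fun m b d => dg d m b))); last first.
  rewrite (contract3_swap12 x i j k dg) (contract3_swap23 x i j k (fun m d b => dg d m b)).
  by rewrite (contract3_swap12 x i k j dg) !contract3_pd_metric.
have FT d : \sum_b T x k b * invmx (g x) b d = F x k d by rewrite mxE.
pose X m b d := dg m b d + dg b m d - dg d m b.
transitivity (2^-1 * contract3 x i j k X); last first.
  rewrite /contract3 -big_split -sumrB; congr (_ * _); apply: eq_bigr => m _ /=.
  rewrite -big_split -sumrB; apply: eq_bigr => b _ /=.
  by rewrite -big_split -sumrB; apply: eq_bigr => d _ /=; rewrite /X; ring.
rewrite /contract3 mulr_sumr; apply: eq_bigr => m _.
transitivity (\sum_c \sum_d \sum_b (T x k b * invmx (g x) b d) *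
    (2^-1 * F x i m * F x j c * X m c d)).
  rewrite [RHS](_ : _ = \sum_c \sum_b \sum_d (T x k b * invmx (g x) b d) *
    (2^-1 * F x i m * F x j c * X m c d)); last first.
    by apply: eq_bigr => c _; rewrite exchange_big.
  rewrite [RHS]exchange_big; apply: eq_bigr => b _ /=.
  rewrite mulr_sumr; apply: eq_bigr => c _.
  rewrite /christoffel mulrCA -!mulrA !mulr_suml !mulr_sumr; apply: eq_bigr => d _.
  by rewrite /X /dg; ring.
rewrite mulr_sumr; apply: eq_bigr => c _; rewrite mulr_sumr; apply: eq_bigr => d _.
by rewrite -mulr_suml FT; ring.
Qed.

(** Differentiating the constant pairing of [T] with [F] trades the derivative of [F] for the term
    [- dframe x k i j]; the bracket is the Christoffel part. *)
Lemma spin_connection x i k j : U x ->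
  \sum_mu \sum_be F x i mu * T x k be * (pd mu (fun y => F y j be) x +
     \sum_ga christoffel g be mu ga x * F x j ga) =
  - dframe x k i j + 2^-1 * (dframe x k i j + dframe x j i k
     + (dframe x k j i + dframe x i j k) - (dframe x j k i + dframe x i k j)).
Proof.
move=> Ux; rewrite -contract_christoffel // /dframe -sumrN -big_split.
apply: eq_bigr => m _ /=.
have [ST HT] := fT.
have e : \sum_be T x k be * pd m (fun y => F y j be) x =
   - \sum_be F x j be * pd m (fun y => T y k be) x.
  apply/eqP; rewrite -addr_eq0 -big_split /=; apply/eqP.
  transitivity (pd m (fun=> eta R k j) x); last exact: pd_cst.
  transitivity (pd m (fun y => \sum_be T y k be * F y j be) x); last first.
    by apply: pd_ext Ux _ => // y Uy; rewrite dual_frame_sum.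
  rewrite (pd_sum oU) // => [|b]; last by apply: smoothM => //; apply: dual_frame_smooth.
  apply: eq_bigr => b _; rewrite (@pdM _ U) //; last exact: dual_frame_smooth.
  by rewrite addrC mulrC.
rewrite [X in X + _](_ : _ =
    F x i m * (- \sum_be F x j be * pd m (fun y => T y k be) x)); last first.
  by rewrite mulrN mulr_sumr; congr (- _); apply: eq_bigr => b _; ring.
rewrite -e mulr_sumr -big_split; apply: eq_bigr => b _ /=; ring.
Qed.

End FrameCalculus.

(** * Four-forms in a coframe and the axial torsion *)

Section WedgeFour.
Variable K : comNzRingType.
Implicit Types u v w z : form1 K.

(** The rows [dlt K a], ..., [dlt K d] form the matrix that selects rows of [M], so multiplicativity
    of the determinant produces the antisymmetric symbol. *)
Lemma det_rows_select u v w z a b c d :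
  det_rows (fun r : 'I_4 => tnth [tuple u; v; w; z] r a) (fun r => tnth [tuple u; v; w; z] r b)
     (fun r => tnth [tuple u; v; w; z] r c) (fun r => tnth [tuple u; v; w; z] r d) =
  det_rows (dlt K a) (dlt K b) (dlt K c) (dlt K d) * det_rows u v w z.
Proof.
pose M : 'M[K]_4 := \matrix_(j, r) tnth [tuple u; v; w; z] r j.
have <- : \det M = det_rows u v w z by rewrite -det_tr det_det_rows /det_rows !mxE.
rewrite -det_rows_mulmx.
have e i : rowmul (dlt K i) M = fun r => tnth [tuple u; v; w; z] r i.
  apply/funext => r; rewrite /rowmul (bigD1 i) //= big1 => [|k ki].
    by rewrite /dlt eqxx mxE mul1r addr0.
  by rewrite /dlt eq_sym (negbTE ki) mul0r.
by rewrite !e.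
Qed.

Lemma wedge4E u v w z a b c d :
  wedge13 u (wedge12 v (wedge11 w z)) a b c d =
  det_rows (dlt K a) (dlt K b) (dlt K c) (dlt K d) * det_rows u v w z.
Proof.
by rewrite -det_rows_select /det_rows !(tnth_nth u) /= /wedge13 /wedge12 /wedge11; ring.
Qed.

Lemma wedge4_sum u v (q : 'I_4 -> 'I_4 -> K) (w : 'I_4 -> 'I_4 -> form2 K) a b c d :
  wedge13 u (wedge12 v (fun e f => \sum_i \sum_j q i j * w i j e f)) a b c d =
  \sum_i \sum_j q i j * wedge13 u (wedge12 v (w i j)) a b c d.
Proof.
rewrite /wedge13 /wedge12 !sum4; ring.
Qed.

End WedgeFour.

Section Axial.
Variables (R : realType) (U : set 'rV[R]_4) (g T : 'rV[R]_4 -> 'M[R]_4).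
Hypothesis oU : open U.
Hypothesis fT : frame U g T.
Local Notation C := R[i].

Definition ldlt : form1 R := fun k => dlt R 0 k + dlt R 3 k.

(** The coefficient of [l /\ theta^k /\ theta^i /\ theta^j] against the volume form; the factors
    [eta] compensate the signs built into [dual_frame]. *)
Definition axial_coef (k i j : 'I_4) : R :=
  eta R k k * eta R i i * eta R j j * det_rows ldlt (dlt R k) (dlt R i) (dlt R j).

Lemma pd_frame x k a b : U x -> pd a (fun y => T y k b) x =
  \sum_i \sum_j eta R i i * eta R j j * dframe g T x k i j * (T x i a * T x j b).
Proof.
move=> Ux.
have H a' m : \sum_i eta R i i * T x i a' * dual_frame g T x i m = (a' == m)%:R.
  have /matrixP/(_ a' m) := dual_frame_inv fT Ux; rewrite mxE [in RHS]mxE => <-.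
  by apply: eq_bigr => i _; rewrite mul_eta etaE eqxx [(_^T) _ _]mxE; ring.
transitivity (\sum_m \sum_n (\sum_i eta R i i * T x i a * dual_frame g T x i m) *
   (\sum_j eta R j j * T x j b * dual_frame g T x j n) * pd m (fun y => T y k n) x).
  rewrite (bigD1 a) //= [X in _ + X]big1 ?addr0 => [|m ma]; last first.
    by rewrite big1 // => n _; rewrite H eq_sym (negbTE ma) !mul0r.
  rewrite (bigD1 b) //= [X in _ + X]big1 ?addr0 => [|n nb]; last first.
    by rewrite (H b) eq_sym (negbTE nb) mulr0 mul0r.
  by rewrite !H !eqxx !mul1r.
rewrite /dframe.
transitivity (\sum_m \sum_n \sum_i \sum_j (eta R i i * T x i a * dual_frame g T x i m) *
   (eta R j j * T x j b * dual_frame g T x j n) * pd m (fun y => T y k n) x).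
  apply: eq_bigr => m _; apply: eq_bigr => n _.
  rewrite big_distrlr /= mulr_suml; apply: eq_bigr => i _; exact: mulr_suml.
rewrite [RHS](_ : _ = \sum_i \sum_j \sum_m \sum_n
   (eta R i i * T x i a * dual_frame g T x i m) *
   (eta R j j * T x j b * dual_frame g T x j n) * pd m (fun y => T y k n) x); last first.
  apply: eq_bigr => i _; apply: eq_bigr => j _.
  rewrite mulr_sumr mulr_suml; apply: eq_bigr => m _.
  by rewrite mulr_sumr mulr_suml; apply: eq_bigr => n _; ring.
under eq_bigr => m _ do rewrite exchange_big.
rewrite exchange_big; apply: eq_bigr => i _.
under eq_bigr => m _ do rewrite exchange_big.
by rewrite exchange_big.
Qed.

Lemma L_teleE x a b c d : U x -> L_tele T x a b c d =
  3^-1 * (levi_civita R a b c d * \det (T x)) *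
  \sum_k \sum_i \sum_j axial_coef k i j * dframe g T x k i j.
Proof.
move=> Ux.
have dE k : ext_d1 (fun y => T y k) x = fun e f =>
    \sum_i \sum_j (eta R i i * eta R j j * dframe g T x k i j) * wedge11 (T x i) (T x j) e f.
  apply/funext => e; apply/funext => f; rewrite /ext_d1 !pd_frame // -sumrB.
  apply: eq_bigr => i _; rewrite -sumrB; apply: eq_bigr => j _; rewrite /wedge11; ring.
have lE : cov_l T x = rowmul ldlt (T x).
  by apply/funext => al; rewrite /rowmul /cov_l sum4 /ldlt /dlt !ordE /=; ring.
have tE k : T x k = rowmul (dlt R k) (T x) :> form1 R.
  apply/funext => al; rewrite /rowmul (bigD1 k) //= big1 => [|j jk].
    by rewrite /dlt eqxx mul1r addr0.
  by rewrite /dlt eq_sym (negbTE jk) mul0r.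
have WE k i j : wedge13 (cov_l T x) (wedge12 (T x k) (wedge11 (T x i) (T x j))) a b c d =
   levi_civita R a b c d * \det (T x) * det_rows ldlt (dlt R k) (dlt R i) (dlt R j).
  by rewrite wedge4E lE (tE k) (tE i) (tE j) det_rows_mulmx levi_civitaE; rewrite -/(dlt R _); ring.
transitivity (3^-1 * \sum_k eta R k k *
   wedge13 (cov_l T x) (wedge12 (T x k) (ext_d1 (fun y => T y k) x)) a b c d).
  have ed (f : 'I_4 -> 'I_4 -> R) : \sum_j \sum_k eta R j k * f j k = \sum_k eta R k k * f k k.
    by rewrite !sum4 !etaE !ordE; ring.
  have w13 u (q : 'I_4 -> R) (w : 'I_4 -> form3 R) r : wedge13 u (fun a b c =>
      r * \sum_k q k * w k a b c) a b c d = r * \sum_k q k * wedge13 u (w k) a b c d.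
    by rewrite /wedge13 !sum4; ring.
  rewrite -w13 /L_tele; congr (wedge13 _ _ _ _ _ _).
  by do 3!apply/funext => ?; rewrite /T_ax ed.
set V := _ * \det _ in WE *.
rewrite -[RHS]mulrA; congr (_ * _); rewrite mulr_sumr; apply: eq_bigr => k _.
rewrite dE wedge4_sum !mulr_sumr; apply: eq_bigr => i _.
rewrite !mulr_sumr; apply: eq_bigr => j _; rewrite WE /axial_coef; ring.
Qed.

Definition pauli1 (i : 'I_4) : 'M[C]_2 := pauli_mx 1%:M i.

(** The [00] entry of [sigma_j], the transposed raised [sigma_k] and [sigma_i] multiplied in this
    order: what a constant spinor [(z, 0)] sees of the Weyl current. *)
Definition triple (i k j : 'I_4) : C := \sum_(a < 2) \sum_(c < 2)
  pauli1 i a 0 * sp_raise (pauli1 k) a c * pauli1 j 0 c.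

Lemma sp_raiseE (M : 'M[C]_2) : sp_raise M = mx2 (M 1 1) (- M 1 0) (- M 0 1) (M 0 0).
Proof.
by apply: mx2P; rewrite mx2E mxE !sum2 /eps !mxE !ordE; ring.
Qed.

Lemma pauli1E : ((pauli1 0 = mx2 1 0 0 1) * (pauli1 1 = mx2 0 1 1 0) *
  (pauli1 2 = mx2 0 (iC R) (- iC R) 0) * (pauli1 3 = mx2 1 0 0 (-1)))%type.
Proof.
rewrite /pauli1 /pauli_mx !mcJ !mcE /lc; do 3?split; apply: mx2P; rewrite !mx2E !mxE !ordE /=; ring.
Qed.

(** The antisymmetric part of a triple product of Pauli matrices is, up to sign, [i] times the
    complementary Pauli matrix, whose [00] entry is nonzero only for the indices 0 and 3: hence [l].
    The rest is Hermitian, with real [00] entry. The 64 index triples are checked one by one. *)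
Lemma Im_triple i k j : complex.Im (triple i k j) = - axial_coef k i j.
Proof.
have l0 : ldlt 0 = 1 by rewrite /ldlt /dlt !ordE addr0.
have l1 : ldlt 1 = 0 by rewrite /ldlt /dlt !ordE addr0.
have l2 : ldlt 2 = 0 by rewrite /ldlt /dlt !ordE addr0.
have l3 : ldlt 3 = 1 by rewrite /ldlt /dlt !ordE add0r.
rewrite /axial_coef /det_rows l0 l1 l2 l3 !mul0r !mul1r subr0 addr0 /dlt !etaE.
rewrite /triple !sum2.
by elim/ord4_ind: k; elim/ord4_ind: i; elim/ord4_ind: j;
  rewrite !pauli1E !sp_raiseE !mx2E !ordE /iC /=; ring.
Qed.

(** The Koszul bracket is symmetric in [i] and [j] while [axial_coef] is antisymmetric, so the
    bracket contributes 0 and only the term [- c k i j] counts. In the proof the six terms of the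
    bracket become [S] or [- S] by permuting indices. *)
Lemma axial_sum (c : 'I_4 -> 'I_4 -> 'I_4 -> R) :
  \sum_i \sum_k \sum_j - axial_coef k i j * (- c k i j + 2^-1 * (c k i j + c j i k
     + (c k j i + c i j k) - (c j k i + c i k j))) =
  \sum_k \sum_i \sum_j axial_coef k i j * c k i j.
Proof.
pose tot (f : 'I_4 -> 'I_4 -> 'I_4 -> R) : R := \sum_i \sum_k \sum_j f i k j.
have t12 f : tot f = tot (fun i k j => f k i j) by rewrite /tot exchange_big.
have t23 f : tot f = tot (fun i k j => f i j k).
  by apply: eq_bigr => i _; rewrite exchange_big.
have tD f h : tot (fun i k j => f i k j + h i k j) = tot f + tot h.
  rewrite /tot -big_split; apply: eq_bigr => i _; rewrite -big_split.
  by apply: eq_bigr => k _; rewrite -big_split.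
have tZ r f : tot (fun i k j => r * f i k j) = r * tot f.
  by rewrite /tot !mulr_sumr; do 3!(apply: eq_bigr => ? _; rewrite ?mulr_sumr).
have a12 k i j : axial_coef i k j = - axial_coef k i j by rewrite /axial_coef /det_rows; ring.
have a23 k i j : axial_coef k j i = - axial_coef k i j by rewrite /axial_coef /det_rows; ring.
pose S := tot (fun k i j => axial_coef k i j * c k i j).
rewrite -[RHS]/S.
have S1 : tot (fun i k j => axial_coef k i j * c k i j) = S by rewrite t12.
have S2 : tot (fun i k j => axial_coef k i j * c i k j) = - S.
  rewrite -[RHS]mulN1r -tZ; do 3!(apply: eq_bigr => ? _); rewrite a12; ring.
have S3 : tot (fun i k j => axial_coef k i j * c j i k) = - S.
  rewrite t23 t12 -[RHS]mulN1r -tZ; do 3!(apply: eq_bigr => ? _).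
  by rewrite a12 a23 a12; ring.
have S4 : tot (fun i k j => axial_coef k i j * c k j i) = - S.
  rewrite t12 t23 -[RHS]mulN1r -tZ; do 3!(apply: eq_bigr => ? _).
  by rewrite a23; ring.
have S5 : tot (fun i k j => axial_coef k i j * c i j k) = S.
  by rewrite t23; do 3!(apply: eq_bigr => ? _); rewrite a12 a23; ring.
have S6 : tot (fun i k j => axial_coef k i j * c j k i) = S.
  by rewrite t12 t23 t12; do 3!(apply: eq_bigr => ? _); rewrite a23 a12; ring.
transitivity (tot (fun i k j => axial_coef k i j * c k i j) + - 2^-1 *
  (tot (fun i k j => axial_coef k i j * c k i j) + tot (fun i k j => axial_coef k i j * c j i k)
   + tot (fun i k j => axial_coef k i j * c k j i) + tot (fun i k j => axial_coef k i j * c i j k)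
   + - 1 * tot (fun i k j => axial_coef k i j * c j k i)
   + - 1 * tot (fun i k j => axial_coef k i j * c i k j))).
  rewrite -!tZ -!tD -tZ -tD; do 3!(apply: eq_bigr => ? _); ring.
by rewrite S1 S2 S3 S4 S5 S6; field.
Qed.

End Axial.

(** * Gauge covariance of the spinor derivative *)

Section Gauge.
Variables (R : realType) (U : set 'rV[R]_4).
Hypothesis oU : open U.
Variables (g T : 'rV[R]_4 -> 'M[R]_4).
Hypothesis fT : frame U g T.
Local Notation C := R[i].
Local Notation conjmx := (map_mx (@conjc R)).

Lemma sigma_up_pauli y al : U y ->
  sigma_up g (fun x => pauli_mx (T x)) y al = pauli_mx (dual_frame g T y) al.
Proof.
move=> Uy; have gs : (invmx (g y))^T = invmx (g y) by rewrite trmx_inv (frame_metric_sym fT Uy).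
rewrite /sigma_up /dual_frame pauli_mul; apply: eq_bigr => be _.
by rewrite -{1}gs mxE.
Qed.

(** [sp_raise] is the cofactor matrix, hence multiplicative, and the cofactor matrix of a unimodular
    matrix is its inverse transpose. *)
Lemma sp_raise_conj (B M : 'M[C]_2) : \det B = 1 ->
  B *m sp_raise (B^T *m M *m conjmx B) *m (conjmx B)^T = sp_raise M.
Proof.
rewrite det2 => dB.
have dB' : conjc (B 0 0) * conjc (B 1 1) - conjc (B 0 1) * conjc (B 1 0) = 1.
  by rewrite -!rmorphM -rmorphB dB rmorph1.
have -> : sp_raise M = ((B 0 0 * B 1 1 - B 0 1 * B 1 0) *
   (conjc (B 0 0) * conjc (B 1 1) - conjc (B 0 1) * conjc (B 1 0))) *: sp_raise M.
  by rewrite dB dB' mul1r scale1r.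
rewrite !sp_raiseE; apply: mx2P; rewrite ?mxE ?sum2 ?mul2E ?mx2E ?mxE ?ordE; ring.
Qed.

Lemma sp_raise_sum (I : finType) (a : I -> C) (M : I -> 'M[C]_2) :
  sp_raise (\sum_k a k *: M k) = \sum_k a k *: sp_raise (M k).
Proof.
apply: mx2P; rewrite summxE sp_raiseE mx2E summxE -?sumrN; apply: eq_bigr => k _;
  by rewrite sp_raiseE mxE [in RHS]mxE mx2E ?mulrN.
Qed.

Lemma eta_scale_sum (f : 'I_4 -> 'I_4 -> 'M[C]_2) :
  \sum_k \sum_j (eta R k j)%:C%C *: f k j = f 0 0 - f 1 1 - f 2 2 - f 3 3.
Proof.
have addE (A B : 'M[C]_2) i j : (A - B) i j = A i j - B i j by rewrite !mxE.
apply/matrixP => a b; rewrite !addE.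
transitivity (\sum_k \sum_j (eta R k j)%:C%C * f k j a b).
  rewrite summxE; apply: eq_bigr => k _; rewrite summxE; apply: eq_bigr => j _.
  by rewrite mxE.
by rewrite !sum4 !etaE !ordE; ring.
Qed.

(** The Fierz completeness relation, reduced to the standard Pauli matrices by the pairing of frame
    and dual frame. It is applied to the identity, where it returns 4, and to a traceless matrix,
    where it returns 0. *)
Lemma pauli_complete x (M : 'M[C]_2) : U x ->
  \sum_be sp_raise (pauli_mx (T x) be) *m M *m (pauli_mx (dual_frame g T x) be)^T =
  (2 * \tr M)%:M.
Proof.
move=> Ux.
have e be : sp_raise (pauli_mx (T x) be) *m M *m (pauli_mx (dual_frame g T x) be)^T =
  \sum_k \sum_j (T x k be * dual_frame g T x j be)%:C%C *:
    (sp_raise (pauli1 R k) *m M *m (pauli1 R j)^T).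
  rewrite -[T x]mul1mx -[dual_frame g T x]mul1mx !pauli_mul.
  rewrite sp_raise_sum.
  rewrite raddf_sum /= mulmx_suml mulmx_suml; apply: eq_bigr => k _.
  rewrite mulmx_sumr; apply: eq_bigr => j _.
  have -> (a : C) (P : 'M[C]_2) : (a *: P)^T = a *: P^T by apply/matrixP => ? ?; rewrite !mxE.
  rewrite -scalemxAr -!scalemxAl scalerA !mul1mx; congr (_ *: _).
  by ring.
transitivity (\sum_k \sum_j (eta R k j)%:C%C *: (sp_raise (pauli1 R k) *m M *m (pauli1 R j)^T)).
  under eq_bigr => be _ do rewrite e.
  rewrite exchange_big; apply: eq_bigr => k _; rewrite exchange_big; apply: eq_bigr => j _.
  by rewrite -scaler_suml -rmorph_sum (dual_frame_sum fT).
rewrite eta_scale_sum !(pauli1E R); have i2 := iC_sqr R.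
have trE (a b c d : C) : (mx2 a b c d)^T = mx2 a c b d by apply: mx2P; rewrite mxE !mx2E.
have addE (A B : 'M[C]_2) i j : (A - B) i j = A i j - B i j by rewrite !mxE.
rewrite !sp_raiseE !mx2E !trE; apply: mx2P; rewrite !addE !mul2E !mx2E mxE /mxtrace sum2 !ordE /=;
  ring: i2.
Qed.

End Gauge.

Section GaugeCovariance.
Variables (R : realType) (U : set 'rV[R]_4).
Hypothesis oU : open U.
Variables (g T : 'rV[R]_4 -> 'M[R]_4).
Hypothesis fT : frame U g T.
Local Notation C := R[i].
Local Notation conjmx := (map_mx (@conjc R)).
Local Notation F := (dual_frame g T).
Local Notation tau := (fun y => pauli_mx (T y)).

Definition nabla_col (sigma : 'rV[R]_4 -> 'I_4 -> 'M[C]_2) (xi : 'rV[R]_4 -> 'rV[C]_2)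
    (mu : 'I_4) x : 'cV[C]_2 := \col_a nabla g sigma xi mu a x.

Definition cov_sigma (sigma : 'rV[R]_4 -> 'I_4 -> 'M[C]_2) (mu be : 'I_4) x : 'M[C]_2 :=
  pdMx mu (fun y => sigma_up g sigma y be) x +
  \sum_ga (christoffel g be mu ga x)%:C%C *: sigma_up g sigma x ga.

Lemma nabla_colE sigma xi mu x : nabla_col sigma xi mu x = (pdMx mu xi x)^T +
  4^-1 *: \sum_be sp_raise (sigma x be) *m (cov_sigma sigma mu be x)^T *m (xi x)^T.
Proof.
apply/matrixP => a i; rewrite (ord1 i) !mxE; congr (_ + _ * _).
rewrite summxE; apply: eq_bigr => be _; rewrite !mxE; apply: eq_bigr => b _.
rewrite !mxE mulr_suml; apply: eq_bigr => c _; rewrite !mxE summxE.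
congr (_ * (_ + _) * _).
by apply: eq_bigr => ga _; rewrite mxE.
Qed.

Definition weyl_current (sigma : 'rV[R]_4 -> 'I_4 -> 'M[C]_2) (xi : 'rV[R]_4 -> 'rV[C]_2)
    x : C := \sum_(mu < 4) \sum_(a < 2) \sum_(b < 2)
  conjc (xi x 0 b) * sigma_up g sigma x mu a b * nabla g sigma xi mu a x.

Lemma weyl_currentE sigma xi x : weyl_current sigma xi x =
  \sum_(mu < 4) ((nabla_col sigma xi mu x)^T *m sigma_up g sigma x mu *m (conjmx (xi x))^T) 0 0.
Proof.
apply: eq_bigr => mu _; rewrite !sum2 !mul2E !mxE /nabla_col; ring.
Qed.

Variables (sigma : 'rV[R]_4 -> 'I_4 -> 'M[C]_2) (xi : 'rV[R]_4 -> 'rV[C]_2).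
Variable B : 'rV[R]_4 -> 'M[C]_2.
Hypothesis SB : smoothMx U B.
Hypothesis Sxi : smoothMx U xi.
Hypothesis dB : forall y, U y -> \det (B y) = 1.
Hypothesis sigmaB : forall y al, U y ->
  sigma y al = (B y)^T *m pauli_mx (T y) al *m conjmx (B y).

Lemma sigma_up_conj y al : U y ->
  sigma_up g sigma y al = (B y)^T *m pauli_mx (F y) al *m conjmx (B y).
Proof.
move=> Uy; rewrite -(sigma_up_pauli fT) // /sigma_up mulmx_sumr mulmx_suml.
by apply: eq_bigr => be _; rewrite sigmaB // -scalemxAr -scalemxAl.
Qed.

Lemma pauli_dual_smooth al : smoothMx U (fun y => pauli_mx (F y) al).
Proof.
have SF := dual_frame_smooth oU fT.
have Sm : smoothC U (fun x => mc (F x) al) by apply: smoothC_pair.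
move=> i j; elim/ord2_ind: i; elim/ord2_ind: j; rewrite /pauli_mx.
- apply: (@smoothC_ext _ _ oU (fun x => lc (F x) al)) => [x _|]; first by rewrite mx2E.
  by apply: smoothC_real; apply: smoothD.
- by apply: smoothC_ext Sm => // x _; rewrite mx2E.
- by apply: smoothC_ext (smoothC_conj oU Sm) => // x _; rewrite mx2E.
- apply: (@smoothC_ext _ _ oU (fun x => (F x 0 al - F x 3 al)%:C%C)) => [x _|].
    by rewrite mx2E.
  by apply: smoothC_real; apply: smoothB.
Qed.

Lemma det_conj_tr y : U y -> \det (conjmx (B y))^T = 1.
Proof. by move=> Uy; rewrite det_tr det_map_mx dB // rmorph1. Qed.

(** The logarithmic derivative of a determinant that is constantly 1; the inverse is written as the
    adjugate. *)
Lemma trace_dlog mu x : U x ->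
  \tr (invmx (conjmx (B x))^T *m (pdMx mu (fun y => conjmx (B y)) x)^T) = 0.
Proof.
move=> Ux; have Sc := smoothMx_conj oU SB.
set N := fun y => conjmx (B y).
have dN y : U y -> N y 0 0 * N y 1 1 - N y 0 1 * N y 1 0 = 1.
  by move=> Uy; rewrite -det2 -det_tr det_conj_tr.
have iE : invmx (N x)^T = mx2 (N x 1 1) (- N x 1 0) (- N x 0 1) (N x 0 0).
  apply: mulmx1_invmx; have d1 := dN x Ux.
  by apply: mx2P; rewrite mul2E !mx2E ![(_^T) _ _]mxE [RHS]mxE !ordE /= -?d1; ring.
rewrite iE /mxtrace sum2 !mul2E !mx2E ![(_^T) _ _]mxE.
have : pdC mu (fun y => N y 0 0 * N y 1 1 + - (N y 0 1 * N y 1 0)) x = 0.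
  transitivity (pdC mu (fun=> 1 : C) x); last exact: pdC_cst.
  apply: (pdC_ext oU) => // y Uy; exact: dN.
rewrite (@pdCD _ _ oU) //; last 2 first.
- by apply: smoothCM => //; apply: Sc.
- by apply: smoothCN => //; apply: smoothCM => //; apply: Sc.
have -> : pdC mu (fun y => - (N y 0 1 * N y 1 0)) x = - pdC mu (fun y => N y 0 1 * N y 1 0) x.
  have := @pdCM _ _ oU (fun=> -1) (fun y => N y 0 1 * N y 1 0) x mu (smoothC_cst U (-1))
    (smoothCM oU (Sc 0 1) (Sc 1 0)) Ux.
  rewrite pdC_cst mul0r add0r mulN1r => <-.
  by apply: (pdC_ext oU) => // y _; rewrite mulN1r.
rewrite !(@pdCM _ _ oU) //; try exact: Sc.
by move=> e; rewrite -[RHS]e !mxE; ring.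
Qed.

(** The Leibniz rule. The Christoffel term is tensorial, so it joins the middle summand, where the
    frame part is differentiated. *)
Lemma cov_sigma_conj mu be x : U x -> (cov_sigma sigma mu be x)^T =
  (conjmx (B x))^T *m (pauli_mx (F x) be)^T *m pdMx mu B x +
  (conjmx (B x))^T *m (cov_sigma tau mu be x)^T *m B x +
  (pdMx mu (fun y => conjmx (B y)) x)^T *m (pauli_mx (F x) be)^T *m B x.
Proof.
move=> Ux; rewrite -[B x in RHS]trmxK -[pdMx mu B x in RHS]trmxK -!trmx_mul -!raddfD /=.
congr (_^T); have SP := pauli_dual_smooth be; have ST := smoothMx_tr oU SB.
have Sc := smoothMx_conj oU SB.
rewrite {1}/cov_sigma.
have -> : pdMx mu (fun y => sigma_up g sigma y be) x =
    pdMx mu (fun y => (B y)^T *m pauli_mx (F y) be *m conjmx (B y)) x.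
  by apply: (pdMx_ext oU) => // y Uy; apply: sigma_up_conj.
rewrite (pdMx_mul oU) //; last exact: smoothMx_mul.
rewrite (pdMx_mul oU) // (pdMx_tr oU) // mulmxDl !mulmxA.
rewrite !trmxK [LHS]addrAC; congr (_ + _); rewrite -addrA; congr (_ + _).
have -> : \sum_ga (christoffel g be mu ga x)%:C%C *: sigma_up g sigma x ga =
    (B x)^T *m (\sum_ga (christoffel g be mu ga x)%:C%C *: sigma_up g tau x ga) *m conjmx (B x).
  rewrite mulmx_sumr mulmx_suml; apply: eq_bigr => ga _.
  by rewrite sigma_up_conj // (sigma_up_pauli fT) // -scalemxAr -scalemxAl.
rewrite -mulmxDl -mulmxDr; congr (_ *m _ *m _); rewrite /cov_sigma; congr (_ + _).
by apply: (pdMx_ext oU) => // y Uy; rewrite (sigma_up_pauli fT).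
Qed.

(** In the connection term the derivative of [B] survives completeness with factor [4/4] and
    supplies the missing part of the derivative of [xi B^T]. The derivative of [conj B] enters
    through a trace, which vanishes by [trace_dlog]. *)
Lemma nabla_gauge mu x : U x ->
  B x *m nabla_col sigma xi mu x = nabla_col tau (fun y => xi y *m (B y)^T) mu x.
Proof.
move=> Ux; have ST := smoothMx_tr oU SB.
rewrite !nabla_colE (pdMx_mul oU) // (pdMx_tr oU) //.
rewrite [(_ + _)^T]raddfD /= !trmx_mul !trmxK mulmxDr -addrA; congr (_ + _).
have dBx := dB Ux; set N := (conjmx (B x))^T.
have uN : N \in unitmx by rewrite unitmxE (det_conj_tr Ux) unitr1.
set V := (xi x)^T; set dBm := pdMx mu B x; set dN := (pdMx mu (fun y => conjmx (B y)) x)^T.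
have key be : B x *m (sp_raise (sigma x be) *m (cov_sigma sigma mu be x)^T *m V) =
   sp_raise (pauli_mx (T x) be) *m 1%:M *m (pauli_mx (F x) be)^T *m (dBm *m V) +
   sp_raise (pauli_mx (T x) be) *m (cov_sigma tau mu be x)^T *m (B x *m V) +
   sp_raise (pauli_mx (T x) be) *m (invmx N *m dN) *m (pauli_mx (F x) be)^T *m (B x *m V).
  have r : B x *m sp_raise (sigma x be) = sp_raise (pauli_mx (T x) be) *m invmx N.
    rewrite -(sp_raise_conj (pauli_mx (T x) be) dBx) -sigmaB // -/N.
    by rewrite -mulmxA mulmxV // mulmx1.
  rewrite !mulmxA r cov_sigma_conj // -/N -/dBm -/dN mulmx1 !mulmxDr !mulmxDl !mulmxA.
  have iN W : W *m invmx N *m N = W by rewrite -mulmxA mulVmx // mulmx1.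
  by rewrite !iN.
rewrite -scalemxAr mulmx_sumr.
rewrite (eq_bigr _ (fun be _ => key be)).
rewrite !big_split /= -!mulmx_suml !(pauli_complete fT) // trace_dlog //.
rewrite mxtrace1 mulr0 !mul_scalar_mx scale0r addr0 scalerDr scalerA.
have -> : 4^-1 * (2 * 2%:R) = 1 :> C by rewrite -natrM mulVf // pnatr_eq0.
by rewrite scale1r; congr (_ + _ *: _); apply: eq_bigr.
Qed.

Lemma weyl_current_gauge x : U x ->
  weyl_current sigma xi x = weyl_current tau (fun y => xi y *m (B y)^T) x.
Proof.
move=> Ux; rewrite !weyl_currentE; apply: eq_bigr => mu _.
rewrite -nabla_gauge // sigma_up_conj // (sigma_up_pauli fT) //.
have -> : (conjmx (xi x *m (B x)^T))^T = conjmx (B x) *m (conjmx (xi x))^T.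
  apply/matrixP => i j; rewrite !mxE rmorph_sum; apply: eq_bigr => k _.
  by rewrite !mxE rmorphM mulrC.
by rewrite trmx_mul !mulmxA.
Qed.

End GaugeCovariance.

(** * The Weyl current of a constant spinor and the Lagrangian identity *)

Section WeylFrame.
Variables (R : realType) (U : set 'rV[R]_4).
Hypothesis oU : open U.
Variables (g T : 'rV[R]_4 -> 'M[R]_4).
Hypothesis fT : frame U g T.
Local Notation C := R[i].
Local Notation conjmx := (map_mx (@conjc R)).
Local Notation F := (dual_frame g T).
Local Notation tau := (fun y => pauli_mx (T y)).

Lemma triple_expand (f h k : 'I_4 -> C) (M N P : 'I_4 -> 'M[C]_2) :
  \sum_(a < 2) \sum_(c < 2) (\sum_i f i *: M i) a 0 * (\sum_i h i *: N i) a c *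
    (\sum_i k i *: P i) 0 c =
  \sum_i \sum_j \sum_l f i * h j * k l *
    \sum_(a < 2) \sum_(c < 2) M i a 0 * N j a c * P l 0 c.
Proof.
have e (q : 'I_4 -> C) (Q : 'I_4 -> 'M[C]_2) a c : (\sum_i q i *: Q i) a c = \sum_i q i * Q i a c.
  by rewrite summxE; apply: eq_bigr => i _; rewrite mxE.
under eq_bigr => a _ do under eq_bigr => c _ do rewrite !e.
transitivity (\sum_(a < 2) \sum_(c < 2) \sum_i \sum_j \sum_l
    f i * h j * k l * (M i a 0 * N j a c * P l 0 c)).
  apply: eq_bigr => a _; apply: eq_bigr => c _.
  rewrite big_distrlr /= mulr_suml; apply: eq_bigr => i _.
  rewrite mulr_suml; apply: eq_bigr => j _; rewrite mulr_sumr; apply: eq_bigr => l _; ring.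
rewrite sum2 !sum2 -!big_split; apply: eq_bigr => i _; rewrite -!big_split /=.
apply: eq_bigr => j _; rewrite -!big_split /=; apply: eq_bigr => l _; rewrite !sum2; ring.
Qed.

(** A constant spinor has no derivative term, so only the connection is left, and [z] enters only as
    [conj z * z]. *)
Lemma weyl_current_const (zeta : 'rV[R]_4 -> 'rV[C]_2) (z : C) x : U x ->
  (forall y, U y -> zeta y 0 0 = z /\ zeta y 0 1 = 0) -> conjc z * z = 1 ->
  weyl_current g tau zeta x = 4^-1 * \sum_i \sum_k \sum_j triple R i k j *
    (\sum_mu \sum_be F x i mu * T x k be * (pd mu (fun y => F y j be) x +
       \sum_ga christoffel g be mu ga x * F x j ga))%:C%C.
Proof.
move=> Ux zc zz; have [z0 z1] := zc x Ux; have SF := dual_frame_smooth oU fT.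
pose Y mu be j := pd mu (fun y => F y j be) x + \sum_ga christoffel g be mu ga x * F x j ga.
have Pb y be b c : U y -> sigma_up g tau y be b c = \sum_j (F y j be)%:C%C * pauli1 R j b c.
  move=> Uy; rewrite (sigma_up_pauli fT) // -[F y]mul1mx pauli_mul summxE.
  by apply: eq_bigr => j _; rewrite mxE mul1mx.
have PM be : sigma_up g tau x be = \sum_j (F x j be)%:C%C *: pauli1 R j.
  by rewrite (sigma_up_pauli fT) // -[F x]mul1mx pauli_mul; apply: eq_bigr => j _; rewrite mul1mx.
have XE mu be b c : pdC mu (fun y => sigma_up g tau y be b c) x +
    \sum_ga (christoffel g be mu ga x)%:C%C * sigma_up g tau x ga b c =
    (\sum_j (Y mu be j)%:C%C *: pauli1 R j) b c.
  have -> : pdC mu (fun y => sigma_up g tau y be b c) x =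
     \sum_j (pd mu (fun y => F y j be) x)%:C%C * pauli1 R j b c.
    transitivity (pdC mu (fun y => \sum_j (F y j be)%:C%C * pauli1 R j b c) x).
      by apply: (pdC_ext oU) => // y Uy; apply: Pb.
    rewrite (pdC_sum oU) // => [|j]; last first.
      by apply: smoothCM => //; [apply: smoothC_real; apply: SF|apply: smoothC_cst].
    apply: eq_bigr => j _; rewrite (@pdCM _ _ oU) //; last 2 first.
    - by apply: smoothC_real; apply: SF.
    - exact: smoothC_cst.
    by rewrite pdC_real pdC_cst mulr0 addr0.
  rewrite summxE.
  transitivity (\sum_j ((pd mu (fun y => F y j be) x)%:C%C * pauli1 R j b c +
     \sum_ga (christoffel g be mu ga x)%:C%C * ((F x j ga)%:C%C * pauli1 R j b c))).
    rewrite big_split /=; congr (_ + _); rewrite exchange_big; apply: eq_bigr => ga _.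
    by rewrite Pb // mulr_sumr.
  apply: eq_bigr => j _; rewrite [RHS]mxE /Y.
  rewrite (rmorphD (real_complex R)) mulrDl; congr (_ + _).
  rewrite (rmorph_sum (real_complex R)) mulr_suml; apply: eq_bigr => ga _.
  by ring.
have nE mu a : nabla g tau zeta mu a x = 4^-1 * \sum_be \sum_(c < 2)
    (\sum_k (T x k be)%:C%C *: sp_raise (pauli1 R k)) a c *
    (\sum_j (Y mu be j)%:C%C *: pauli1 R j) 0 c * z.
  rewrite /nabla.
  have -> : pdC mu (fun y => zeta y 0 a) x = 0.
    transitivity (pdC mu (fun=> zeta x 0 a) x); last exact: pdC_cst.
    apply: (pdC_ext oU) => // y Uy; have [y0 y1] := zc y Uy.
    by elim/ord2_ind: a; rewrite ?y0 ?y1 ?z0 ?z1.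
  rewrite add0r; congr (_ * _); apply: eq_bigr => be _.
  rewrite sum2 [X in _ + X]big1 ?addr0 => [|c _]; last by rewrite z1 mulr0.
  apply: eq_bigr => c _; rewrite z0 XE; congr (_ * _ * _).
  by rewrite -sp_raise_sum -[T x]mul1mx pauli_mul; congr (sp_raise _ _ _); apply: eq_bigr => k _;
    rewrite mul1mx.
rewrite /weyl_current.
transitivity (4^-1 * \sum_mu \sum_be \sum_(a < 2) \sum_(c < 2)
   (\sum_i (F x i mu)%:C%C *: pauli1 R i) a 0 *
   (\sum_k (T x k be)%:C%C *: sp_raise (pauli1 R k)) a c *
    (\sum_j (Y mu be j)%:C%C *: pauli1 R j) 0 c).
  rewrite mulr_sumr; apply: eq_bigr => mu _.
  rewrite [in RHS]exchange_big mulr_sumr; apply: eq_bigr => a _.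
  rewrite sum2 z0 z1 conjc0 mul0r mul0r addr0 nE PM.
  rewrite !mulr_sumr; apply: eq_bigr => be _; rewrite !mulr_sumr; apply: eq_bigr => c _.
  move: ((\sum_i (F x i mu)%:C%C *: pauli1 R i) a 0)
    ((\sum_k (T x k be)%:C%C *: sp_raise (pauli1 R k)) a c)
    ((\sum_j (Y mu be j)%:C%C *: pauli1 R j) 0 c) => p q r.
  by rewrite -[RHS]mulr1 -zz; ring.
congr (_ * _).
under eq_bigr => mu _ do under eq_bigr => be _ do rewrite triple_expand.
transitivity (\sum_mu \sum_be \sum_i \sum_k \sum_j triple R i k j *
    (F x i mu * T x k be * Y mu be j)%:C%C).
  apply: eq_bigr => mu _; apply: eq_bigr => be _; apply: eq_bigr => i _.
  apply: eq_bigr => k _; apply: eq_bigr => j _.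
  by rewrite /triple mulrC !rmorphM.
have xc (f : 'I_4 -> 'I_4 -> 'I_4 -> 'I_4 -> 'I_4 -> C) :
    \sum_a \sum_b \sum_i \sum_k \sum_j f a b i k j =
    \sum_i \sum_k \sum_j \sum_a \sum_b f a b i k j.
  under eq_bigr => a _ do rewrite exchange_big.
  rewrite exchange_big; apply: eq_bigr => i _.
  under eq_bigr => a _ do rewrite exchange_big.
  rewrite exchange_big; apply: eq_bigr => k _.
  under eq_bigr => a _ do rewrite exchange_big.
  by rewrite exchange_big.
rewrite xc; do 3!(apply: eq_bigr => ? _).
rewrite rmorph_sum mulr_sumr; apply: eq_bigr => mu _.
by rewrite rmorph_sum mulr_sumr; apply: eq_bigr => be _.
Qed.

Lemma Im_sum (I : finType) (f : I -> C) : complex.Im (\sum_i f i) = \sum_i complex.Im (f i).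
Proof.
by elim/big_rec2: _ => [//|i a b _ <-]; case: (f i) b => ? ? [? ?].
Qed.

Lemma Im_mulr (w : C) (r : R) : complex.Im (w * r%:C%C) = complex.Im w * r.
Proof. by case: w => a b /=; ring. Qed.

(** With [J] the Weyl current, the bracket of [L_Weyl] is [J - conj J], so [L_Weyl] is [- Im J]
    times the volume form. Here [Im J = S / 4], the quarter being that of the spinor derivative,
    while [L_tele] carries [S / 3] from the normalisation of [T_ax]: the ratio is [-4/3]. *)
Lemma tele_weyl (sigma : 'rV[R]_4 -> 'I_4 -> 'M[C]_2) (xi : 'rV[R]_4 -> 'rV[C]_2)
    (B : 'rV[R]_4 -> 'M[C]_2) (z : C) :
  smoothMx U B -> smoothMx U xi -> (forall y, U y -> \det (B y) = 1) ->
  (forall y al, U y ->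
    sigma y al = (B y)^T *m pauli_mx (T y) al *m conjmx (B y)) ->
  (forall y al a b, U y -> sigma y al a b = conjc (sigma y al b a)) ->
  (forall y, U y -> (xi y *m (B y)^T) 0 0 = z /\ (xi y *m (B y)^T) 0 1 = 0) ->
  conjc z * z = 1 -> forall x a b c d, U x ->
  (L_tele T x a b c d)%:C%C = - (4 / 3) * L_Weyl g sigma xi x a b c d.
Proof.
move=> SB Sxi dB sB sH zc zz x a b c d Ux.
pose S := \sum_k \sum_i \sum_j axial_coef R k i j * dframe g T x k i j.
have ImZ (r : R) (w : C) : complex.Im (r%:C%C * w) = r * complex.Im w.
  by case: w => ? ?; rewrite /=; ring.
have ImD : complex.Im (weyl_current g sigma xi x) = 4^-1 * S.
  rewrite (weyl_current_gauge oU fT SB Sxi dB sB Ux) (weyl_current_const Ux zc zz).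
  have -> : 4^-1 = (4^-1)%:C%C :> C by rewrite fmorphV rmorph_nat.
  rewrite ImZ /S -axial_sum; congr (_ * _).
  rewrite Im_sum; apply: eq_bigr => i _; rewrite Im_sum; apply: eq_bigr => k _.
  rewrite Im_sum; apply: eq_bigr => j _.
  by rewrite Im_mulr Im_triple (spin_connection oU fT).
have supH mu a' b' : sigma_up g sigma x mu a' b' = conjc (sigma_up g sigma x mu b' a').
  rewrite /sigma_up !summxE rmorph_sum; apply: eq_bigr => be _.
  by rewrite !mxE sH // rmorphM; congr (_ * _); apply/esym/conjc_real.
(* Hermiticity makes the second half of the Lagrangian the conjugate of the first. *)
have cur2 : \sum_(mu < 4) \sum_(a < 2) \sum_(b < 2)
   xi x 0 a * sigma_up g sigma x mu a b * conjc (nabla g sigma xi mu b x) =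
   conjc (weyl_current g sigma xi x).
  rewrite rmorph_sum; apply: eq_bigr => mu _; rewrite exchange_big rmorph_sum.
  apply: eq_bigr => a' _; rewrite rmorph_sum; apply: eq_bigr => b' _.
  by rewrite !rmorphM /= conjcK -supH.
have -> : L_Weyl g sigma xi x a b c d =
    (- (4^-1 * S) * (\det (T x) * levi_civita R a b c d))%:C%C.
  rewrite /L_Weyl.
  have -> : \sum_(mu < 4) \sum_(a0 < 2) \sum_(b0 < 2)
       (conjc (xi x 0 b0) * sigma_up g sigma x mu a0 b0 * nabla g sigma xi mu a0 x -
        xi x 0 a0 * sigma_up g sigma x mu a0 b0 * conjc (nabla g sigma xi mu b0 x)) =
      weyl_current g sigma xi x - conjc (weyl_current g sigma xi x).
    rewrite -cur2 -sumrB; apply: eq_bigr => mu _; rewrite -sumrB; apply: eq_bigr => a0 _.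
    by rewrite -sumrB.
  have dT : 0 < \det (T x) by have [_ /(_ x Ux)[]] := fT.
  rewrite /vol_form (sqrt_det_gram (frame_gram fT Ux)) gtr0_norm // -ImD.
  case: (weyl_current g sigma xi x) => p q.
  by apply/eqP; rewrite eq_complex /=; apply/andP; split; apply/eqP; field.
rewrite (L_teleE fT) // -/S.
have -> : - (4 / 3) = (- (4 / 3))%:C%C :> C.
  by rewrite rmorphN rmorphM fmorphV !rmorph_nat.
by rewrite -rmorphM; congr (_%:C%C); field.
Qed.

End WeylFrame.

(** * The coframe of the Pauli matrices *)

Section Forward.
Variable R : realType.
Implicit Types (G A B D : 'M[R]_4).

Lemma forward_sym G A B : A \in unitmx -> B \in unitmx ->
  G = A^T *m eta R *m A -> G = B^T *m eta R *m B ->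
  0 < cov_inner G (A 0) (B 0) -> 0 < cov_inner G (B 0) (A 0).
Proof.
move=> uA uB GA GB; rewrite !(cov_inner_lorentz _ _ GA, cov_inner_lorentz _ _ GB) //.
set L := B *m invmx A; have HL : L^T *m eta R *m L = eta R := gram_lorentz uA GA GB.
have -> : A *m invmx B = eta R *m L^T *m eta R.
  have [_ H] := lorentz_inv HL; rewrite -(mulmx1_invmx H) /L; apply/esym/mulmx1_invmx.
  by rewrite mulmxA -[B *m _ *m A]mulmxA mulVmx // mulmx1 mulmxV.
by have [_ ->] := lorentz_adj HL.
Qed.

Lemma forward_trans G A B D : A \in unitmx -> B \in unitmx ->
  G = A^T *m eta R *m A -> G = B^T *m eta R *m B -> G = D^T *m eta R *m D ->
  0 < cov_inner G (A 0) (B 0) -> 0 < cov_inner G (B 0) (D 0) ->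
  0 < cov_inner G (A 0) (D 0).
Proof.
move=> uA uB GA GB GD; rewrite (cov_inner_lorentz B uA GA) (cov_inner_lorentz D uB GB).
rewrite (cov_inner_lorentz D uA GA) => h1 h2.
have -> : D *m invmx A = (D *m invmx B) *m (B *m invmx A).
  by rewrite mulmxA -[D *m _ *m B]mulmxA mulVmx // mulmx1.
exact: lorentz_mul00 (gram_lorentz uB GB GD) (gram_lorentz uA GA GB) h2 h1.
Qed.

End Forward.

Section Hodge.
Variable R : realType.
Implicit Types (G E : 'M[R]_4).
Local Notation C := R[i].
Local Notation Ci := (iC R).

Lemma hodge2_sum (I : finType) G (k : I -> C) (w : I -> form2 C) ga de :
  hodge2 G (fun al be => \sum_i k i * w i al be) ga de = \sum_i k i * hodge2 G (w i) ga de.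
Proof.
rewrite /hodge2.
under [RHS]eq_bigr => i _ do rewrite mulrCA.
rewrite -mulr_sumr; congr (_ * _).
under [RHS]eq_bigr => i _ do rewrite mulr_sumr.
rewrite [RHS]exchange_big /=; apply: eq_bigr => al _.
under [RHS]eq_bigr => i _ do rewrite mulr_sumr.
rewrite [RHS]exchange_big /=; apply: eq_bigr => be _.
under [RHS]eq_bigr => i _ do rewrite mulrA.
rewrite -mulr_suml; congr (_ * _).
under [RHS]eq_bigr => i _ do rewrite mulr_sumr.
rewrite [RHS]exchange_big /=; apply: eq_bigr => mu _.
under [RHS]eq_bigr => i _ do rewrite mulr_sumr.
rewrite [RHS]exchange_big /=; apply: eq_bigr => nu _.
by rewrite mulr_sumr; apply: eq_bigr => i _; rewrite mulrCA.
Qed.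

(** With a negative determinant [hodge_lm] would give the eigenvalue [i] on the nonzero form
    [l /\ m]. *)
Lemma hodge_orient G E : E \in unitmx -> G = E^T *m eta R *m E ->
  (forall ga de, hodge2 G (wedge11 (lc E) (mc E)) ga de =
     - Ci * wedge11 (lc E) (mc E) ga de) -> 0 < \det E.
Proof.
move=> uE GE H.
have d0 : \det E != 0 by move: uE; rewrite unitmxE unitfE.
rewrite lt_def d0 /= leNgt; apply/negP => dn.
have := lmx_neq0 uE; move/eqP; apply; apply/matrixP => a b; rewrite !mxE.
have := hodge_lm a b uE GE; rewrite H ltr0_norm //.
move: (wedge11 _ _ _ _) => w e.
have : (2 * (\det E)%:C%C * Ci) * w = 0.
  transitivity ((- \det E)%:C%C * (- Ci * w) - (\det E)%:C%C * (- Ci * w)); first by ring.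
  by rewrite -e subrr.
move/eqP; rewrite mulf_eq0 => /orP[|/eqP //].
rewrite !mulf_eq0 pnatr_eq0 /= eq_complex /= (negbTE d0) /= => /eqP i0.
have := iC_sqr R; rewrite i0 mulr0 => /eqP; rewrite eq_sym oppr_eq0 oner_eq0; by [].
Qed.

End Hodge.

Lemma frame_of_smooth (R : realType) (U : set 'rV[R]_4) (tau : 'rV[R]_4 -> 'I_4 -> 'M[R[i]]_2) :
  open U ->
  (forall al, smoothMx U (fun x => tau x al)) ->
  forall j al, smooth U (fun x => frame_of (tau x) j al).
Proof.
move=> oU S j al; have S00 := S al 0 0; have S01 := S al 0 1; have S11 := S al 1 1.
elim/ord4_ind: j.
- apply: (@smooth_ext _ _ oU (fun x => (complex.Re (tau x al 0 0) +
     complex.Re (tau x al 1 1)) * 2^-1)) => [x _|]; first by rewrite frame_ofE.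
  apply: smoothM => //; last exact: smooth_cst.
  by apply: smoothD => //; [have [] := S00|have [] := S11].
- by apply: smooth_ext (proj1 S01) => // x _; rewrite frame_ofE.
- by apply: smooth_ext (proj2 S01) => // x _; rewrite frame_ofE.
- apply: (@smooth_ext _ _ oU (fun x => (complex.Re (tau x al 0 0) -
     complex.Re (tau x al 1 1)) * 2^-1)) => [x _|]; first by rewrite frame_ofE.
  apply: smoothM => //; last exact: smooth_cst.
  by apply: smoothB => //; [have [] := S00|have [] := S11].
Qed.

Section PauliCoframe.
Variables (R : realType) (U : set 'rV[R]_4) (g th0 : 'rV[R]_4 -> 'M[R]_4).
Variable sigma : 'rV[R]_4 -> 'I_4 -> 'M[R[i]]_2.
Local Notation C := R[i].
Local Notation Ci := (iC R).
Local Notation conjmx := (map_mx (@conjc R)).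
Hypothesis oU : open U.
Hypothesis hth0 : frame U g th0.
Hypothesis hS : pauli U g th0 sigma.

Definition pauli_frame x : 'M[R]_4 := frame_of (sigma x).
Local Notation e := pauli_frame.

Lemma pauli_frameE x al : U x -> sigma x al = pauli_mx (e x) al.
Proof.
by move=> Ux; have [_ /(_ x Ux)[H _ _ _]] := hS; rewrite pauli_frame_of.
Qed.

Lemma pauli_frame_smooth j al : smooth U (fun x => e x j al).
Proof.
by apply: frame_of_smooth => // a i k; have [] := hS.
Qed.

(** A diagonal spinor entry of the Clifford relation is the polarised determinant. Hence the frame
    with raised index has the inverse metric as Gram matrix; the metric lowers it again. *)
Lemma pauli_frame_gram x : U x -> g x = (e x)^T *m eta R *m e x.
Proof.
move=> Ux; have [_ /(_ x Ux)[_ H _ _]] := hS.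
have uG := frame_metric_unit hth0 Ux; have sG := frame_metric_sym hth0 Ux.
have sE al : sigma_up g sigma x al = pauli_mx (e x *m (invmx (g x))^T) al.
  rewrite pauli_mul; apply: eq_bigr => be _; rewrite pauli_frameE //.
  by rewrite [in RHS]mxE.
have K : (e x *m (invmx (g x))^T)^T *m eta R *m (e x *m (invmx (g x))^T) = invmx (g x).
  apply/matrixP => al be.
  have := H al be 0 0; rewrite !sum2 !sp_raiseE !mx2E !sE ordE mulr1 => h.
  have := mink_pauli (e x *m (invmx (g x))^T) al be; rewrite /mink => m.
  have two : 2 != 0 :> C by rewrite pnatr_eq0.
  have : 2 * (((e x *m (invmx (g x))^T)^T *m eta R *m (e x *m (invmx (g x))^T)) al be)%:C%C =
     2 * (invmx (g x) al be)%:C%C by rewrite -m -h; ring.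
  by move/(mulfI two)/eqP; rewrite eq_complex => /andP[/eqP /= -> _].
have K2 : invmx (g x) *m ((e x)^T *m eta R *m e x) *m (invmx (g x))^T = invmx (g x).
  by rewrite -{3}K trmx_mul trmxK !mulmxA.
have u' : (invmx (g x))^T \in unitmx by rewrite unitmx_tr unitmx_inv.
apply: (@sandwich_inj _ _ (invmx (g x)) (invmx (g x))^T); rewrite ?unitmx_inv //.
by rewrite K2 mulVmx // mul1mx trmx_inv sG.
Qed.

Lemma pauli_frame_unit x : U x -> e x \in unitmx.
Proof.
move=> Ux; have := frame_metric_unit hth0 Ux; rewrite (pauli_frame_gram Ux).
by rewrite !unitmx_mul => /andP[_ ->].
Qed.

Lemma sigma2_00 x : U x -> sigma2 sigma x 0 0 = wedge11 (lc (e x)) (mc (e x)).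
Proof.
move=> Ux; apply/funext => al; apply/funext => be.
by rewrite /sigma2 /wedge11 !sum2 !pauli_frameE // !mx2E /eps !mxE !ordE /=; field.
Qed.

(** Orientation follows because [sigma2] at the spinor indices [0 0] is [l /\ m]. Time orientation
    is tested on the two basis spinors, whose covectors are [e^0 + e^3] and [e^0 - e^3]: the mean of
    their time components is [L 0 0]. *)
Lemma pauli_coframe : coframe U g th0 e.
Proof.
have [_ HS] := hS; split; first split.
- exact: pauli_frame_smooth.
- move=> x Ux; split; first by apply/gramP; apply: pauli_frame_gram.
  apply: (hodge_orient (pauli_frame_unit Ux) (pauli_frame_gram Ux)) => ga de.
  by have [_ _ _ H] := HS x Ux; rewrite -sigma2_00.
move=> x Ux; have [_ _ H _] := HS x Ux.
have u0 := frame_unit hth0 Ux.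
rewrite (cov_inner_lorentz _ u0 (frame_gram hth0 Ux)).
set L := e x *m invmx (th0 x).
have eL : e x = L *m th0 x by rewrite /L -mulmxA mulVmx // mulmx1.
have key (s : R) (v : 'rV[C]_2) : v != 0 ->
    (forall al, \sum_(a < 2) \sum_(b < 2) sigma x al a b * v 0 a * conjc (v 0 b) =
       (e x 0 al + s * e x 3 al)%:C%C) -> 0 < L 0 0 + s * L 3 0.
  move=> v0 Hv; have [u [c [uc _ c0]] uE] := H v v0.
  have ue al : e x 0 al + s * e x 3 al = u al.
    by have := uE al; rewrite Hv => /eqP; rewrite eq_complex => /andP[/eqP].
  suff <- : c 0 = L 0 0 + s * L 3 0 by [].
  have rE (M : 'M[R]_4) j : (row 0 M + s *: row 3 M) 0 j = M 0 j + s * M 3 j.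
    by rewrite !mxE.
  have r : \row_j c j = row 0 L + s *: row 3 L.
    apply: (can_inj (mulmxK u0)); rewrite mulmxDl -scalemxAl -!row_mul -eL.
    apply/rowP => al; rewrite rE ue uc mxE; apply: eq_bigr => j _.
    by rewrite mxE.
  by have /rowP/(_ 0) := r; rewrite rE mxE.
have dE (j k : 'I_2) : (\row_i (i == j)%:R : 'rV[C]_2) 0 k = (k == j)%:R by rewrite mxE.
have k1 : 0 < L 0 0 + 1 * L 3 0.
  apply: (key 1 (\row_j (j == 0)%:R)).
    apply/eqP => /rowP/(_ 0); rewrite !mxE eqxx => /eqP; by rewrite oner_eq0.
  move=> al; rewrite !sum2 !dE !ordE !pauli_frameE // !mx2E conjc0 conjc1 /lc /=; ring.
have k2 : 0 < L 0 0 + -1 * L 3 0.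
  apply: (key (-1) (\row_j (j == 1)%:R)).
    apply/eqP => /rowP/(_ 1); rewrite !mxE eqxx => /eqP; by rewrite oner_eq0.
  move=> al; rewrite !sum2 !dE !ordE !pauli_frameE // !mx2E conjc0 conjc1 /lc /=; ring.
by lra.
Qed.

End PauliCoframe.

(** * Coframes obtained from spinor dyads *)

Section SpinorFrame.
Variables (R : realType) (U : set 'rV[R]_4) (g th0 : 'rV[R]_4 -> 'M[R]_4).
Variable sigma : 'rV[R]_4 -> 'I_4 -> 'M[R[i]]_2.
Local Notation C := R[i].
Local Notation Ci := (iC R).
Local Notation conjmx := (map_mx (@conjc R)).
Hypothesis oU : open U.
Hypothesis hth0 : frame U g th0.
Hypothesis hS : pauli U g th0 sigma.
Local Notation e := (pauli_frame sigma).

Lemma conjcM (z z' : C) : conjc (z * z') = conjc z * conjc z'.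
Proof. exact: rmorphM. Qed.

Lemma coframe_frame th : coframe U g th0 th -> frame U g th.
Proof. by case. Qed.

(** The metric is kept since [\det A = 1]. The new [l /\ m] is a combination of the [sigma2], hence
    in the same eigenspace of the star, which gives orientation. Time orientation follows from
    [conj_lorentz00] through the Pauli coframe. *)
Lemma frame_conj (A : 'rV[R]_4 -> 'M[C]_2) (T := fun y =>
    frame_of (fun al => (A y)^T *m sigma y al *m conjmx (A y))) :
  smoothMx U A -> (forall y, U y -> \det (A y) = 1) ->
  coframe U g th0 T /\ (forall y al, U y ->
    pauli_mx (T y) al = (A y)^T *m sigma y al *m conjmx (A y)).
Proof.
move=> SA dA; have [Ss HS] := hS.
have TE y al : U y -> pauli_mx (T y) al = (A y)^T *m sigma y al *m conjmx (A y).
  move=> Uy; have [H _ _ _] := HS y Uy; rewrite pauli_frame_of // => a b.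
  have h i j : conjc (sigma y al i j) = sigma y al j i by rewrite -H.
  by rewrite !mul2E !mxE !conjcD !conjcM !conjcD !conjcM !conjcK !h; ring.
have TE' y (Uy : U y) al : pauli_mx (T y) al = (A y)^T *m pauli_mx (e y) al *m conjmx (A y).
  by rewrite TE // (pauli_frameE hS).
split=> //; have [fe0 fe1] := pauli_coframe oU hth0 hS.
have uE y (Uy : U y) := pauli_frame_unit hth0 hS Uy.
have gE y (Uy : U y) := pauli_frame_gram hth0 hS Uy.
have gT y : U y -> g y = (T y)^T *m eta R *m T y.
  by move=> Uy; rewrite (gram_conj (dA y Uy) (TE' y Uy)) gE.
have uT y : U y -> T y \in unitmx.
  move=> Uy; have := frame_metric_unit hth0 Uy; rewrite (gT y Uy).
  by rewrite !unitmx_mul => /andP[_ ->].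
split; first split.
- apply: frame_of_smooth => // k; apply: smoothMx_mul => //; last exact: smoothMx_conj.
  by apply: smoothMx_mul => //; apply: smoothMx_tr.
- move=> y Uy; split; first by apply/gramP; apply: gT.
  apply: (hodge_orient (uT y Uy) (gT y Uy)) => ga de.
  have wE : wedge11 (lc (T y)) (mc (T y)) = fun al be => \sum_(p : 'I_2 * 'I_2)
      (row 0 (A y)^T) 0 p.1 * (row 0 (A y)^T) 0 p.2 * sigma2 sigma y p.1 p.2 al be.
    apply/funext => al; apply/funext => be.
    rewrite (eps_wedge_conj al be (dA y Uy) (TE' y Uy)).
    have -> : pauli_mx (e y) = sigma y by apply/funext => a; rewrite (pauli_frameE hS).
    rewrite -sigma2_sum pair_big /=; apply: eq_bigr => p _.
    by rewrite -mulrA mulrC.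
  rewrite wE hodge2_sum mulr_sumr; apply: eq_bigr => p _.
  by have [_ _ _ ->] := HS y Uy; rewrite mulrCA.
move=> y Uy.
apply: (forward_trans (frame_unit hth0 Uy) (uE y Uy) (frame_gram hth0 Uy) (gE y Uy) (gT y Uy)).
  exact: fe1.
rewrite (cov_inner_lorentz _ (uE y Uy) (gE y Uy)).
apply: (conj_lorentz00 (dA y Uy)) => k.
by rewrite (pauli_conj_mul _ (TE' y Uy)) mulmxV ?uE.
Qed.

(** The second column is the spinor Hermitian-orthogonal to [xi], scaled to make the determinant 1;
    it is smooth wherever [xi] is smooth and nonzero. *)
Definition dyad (xi : 'rV[C]_2) : 'M[C]_2 :=
  let n := xi 0 0 * conjc (xi 0 0) + xi 0 1 * conjc (xi 0 1) in
  mx2 (xi 0 0) (- conjc (xi 0 1) / n) (xi 0 1) (conjc (xi 0 0) / n).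

Lemma norm2_neq0 (xi : 'rV[C]_2) : xi != 0 ->
  xi 0 0 * conjc (xi 0 0) + xi 0 1 * conjc (xi 0 1) != 0.
Proof.
apply: contra => /eqP h.
have [a0 b0] : xi 0 0 = 0 /\ xi 0 1 = 0.
  move/eqP: h; rewrite paddr_eq0 ?mulcJ_ge0 // !mulf_eq0 !conjc_eq0 !orbb.
  by move=> /andP[/eqP ? /eqP ?].
by apply/eqP/matrixP => i j; rewrite (ord1 i) mxE; elim/ord2_ind: j.
Qed.

Lemma dyad_det xi : xi != 0 -> \det (dyad xi) = 1.
Proof. by move=> /norm2_neq0 nz; rewrite det2 !mx2E; field. Qed.

Lemma dyad_row xi : row 0 (dyad xi)^T = xi.
Proof.
apply/matrixP => i j; rewrite (ord1 i) mxE [LHS]mxE.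
by elim/ord2_ind: j; rewrite mx2E.
Qed.

Lemma dyad_smooth (xi : 'rV[R]_4 -> 'rV[C]_2) :
  nv_spinor U xi -> smoothMx U (fun y => dyad (xi y)).
Proof.
move=> [S nz].
have Sc a := smoothC_conj oU (S a).
have Sn : smoothC U (fun y => (xi y 0 0 * conjc (xi y 0 0) + xi y 0 1 * conjc (xi y 0 1))^-1).
  apply: smoothCV => //; first by move=> y /nz /norm2_neq0.
  by apply: smoothCD => //; apply: smoothCM.
move=> i j; elim/ord2_ind: i; elim/ord2_ind: j.
- by apply: smoothC_ext (S 0) => // y _; rewrite mx2E.
- apply: smoothC_ext (smoothCM oU (smoothCN oU (Sc 1)) Sn) => // y _; by rewrite mx2E.
- by apply: smoothC_ext (S 1) => // y _; rewrite mx2E.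
- apply: smoothC_ext (smoothCM oU (Sc 0) Sn) => // y _; by rewrite mx2E.
Qed.

Lemma frame_conj_lm (A : 'rV[R]_4 -> 'M[C]_2) T y al be : U y -> \det (A y) = 1 ->
  (forall al, pauli_mx (T y) al = (A y)^T *m sigma y al *m conjmx (A y)) ->
  lm T y al be = eps_wedge (sigma y) (row 0 (A y)^T) al be.
Proof.
move=> Uy dA TE; have sE : pauli_mx (e y) = sigma y.
  by apply/funext => a; rewrite (pauli_frameE hS).
by rewrite lmE -sE; apply: eps_wedge_conj => // a; rewrite sE.
Qed.

Lemma spinor_coframe xi : nv_spinor U xi ->
  exists2 T, coframe U g th0 T & forall y, U y -> forall al be,
    lm T y al be = eps_wedge (sigma y) (xi y) al be.
Proof.
move=> Hxi; have nz y (Uy : U y) := dyad_det (proj2 Hxi y Uy).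
have [cT TE] := frame_conj (dyad_smooth Hxi) nz.
eexists; first exact: cT.
move=> y Uy al be; rewrite (frame_conj_lm (A := fun y => dyad (xi y))) ?dyad_row //.
  exact: nz.
by move=> a; apply: TE.
Qed.

Lemma eps_wedgeZ (s : 'I_4 -> 'M[C]_2) (k : C) (xi : 'rV[C]_2) al be :
  eps_wedge s (k *: xi) al be = k * k * eps_wedge s xi al be.
Proof. rewrite /eps_wedge /wedge11 -!scalemxAl !mxE; ring. Qed.

Lemma correspE th xi : corresp U sigma th xi <-> exists2 c : C, `|c| = 1 &
  forall x, U x -> forall al be, lm th x al be = c * eps_wedge (sigma x) (xi x) al be.
Proof.
by split=> -[c c1 H]; exists c => // x Ux al be; rewrite H // sigma2_sum.
Qed.

Lemma normc1P (c : C) : `|c| = 1 <-> conjc c * c = 1.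
Proof.
rewrite mulrC -sqr_normc; split=> [->|/eqP]; first by rewrite expr1n.
by rewrite sqrp_eq1 // => /eqP.
Qed.

Lemma norm1_sqrt (c : C) : `|c| = 1 -> exists2 k : C, `|k| = 1 & k * k = c.
Proof.
move=> c1; exists (sqrtc c); last by rewrite -expr2 sqr_sqrtc.
have := congr1 (fun z : C => `|z|) (sqr_sqrtc c); rewrite normrX c1 => /eqP.
by rewrite sqrp_eq1 // => /eqP.
Qed.

(** Supplies the gauge for [tele_weyl]. With [k^2 = c], the dyad of [k xi] gives a coframe with the
    same [l /\ m] as [th]; the null rotation [N] between the two completes it to [A], and [B] is the
    inverse of [A]. As the first column of [A] is [k xi], the spinor becomes the constant
    [(k^-1, 0)]. *)
Lemma corresp_gauge th xi : coframe U g th0 th -> nv_spinor U xi -> corresp U sigma th xi ->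
  exists (B : 'rV[R]_4 -> 'M[C]_2) (z : C),
  [/\ smoothMx U B, (forall y, U y -> \det (B y) = 1),
      (forall y al, U y -> sigma y al = (B y)^T *m pauli_mx (th y) al *m conjmx (B y)),
      (forall y, U y -> (xi y *m (B y)^T) 0 0 = z /\ (xi y *m (B y)^T) 0 1 = 0)
    & conjc z * z = 1].
Proof.
move=> cth Hxi /correspE[c c1 H].
have [k k1 kk] := norm1_sqrt c1.
have k0 : k != 0 by rewrite -normr_eq0 k1 oner_eq0.
pose xk y := k *: xi y.
have Hxk : nv_spinor U xk.
  split=> [a|y Uy]; last by rewrite scaler_eq0 negb_or k0 (proj2 Hxi).
  apply: (@smoothC_ext _ _ oU (fun y => k * xi y 0 a)) => [y _|]; first by rewrite mxE.
  by apply: smoothCM => //; [apply: smoothC_cst|apply: (proj1 Hxi)].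
have SA := dyad_smooth Hxk.
have dA y (Uy : U y) := dyad_det (proj2 Hxk y Uy).
have [] := frame_conj SA dA; set T := (fun y => frame_of _) => cT TE.
have lmT y : U y -> forall al be, lm T y al be = lm th y al be.
  move=> Uy al be.
  rewrite (frame_conj_lm (A := fun y => dyad (xk y)) _ _ Uy (dA y Uy)) => [|a]; last exact: TE.
  by rewrite dyad_row eps_wedgeZ kk H.
have fT := coframe_frame cT; have fth := coframe_frame cth.
pose L y := th y *m invmx (T y).
have Lth y : U y -> L y *m T y = th y.
  by move=> Uy; rewrite /L -mulmxA mulVmx ?mulmx1 // (frame_unit fT).
have SL i j : smooth U (fun y => L y i j).
  apply: smooth_mulmx => //; first by have [] := fth.
  apply: smooth_invmx => //; last by have [] := fT.
  by move=> y Uy; apply: (frame_unit fT Uy).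
have HL y : U y -> (L y)^T *m eta R *m L y = eta R.
  by move=> Uy; apply: gram_lorentz (frame_unit fT Uy) (frame_gram fT Uy) (frame_gram fth Uy).
have L00 y : U y -> 0 < L y 0 0.
  move=> Uy; rewrite -(cov_inner_lorentz _ (frame_unit fT Uy) (frame_gram fT Uy)).
  apply: (forward_trans (frame_unit fT Uy) (frame_unit hth0 Uy) (frame_gram fT Uy)
    (frame_gram hth0 Uy) (frame_gram fth Uy)); last by have [_ /(_ y Uy)] := cth.
  apply: forward_sym (frame_unit hth0 Uy) (frame_unit fT Uy) (frame_gram hth0 Uy)
    (frame_gram fT Uy) _.
  by have [_ /(_ y Uy)] := cT.
have HW y : U y -> forall a b, wedge11 (lc (L y)) (mc (L y)) a b =
    wedge11 (lc 1%:M) (mc 1%:M) a b.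
  move=> Uy a b; have : lmx (L y) = lmx 1%:M.
    apply: (lmx_inj (frame_unit fT Uy)); rewrite Lth // mul1mx.
    by apply/matrixP => i j; rewrite !mxE -!lmE lmT.
  by move/matrixP/(_ a b); rewrite !mxE.
pose N y : 'M[C]_2 := mx2 1 ((L y 1 0)%:C%C - Ci * (L y 2 0)%:C%C) 0 1.
have NE y al : U y -> pauli_mx (th y) al = (N y)^T *m pauli_mx (T y) al *m conjmx (N y).
  move=> Uy; rewrite -Lth // -{2}[T y]mul1mx.
  exact: pauli_conj_mul (null_rotation (HL y Uy) (L00 y Uy) (HW y Uy)) al.
have SN : smoothMx U N.
  move=> i j; elim/ord2_ind: i; elim/ord2_ind: j.
  - by apply: smoothC_ext (smoothC_cst U 1) => // y _; rewrite mx2E.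
  - apply: (@smoothC_ext _ _ oU (fun y => (L y 1 0)%:C%C + - (Ci * (L y 2 0)%:C%C))).
      by move=> y _; rewrite mx2E.
    apply: smoothCD => //; first exact: smoothC_real.
    by apply: smoothCN => //; apply: smoothCM => //; [apply: smoothC_cst|apply: smoothC_real].
  - by apply: smoothC_ext (smoothC_cst U 0) => // y _; rewrite mx2E.
  - by apply: smoothC_ext (smoothC_cst U 1) => // y _; rewrite mx2E.
pose A y := dyad (xk y) *m N y.
have SAN : smoothMx U A by apply: smoothMx_mul.
have dAN y : U y -> \det (A y) = 1.
  move=> Uy; rewrite det_mulmx dA // mul1r det2 !mx2E; ring.
have thE y al : U y -> pauli_mx (th y) al = (A y)^T *m sigma y al *m conjmx (A y).
  by move=> Uy; rewrite NE // TE // /A trmx_mul map_mxM !mulmxA.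
(* The adjugate, which is the inverse because [\det (A y) = 1], and is smooth at sight. *)
pose B y := mx2 (A y 1 1) (- A y 0 1) (- A y 1 0) (A y 0 0).
have AB y : U y -> A y *m B y = 1%:M.
  move=> Uy; have := dAN y Uy; rewrite det2 => d.
  by apply: mx2P; rewrite [RHS]mxE mul2E !mx2E !ordE /= -?d; ring.
have col y : A y 0 0 = k * xi y 0 0 /\ A y 1 0 = k * xi y 0 1.
  by rewrite /A !mul2E !mx2E !mxE; split; ring.
exists B, k^-1; split.
- move=> i j; elim/ord2_ind: i; elim/ord2_ind: j.
  + by apply: smoothC_ext (SAN 1 1) => // y _; rewrite mx2E.
  + by apply: smoothC_ext (smoothCN oU (SAN 0 1)) => // y _; rewrite mx2E.
  + by apply: smoothC_ext (smoothCN oU (SAN 1 0)) => // y _; rewrite mx2E.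
  + by apply: smoothC_ext (SAN 0 0) => // y _; rewrite mx2E.
- by move=> y Uy; rewrite -(dAN y Uy) !det2 !mx2E; ring.
- move=> y al Uy; rewrite thE //.
  have -> : (B y)^T *m ((A y)^T *m sigma y al *m conjmx (A y)) *m conjmx (B y) =
     (A y *m B y)^T *m sigma y al *m conjmx (A y *m B y).
    by rewrite (trmx_mul (A y) (B y)) (map_mxM _ (A y) (B y)) !mulmxA.
  by rewrite AB // trmx1 map_mx1 mul1mx mulmx1.
- move=> y Uy; have [c0 c1'] := col y.
  have := dAN y Uy; rewrite det2 c0 c1' => d.
  rewrite !mul2E ![(_^T) _ _]mxE !mx2E c0 c1'; split; last by ring.
  by apply: (mulfI k0); rewrite mulfV // -d; ring.
apply/normc1P; by rewrite normfV k1 invr1.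
Qed.

End SpinorFrame.

(** * Spinors of a coframe *)

Section SquareRoot.
Variables (R : realType) (U : set 'rV[R]_4).
Hypothesis oU : open U.
Local Notation C := R[i].

Lemma smoothC_sub (V : set 'rV[R]_4) (F : 'rV[R]_4 -> C) :
  open V -> V `<=` U -> smoothC U F -> smoothC V F.
Proof. by move=> oV VU [S1 S2]; split; apply: smooth_sub S1 || apply: smooth_sub S2. Qed.

(* Near [z = 1] the branch is [(|z| + z) / sqrt (2 (|z| + Re z))]. *)
Lemma csqrt_local (F : 'rV[R]_4 -> C) x : smoothC U F -> U x -> F x != 0 ->
  exists V r, [/\ open V, V x, V `<=` U, smoothC V r &
    forall y, V y -> r y * r y = F y /\ r y != 0].
Proof.
move=> SF Ux Fx; pose z y := (F x)^-1 * F y.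
have Sz : smoothC U z by apply: smoothCM => //; apply: smoothC_cst.
pose a y := complex.Re (z y); pose b y := complex.Im (z y).
have [Sa Sb] : smooth U a /\ smooth U b by [].
pose V := [set y | U y /\ 0 < a y].
have VU : V `<=` U by move=> y [].
have oV : open V.
  rewrite openE => y [Uy ay]; rewrite /interior.
  have nU : \forall t \near y, U t by apply: open_nbhs_nbhs.
  have na : \forall t \near y, 0 < a t.
    have ac : {for y, continuous a} := smooth_continuous Sa Uy.
    have := cvgr_gt (a y) ac 0 ay.
    by move=> /(_ (nbhs_filter y)).
  by near=> t; split; near: t.
have Vx : V x by split=> //; rewrite /a /z mulVf //= ltr01.
have SVa := smooth_sub oV VU Sa; have SVb := smooth_sub oV VU Sb.
pose n y := Num.sqrt (a y * a y + b y * b y).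
have q0 y : V y -> 0 < a y * a y + b y * b y.
  by move=> [_ ay]; rewrite ltr_pwDl ?mulr_gt0 // -expr2 sqr_ge0.
have nn y : V y -> n y * n y = a y * a y + b y * b y.
  by move=> Vy; rewrite -expr2 sqr_sqrtr // ltW // q0.
have n0 y : V y -> 0 < n y by move=> Vy; rewrite sqrtr_gt0 q0.
have Sn : smooth V n by apply: smooth_sqrt => //; apply: smoothD => //; apply: smoothM.
pose d y := Num.sqrt (2 * (n y + a y)).
have d0' y : V y -> 0 < 2 * (n y + a y).
  by move=> Vy; rewrite mulr_gt0 // addr_gt0 // ?n0 //; case: Vy.
have d0 y : V y -> 0 < d y by move=> Vy; rewrite sqrtr_gt0 d0'.
have dd y : V y -> d y * d y = 2 * (n y + a y).
  by move=> Vy; rewrite -expr2 sqr_sqrtr // ltW // d0'.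
have Sd : smooth V (fun y => (d y)^-1).
  apply: smoothV => // [y Vy|]; first by rewrite gt_eqF // d0.
  apply: smooth_sqrt => //; apply: smoothM => //; first exact: smooth_cst.
  exact: smoothD.
pose k := sqrtc (F x).
have kk : k * k = F x by rewrite -expr2 sqr_sqrtc.
pose r y : C := k * (((n y + a y) * (d y)^-1) +i* (b y * (d y)^-1))%C.
exists V, r; split=> //.
  apply: smoothCM => //; first exact: smoothC_cst.
  by apply: smoothC_pair => //; apply: smoothM => //; apply: smoothD.
move=> y Vy.
have e : r y * r y = F y.
  rewrite /r mulrACA kk.
  have -> : F y = F x * z y by rewrite /z mulrA mulfV // mul1r.
  congr (_ * _); have dn := lt0r_neq0 (d0 y Vy); have sn := lt0r_neq0 (d0' y Vy).
  have Nn := nn y Vy; have Dd := dd y Vy.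
  have i2 : (d y)^-1 * (d y)^-1 = (2 * (n y + a y))^-1 by rewrite -invfM Dd.
  have na0 : n y + a y != 0 by apply: contra sn => /eqP ->; rewrite mulr0.
  have -> : z y = (a y +i* b y)%C by rewrite /a /b; case: (z y).
  apply/eqP; rewrite eq_complex /=; apply/andP; split; apply/eqP.
    transitivity (((n y + a y) * (n y + a y) - b y * b y) * ((d y)^-1 * (d y)^-1)); first by ring.
    have -> : b y * b y = n y * n y - a y * a y by rewrite Nn; ring.
    by rewrite i2; field.
  transitivity (2 * (n y + a y) * b y * ((d y)^-1 * (d y)^-1)); first by ring.
  by rewrite i2; field.
split=> //; apply/eqP => r0.
have zy : z y != 0 by rewrite eq_complex negb_and gt_eqF //; case: Vy.
move: e; rewrite r0 mulr0 => F0; move/eqP: zy; apply; by rewrite /z -F0 mulr0.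
Unshelve. all: by end_near.
Qed.

End SquareRoot.

Section Lifting.
Variables (R : realType) (U : set 'rV[R]_4) (g th0 : 'rV[R]_4 -> 'M[R]_4).
Variable sigma : 'rV[R]_4 -> 'I_4 -> 'M[R[i]]_2.
Local Notation C := R[i].
Local Notation Ci := (iC R).
Hypothesis oU : open U.
Hypothesis hth0 : frame U g th0.
Hypothesis hS : pauli U g th0 sigma.
Local Notation e := (pauli_frame sigma).

(** A spinor as four real numbers, the form in which two-sheeted coverings are treated. *)
Definition spin_of (w : 'I_4 -> R) : 'rV[C]_2 :=
  \row_a if a == 0 then (w 0 +i* w 1)%C else (w 2 +i* w 3)%C.

Definition real_of (v : 'rV[C]_2) : 'I_4 -> R := fun i =>
  if i == 0 then complex.Re (v 0 0) else if i == 1 then complex.Im (v 0 0)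
  else if i == 2 then complex.Re (v 0 1) else complex.Im (v 0 1).

Lemma real_ofK v : spin_of (real_of v) = v.
Proof.
apply/matrixP => i j; rewrite (ord1 i) mxE /real_of !ordE.
by elim/ord2_ind: j; rewrite !ordE; [case: (v 0 0)|case: (v 0 1)].
Qed.

Lemma spin_ofK w : real_of (spin_of w) = w.
Proof.
by apply/funext => i; rewrite /real_of !mxE !ordE /=; elim/ord4_ind: i; rewrite !ordE.
Qed.

Lemma spin_of_sign (b : bool) w : spin_of (fun i => (-1) ^+ b * w i) = (-1) ^+ b *: spin_of w.
Proof.
apply/matrixP => i j; rewrite !mxE.
by case: b; rewrite ?expr0 ?expr1; case: ifP => _; apply/eqP; rewrite eq_complex /=;
  apply/andP; split; apply/eqP; ring.
Qed.

(** In the standard frame the components [01], [02], [03] determine the squares and the product of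
    the spinor components. *)
Lemma eps_wedge_inj (E : 'M[R]_4) (v w : 'rV[C]_2) : E \in unitmx ->
  (forall al be, eps_wedge (pauli_mx E) v al be = eps_wedge (pauli_mx E) w al be) ->
  exists b : bool, v = (-1) ^+ b *: w.
Proof.
move=> uE H.
have H1 j k : eps_wedge (pauli_mx 1%:M) v j k = eps_wedge (pauli_mx 1%:M) w j k.
  rewrite -(mulmxV uE) !eps_wedge_mul; apply: eq_bigr => a _; apply: eq_bigr => b _.
  by rewrite H.
have [[v1 v2 v3] _] := eps_wedge1 v; have [[w1 w2 w3] _] := eps_wedge1 w.
have h1 := H1 0 1; have h2 := H1 0 2; have h3 := H1 0 3.
rewrite v1 w1 in h1; rewrite v2 w2 in h2; rewrite v3 w3 in h3.
have i0 : Ci != 0.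
  by apply/eqP => i0; have := iC_sqr R; rewrite i0 mulr0 => /eqP; rewrite eq_sym oppr_eq0 oner_eq0.
have two : 2 != 0 :> C by rewrite pnatr_eq0.
have {}h2 := mulfI i0 h2.
have {}h3 : v 0 0 * v 0 1 = w 0 0 * w 0 1.
  by apply: (mulfI two); apply: oppr_inj; rewrite -!mulNr h3.
have ha : v 0 0 * v 0 0 = w 0 0 * w 0 0.
  apply: (mulfI two); transitivity
    ((v 0 0 * v 0 0 - v 0 1 * v 0 1) + (v 0 0 * v 0 0 + v 0 1 * v 0 1)).
    by ring.
  by rewrite h1 h2; ring.
have hb : v 0 1 * v 0 1 = w 0 1 * w 0 1.
  transitivity ((v 0 0 * v 0 0 + v 0 1 * v 0 1) - v 0 0 * v 0 0); first by ring.
  by rewrite h2 ha; ring.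
have [b [e1 e2]] := spinor_pm ha h3 hb; exists b.
by apply/matrixP => i j; rewrite (ord1 i) mxE; elim/ord2_ind: j.
Qed.

Lemma eps_wedge0 (s : 'I_4 -> 'M[C]_2) al be : eps_wedge s 0 al be = 0.
Proof. by rewrite /eps_wedge /wedge11 !mul0mx !mxE; ring. Qed.

(** The fibre of the covering over [y]. The constant [c] is a parameter: existence takes it to be 1,
    uniqueness compares two spinors for a common value. *)
Definition lift_rel (th : 'rV[R]_4 -> 'M[R]_4) (c : C) y (w : 'I_4 -> R) :=
  forall al be, lm th y al be = c * eps_wedge (sigma y) (spin_of w) al be.

Lemma sigma_pauli y : U y -> sigma y = pauli_mx (e y).
Proof. by move=> Uy; apply/funext => a; rewrite (pauli_frameE hS). Qed.

Lemma lift_rel_neq0 th c y w : coframe U g th0 th -> U y -> lift_rel th c y w ->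
  exists i, w i != 0.
Proof.
move=> cth Uy H; apply/not_existsP => nw.
have w0 i : w i = 0 by apply/eqP; rewrite -[_ == _]negbK; apply/negP/nw.
have s0 : spin_of w = 0.
  by apply/matrixP => i j; rewrite !mxE !w0; case: ifP.
have := lmx_neq0 (frame_unit (coframe_frame cth) Uy); move/eqP; apply.
by apply/matrixP => a b; rewrite !mxE -lmE H s0 eps_wedge0 mulr0.
Qed.

Lemma lift_rel_sign th c y w (b : bool) : lift_rel th c y w ->
  lift_rel th c y (fun i => (-1) ^+ b * w i).
Proof.
by move=> H al be; rewrite spin_of_sign eps_wedgeZ -expr2 sqrr_sign mul1r.
Qed.

Lemma lift_rel_fiber th c y w w' : c != 0 -> U y -> lift_rel th c y w -> lift_rel th c y w' ->
  exists b : bool, w' = fun i => (-1) ^+ b * w i.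
Proof.
move=> c0 Uy H H'.
have [|b eb] := @eps_wedge_inj (e y) (spin_of w') (spin_of w) (pauli_frame_unit hth0 hS Uy).
  by move=> al be; apply: (mulfI c0); rewrite -sigma_pauli // -H -H'.
by exists b; rewrite -[w']spin_ofK eb -spin_of_sign spin_ofK.
Qed.

(** One of [spin00], [spin11] is nonzero at [x]: otherwise [spin_det] would make [spin01], and with
    it [l /\ m], vanish. A local root of the nonzero one is one spinor component, and [spin01]
    divided by it is the other. *)
Lemma lift_local th x : coframe U g th0 th -> U x -> exists V s,
  [/\ open V, V x, V `<=` U, (forall y, V y -> lift_rel th 1 y (s y)) &
     forall i, smooth V (fun y => s y i)].
Proof.
move=> cth Ux; have fth := coframe_frame cth; have [fe0 fe1] := pauli_coframe oU hth0 hS.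
have uE y (Uy : U y) := pauli_frame_unit hth0 hS Uy.
have gE y (Uy : U y) := pauli_frame_gram hth0 hS Uy.
pose L y := th y *m invmx (e y).
have Le y : U y -> L y *m e y = th y by move=> Uy; rewrite /L -mulmxA mulVmx ?mulmx1 // uE.
have HL y : U y -> (L y)^T *m eta R *m L y = eta R.
  by move=> Uy; apply: gram_lorentz (uE y Uy) (gE y Uy) (frame_gram fth Uy).
have dL y : U y -> 0 < \det (L y).
  move=> Uy; have [_ /(_ y Uy)[_ dt]] := fth; have [_ /(_ y Uy)[_ de]] := fe0.
  by rewrite -(pmulr_lgt0 _ de) -det_mulmx Le.
have SL i j : smooth U (fun y => L y i j).
  apply: smooth_mulmx => //; first by have [] := fth.
  by apply: smooth_invmx => //; have [] := fe0.
have Sw a b : smoothC U (fun y => wedge11 (lc (L y)) (mc (L y)) a b).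
  have Sl i : smoothC U (fun y => lc (L y) i) by apply: smoothC_real; apply: smoothD.
  have Sm i : smoothC U (fun y => mc (L y) i) by apply: smoothC_pair.
  by apply: smoothCD => //; [|apply: smoothCN => //]; apply: smoothCM.
have S00 : smoothC U (fun y => spin00 (L y)).
  apply: smoothCM => //; last exact: smoothC_cst.
  apply: smoothCD => //; apply: smoothCN => //; apply: smoothCM => //; exact: smoothC_cst.
have S01 : smoothC U (fun y => spin01 (L y)).
  by apply: smoothCM => //; [apply: smoothCN|apply: smoothC_cst].
have S11 : smoothC U (fun y => spin11 (L y)).
  apply: smoothCM => //; last exact: smoothC_cst.
  apply: smoothCD => //; first exact: smoothCN.
  apply: smoothCN => //; apply: smoothCM => //; exact: smoothC_cst.
have main (p q : 'rV[R]_4 -> C) V : open V -> V x -> V `<=` U -> smoothC V p -> smoothC V q ->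
    (forall y, V y -> [/\ p y * p y = spin00 (L y), p y * q y = spin01 (L y) &
       q y * q y = spin11 (L y)]) ->
    exists V s, [/\ open V, V x, V `<=` U, (forall y, V y -> lift_rel th 1 y (s y)) &
     forall i, smooth V (fun y => s y i)].
  move=> oV Vx VU [p1 p2] [q1 q2] H.
  pose xi y : 'rV[C]_2 := \row_a if a == 0 then p y else q y.
  exists V, (fun y => real_of (xi y)); split=> //.
    move=> y Vy; have Uy := VU _ Vy; move=> al be; rewrite real_ofK mul1r lmE -Le // lm_mul.
    rewrite sigma_pauli // -[e y in RHS]mul1mx eps_wedge_mul.
    have [h1 h2 h3] := H y Vy.
    apply: eq_bigr => j _; apply: eq_bigr => k _; congr (_ * _).
    by apply: lm_spin; rewrite ?HL ?dL // !mxE !ordE.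
  move=> i; elim/ord4_ind: i.
  - by apply: (smooth_ext oV) p1 => y _; rewrite /real_of !mxE !ordE.
  - by apply: (smooth_ext oV) p2 => y _; rewrite /real_of !mxE !ordE.
  - by apply: (smooth_ext oV) q1 => y _; rewrite /real_of !mxE !ordE.
  - by apply: (smooth_ext oV) q2 => y _; rewrite /real_of !mxE !ordE.
have [z00|n00] := eqVneq (spin00 (L x)) 0; last first.
  have [V [r [oV Vx VU Sr rr]]] := csqrt_local oU S00 Ux n00.
  apply: (main r (fun y => spin01 (L y) * (r y)^-1) V) => //.
    apply: smoothCM => //; first exact: (smoothC_sub oV VU S01).
    by apply: smoothCV => // y /rr[].
  move=> y Vy; have [e1 r0] := rr y Vy; split=> //; first by field.
  transitivity (spin01 (L y) * spin01 (L y) / (r y * r y)); first by field.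
  rewrite -spin_det ?HL //; last exact: VU.
  rewrite e1 mulrC mulKf // -e1; exact: mulf_neq0.
have n11 : spin11 (L x) != 0.
  apply/eqP => z11.
  have z01 : spin01 (L x) = 0.
    by have := spin_det (HL x Ux); rewrite z00 mul0r => /esym/eqP; rewrite mulf_eq0 orbb => /eqP.
  have uL : L x \in unitmx by rewrite unitmxE unitfE gt_eqF // dL.
  have := lmx_neq0 uL; move/eqP; apply; apply/matrixP => a b; rewrite !mxE.
  rewrite (lm_spin (xi := 0) (HL x Ux) (dL x Ux)) ?eps_wedge0 //.
  - by rewrite !mxE z00 mul0r.
  - by rewrite !mxE z01 mul0r.
  - by rewrite !mxE z11 mul0r.
have [V [r [oV Vx VU Sr rr]]] := csqrt_local oU S11 Ux n11.
apply: (main (fun y => spin01 (L y) * (r y)^-1) r V) => //.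
  apply: smoothCM => //; first exact: (smoothC_sub oV VU S01).
  by apply: smoothCV => // y /rr[].
move=> y Vy; have [e1 r0] := rr y Vy; split=> //; last by field.
transitivity (spin01 (L y) * spin01 (L y) / (r y * r y)); first by field.
rewrite -spin_det ?HL //; last exact: VU.
rewrite e1 mulfK // -e1; exact: mulf_neq0.
Qed.

End Lifting.

(** * The correspondence *)

Section Expi.
Variable R : realType.

(** The arccosine of the real part gives the angle up to sign; the sign of the imaginary part
    decides. *)
Lemma norm1_expi (c : R[i]) : `|c| = 1 -> exists phi : R, c = expi phi.
Proof.
move=> /normc1P; case: c => a b /eqP; rewrite eq_complex /= => /andP[/eqP + _] => h.
have ab : a ^+ 2 + b ^+ 2 = 1 by rewrite -h !expr2; ring.
have a1 : -1 <= a <= 1.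
  rewrite -ler_norml -(@ler_pXn2r _ 2) ?nnegrE // expr1n real_normK ?num_real //.
  by rewrite -ab lerDl sqr_ge0.
have sa : sin (acos a) = `|b|.
  by rewrite sin_acos // -(sqrtr_sqr b) -ab addrAC subrr add0r.
have [b0|b0] := leP 0 b.
  by exists (acos a); rewrite /expi acosK ?in_itv //= sa ger0_norm.
exists (- acos a); rewrite /expi cosN sinN acosK ?in_itv //= sa ltr0_norm //.
by rewrite opprK.
Qed.

Lemma expi_norm1 (phi : R) : `|expi phi| = 1.
Proof.
apply/normc1P; apply/eqP; rewrite eq_complex /=; apply/andP; split; apply/eqP; last by ring.
by rewrite -[RHS](cos2Dsin2 phi) !expr2; ring.
Qed.

End Expi.

(** [K] is total on both sides and saturated for both relations, so it descends to a bijection of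
    classes. Reflexivity and the exchange of representatives come from [KA] and [KB] applied to a
    common partner. *)
Lemma quotient_bij (T S : Type) (A : set T) (B : set S) (eA : T -> T -> Prop)
    (eB : S -> S -> Prop) (K : T -> S -> Prop) :
  (forall x, A x -> exists2 y, B y & K x y) ->
  (forall y, B y -> exists2 x, A x & K x y) ->
  (forall x x' y, A x -> A x' -> B y -> K x y -> (K x' y <-> eA x x')) ->
  (forall x y y', A x -> B y -> B y' -> K x y -> (K x y' <-> eB y y')) ->
  exists F : set T -> set S, set_bij (eq_classes A eA) (eq_classes B eB) F /\
    (forall x y, A x -> B y -> (F (eq_class A eA x) = eq_class B eB y <-> K x y)).
Proof.
move=> totA totB KA KB.
pose F (X : set T) : set S := [set y | B y /\ exists2 x, X x & K x y].
have eArefl x : A x -> eA x x.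
  by move=> Ax; have [y By Kxy] := totA x Ax; apply/(KA x x y).
have eBrefl y : B y -> eB y y.
  by move=> By; have [x Ax Kxy] := totB y By; apply/(KB x y y).
have FE x y : A x -> B y -> K x y -> F (eq_class A eA x) = eq_class B eB y.
  move=> Ax By Kxy; apply/seteqP; split=> y'.
    move=> [By' [x' [Ax' exx'] Kxy']]; split=> //.
    have Kx'y : K x' y by apply/(KA x x' y).
    have Kxy'2 : K x y'.
      apply/(KA x' x y') => //; apply/(KA x' x y) => //.
    by apply/(KB x y y').
  move=> [By' eyy']; split=> //; exists x; first by split=> //; apply: eArefl.
  by apply/(KB x y y').
have classA x y : A x -> B y -> K x y -> eq_class A eA x = [set x' | A x' /\ K x' y].
  move=> Ax By Kxy; apply/seteqP; split=> x' [Ax' h]; split=> //.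
    by apply/(KA x x' y).
  by apply/(KA x x' y).
have FK x y : A x -> B y -> (F (eq_class A eA x) = eq_class B eB y <-> K x y).
  move=> Ax By; split=> [e|]; last exact: FE.
  have : F (eq_class A eA x) y by rewrite e; split=> //; apply: eBrefl.
  move=> [_ [x' [Ax' exx'] Kx'y]]; have [y' By' Kxy'] := totA x Ax.
  have Kx'y' : K x' y' by apply/(KA x x' y').
  by apply/(KA x' x y) => //; apply/(KA x' x y').
exists F; split=> //; split.
- move=> _ [x Ax <-]; have [y By Kxy] := totA x Ax; exists y => //.
  by rewrite (FE x y).
- move=> X X' /set_mem[x Ax <-] /set_mem[x' Ax' <-] e.
  have [y By Kxy] := totA x Ax.
  have Kx'y : K x' y by apply/FK => //; rewrite -e; apply/FK.
  by rewrite (classA x y) // (classA x' y).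
- move=> _ [y By <-]; have [x Ax Kxy] := totB y By.
  by exists (eq_class A eA x); [exists x|apply/FK].
Qed.

Section Correspondence.
Variables (R : realType) (U : set 'rV[R]_4) (g th0 : 'rV[R]_4 -> 'M[R]_4).
Variable sigma : 'rV[R]_4 -> 'I_4 -> 'M[R[i]]_2.
Local Notation C := R[i].
Hypothesis oU : open U.
Hypothesis kU : contractible U.
Hypothesis hth0 : frame U g th0.
Hypothesis hS : pauli U g th0 sigma.

Lemma spin_of_smooth (s : 'rV[R]_4 -> 'I_4 -> R) : (forall i, smooth U (fun y => s y i)) ->
  forall a, smoothC U (fun y => spin_of (s y) 0 a).
Proof.
move=> S; elim/ord2_ind.
  by apply: (smoothC_ext oU) (smoothC_pair (S 0) (S 1)) => y _; rewrite mxE.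
by apply: (smoothC_ext oU) (smoothC_pair (S 2) (S 3)) => y _; rewrite mxE.
Qed.

Lemma real_of_smooth (xi : 'rV[R]_4 -> 'rV[C]_2) : (forall a, smoothC U (fun y => xi y 0 a)) ->
  forall i, smooth U (fun y => real_of (xi y) i).
Proof.
by move=> S; elim/ord4_ind; rewrite /real_of !ordE; have [S0 S0'] := S 0; have [S1 S1'] := S 1.
Qed.

Lemma coframe_spinor th : coframe U g th0 th ->
  exists2 xi, nv_spinor U xi & corresp U sigma th xi.
Proof.
move=> cth; have one0 : 1 != 0 :> C by apply: oner_neq0.
have Ploc x : U x -> exists V s, local_section U (lift_rel sigma th 1) V s /\ V x.
  move=> Ux; have [V [s [oV Vx VU Ps Ss]]] := lift_local oU hth0 hS cth Ux.
  exists V, s; split=> //; split=> // i y Vy.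
  exact: (smooth_continuous (Ss i) Vy).
have [s [Ps sloc]] := contractible_section oU kU
  (fun y v Uy => @lift_rel_neq0 _ _ _ _ sigma th 1 y v cth Uy)
  (fun y v b _ => @lift_rel_sign _ sigma th 1 y v b)
  (fun y v w Uy => @lift_rel_fiber _ _ _ _ _ hth0 hS th 1 y v w one0 Uy) Ploc.
(* Near each point the lift is a fixed sign times a smooth local root; [W] is an open set on which
   this holds. *)
have Ss i : smooth U (fun y => s y i).
  apply: smooth_local => x Ux; have [V [s' [oV Vx VU Ps' Ss']]] := lift_local oU hth0 hS cth Ux.
  have LS : local_section U (lift_rel sigma th 1) V s'.
    split=> // j y Vy; exact: (smooth_continuous (Ss' j) Vy).
  have [b nb] := sloc V s' x LS Vx.
  pose W := interior [set y | V y /\ s y = (fun i => (-1) ^+ b * s' y i)].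
  have oW : open W by apply: open_interior.
  have WV y : W y -> V y /\ s y = (fun i => (-1) ^+ b * s' y i) by apply: interior_subset.
  exists W; split=> //.
  apply: (@smooth_ext _ _ oW (fun y => (-1) ^+ b * s' y i)).
    by move=> y /WV[_ ->].
  apply: smoothM => //; first exact: smooth_cst.
  by apply: smooth_sub (Ss' i) => // y /WV[].
exists (fun y => spin_of (s y)).
  split; first exact: spin_of_smooth.
  move=> y Uy; apply/eqP => s0.
  have [j] := lift_rel_neq0 cth Uy (Ps y Uy); rewrite -[s y]spin_ofK s0.
  by rewrite /real_of !mxE; do 3?case: ifP; rewrite eqxx.
by apply/correspE; exists 1; [rewrite normr1|move=> x Ux al be; rewrite Ps].
Qed.

(** If both spinors correspond to [th], with constants [c] and [c'], scaling [xi] by a root [k] of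
    [c / c'] makes both of them lifts for [c']. They then differ by one global sign, so the factor
    is [k] or [- k]. *)
Lemma corresp_spinor_equiv th xi xi' : coframe U g th0 th -> nv_spinor U xi ->
  nv_spinor U xi' -> corresp U sigma th xi ->
  (corresp U sigma th xi' <-> spinor_equiv U xi xi').
Proof.
move=> cth [S nz] [S' nz'] /correspE[c c1 H].
have nnz (z : C) : `|z| = 1 -> z != 0 by move=> z1; rewrite -normr_eq0 z1 oner_eq0.
split=> [/correspE[c' c1' H']|[k k1 kE]]; last first.
  apply/correspE; exists (c / (k * k)); first by rewrite normrM normfV normrM c1 k1 !mul1r invr1.
  move=> x Ux al be; rewrite kE // eps_wedgeZ H //; have k0 := nnz k k1; by field.
have c0' := nnz c' c1'.
have [|k k1 kk] := @norm1_sqrt R (c / c'); first by rewrite normrM normfV c1 c1' mul1r invr1.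
have sm (x : 'rV[R]_4 -> 'rV[C]_2) : (forall a, smoothC U (fun y => x y 0 a)) ->
    (forall y, U y -> lift_rel sigma th c' y (real_of (x y))) ->
    local_section U (lift_rel sigma th c') U (fun y => real_of (x y)).
  move=> Sx Px; split=> // i y Uy.
  exact: (smooth_continuous (real_of_smooth Sx i) Uy).
have L' : local_section U (lift_rel sigma th c') U (fun y => real_of (xi' y)).
  by apply: sm => // y Uy al be; rewrite real_ofK H'.
have L : local_section U (lift_rel sigma th c') U (fun y => real_of (k *: xi y)).
  apply: sm => [a|y Uy al be].
    apply: (@smoothC_ext _ _ oU (fun y => k * xi y 0 a)) => [y _|]; first by rewrite mxE.
    by apply: smoothCM => //; apply: smoothC_cst.
  rewrite real_ofK eps_wedgeZ kk H // mulrA; congr (_ * _).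
  by rewrite mulrC divfK.
have [b eb] := contractible_section_unique kU
  (fun y v Uy => @lift_rel_neq0 _ _ _ _ sigma th c' y v cth Uy)
  (fun y v b _ => @lift_rel_sign _ sigma th c' y v b)
  (fun y v w Uy => @lift_rel_fiber _ _ _ _ _ hth0 hS th c' y v w c0' Uy) L L'.
exists ((-1) ^+ b * k); first by rewrite normrM k1 mulr1 normrX normrN1 expr1n.
by move=> y Uy; rewrite -[xi' y]real_ofK eb // spin_of_sign real_ofK scalerA.
Qed.

(** The constant phase in the definition of [H] is the quotient [c' / c] of the two constants;
    conversely such a phase is absorbed into the constant. *)
Lemma corresp_coframe_equiv th th' xi : coframe U g th0 th -> coframe U g th0 th' ->
  nv_spinor U xi -> corresp U sigma th xi ->
  (corresp U sigma th' xi <-> coframe_equiv U th th').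
Proof.
move=> cth cth' Hxi /correspE[c c1 H].
have nnz (z : C) : `|z| = 1 -> z != 0 by move=> z1; rewrite -normr_eq0 z1 oner_eq0.
have fth := coframe_frame cth; have fth' := coframe_frame cth'.
have lm_eq (t t' : 'rV[R]_4 -> 'M[R]_4) x : t x = t' x -> lm t x = lm t' x.
  by move=> e; rewrite !lmE e.
split=> [/correspE[c' c1' H']|[L [_ _ [phi HL]] LE]]; last first.
  apply/correspE; exists (expi phi * c); first by rewrite normrM expi_norm1 c1 mul1r.
  move=> x Ux al be; rewrite (lm_eq _ (fun y => L y *m th y)) ?LE // HL // H //.
  by rewrite mulrA.
pose L y := th' y *m invmx (th y).
have Lth y : U y -> L y *m th y = th' y.
  by move=> Uy; rewrite /L -mulmxA mulVmx ?mulmx1 // (frame_unit fth).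
exists L; last by move=> x Ux; rewrite Lth.
split.
- move=> i j; apply: smooth_mulmx => //; first by have [] := fth'.
  apply: smooth_invmx => //; last by have [] := fth.
  by move=> y Uy; apply: (frame_unit fth Uy).
- move=> x Ux; apply/lorentz_mxP; split.
  + exact: gram_lorentz (frame_unit fth Ux) (frame_gram fth Ux) (frame_gram fth' Ux).
  + have [_ /(_ x Ux)[_ d]] := fth; have [_ /(_ x Ux)[_ d']] := fth'.
    by rewrite -(pmulr_lgt0 _ d) -det_mulmx Lth.
  rewrite -(cov_inner_lorentz _ (frame_unit fth Ux) (frame_gram fth Ux)).
  apply: (forward_trans (frame_unit fth Ux) (frame_unit hth0 Ux) (frame_gram fth Ux)
    (frame_gram hth0 Ux) (frame_gram fth' Ux)); last by have [_ /(_ x Ux)] := cth'.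
  apply: forward_sym (frame_unit hth0 Ux) (frame_unit fth Ux) (frame_gram hth0 Ux)
    (frame_gram fth Ux) _.
  by have [_ /(_ x Ux)] := cth.
have [|phi ephi] := @norm1_expi R (c' / c); first by rewrite normrM normfV c1 c1' mul1r invr1.
exists phi => x Ux al be; rewrite (lm_eq _ th') ?Lth // H' // H // -ephi mulrA divfK //.
exact: nnz.
Qed.

End Correspondence.

Theorem theorem2 (R : realType) (U : set 'rV[R]_4)
    (g th0 : 'rV[R]_4 -> 'M[R]_4) (sigma : 'rV[R]_4 -> 'I_4 -> 'M[R[i]]_2)
    (hU : coord_nbhd U)
    (hg : lorentz_metric U g)
    (hth0 : frame U g th0)
    (hS : pauli U g th0 sigma) :
  (exists F : set ('rV[R]_4 -> 'M[R]_4) -> set ('rV[R]_4 -> 'rV[R[i]]_2),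
     set_bij (eq_classes (coframe U g th0) (coframe_equiv U))
             (eq_classes (nv_spinor U) (spinor_equiv U)) F /\
     (forall th xi, coframe U g th0 th -> nv_spinor U xi ->
        (F (eq_class (coframe U g th0) (coframe_equiv U) th)
           = eq_class (nv_spinor U) (spinor_equiv U) xi
         <-> corresp U sigma th xi))) /\
  (forall th xi, coframe U g th0 th -> nv_spinor U xi -> corresp U sigma th xi ->
     forall x, U x -> forall al be ga de,
       (L_tele th x al be ga de)%:C%C
       = - (4 / 3) * L_Weyl g sigma xi x al be ga de).
Proof.
have [oU kU] := hU; split.
  apply: quotient_bij.
  - by move=> th cth; apply: (coframe_spinor oU kU hth0 hS cth).
  - move=> xi Hxi; have [T cT H] := spinor_coframe oU hth0 hS Hxi.
    exists T => //; apply/correspE; exists 1; first by rewrite normr1.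
    by move=> x Ux al be; rewrite H // mul1r.
  - by move=> th th' xi cth cth' Hxi; apply: (corresp_coframe_equiv oU hth0 cth cth' Hxi).
  - by move=> th xi xi' cth Hxi Hxi'; apply: (corresp_spinor_equiv oU kU hth0 hS cth Hxi Hxi').
move=> th xi cth Hxi K.
have [B [z [SB dB sB zc zz]]] := corresp_gauge oU hth0 hS cth Hxi K.
have Sxi : smoothMx U xi by move=> i j; rewrite (ord1 i); apply: (proj1 Hxi).
have sH y al a b : U y -> sigma y al a b = conjc (sigma y al b a).
  by move=> Uy; have [_ /(_ y Uy)[H _ _ _]] := hS.
move=> x Ux al be ga de.
exact: (tele_weyl oU (coframe_frame cth) SB Sxi dB sB sH zc zz).
Qed.
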